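(* Let $H$ be a cocommutative nonlocal vertex bialgebra. Let $V$ be a vertex algebra with a right $H$-comodule vertex algebra structure $\rho$. Suppose that $\{Y_M,Y_M^{-1}\}$ is a commutative subset of $\mathfrak L_H^\rho(V)$, with $Y_M$ and $Y_M^{-1}$ inverses of each other with respect to the operation $*$. Define a linear map $\mathcal S(x):V\otimes V\to V\otimes V\otimes\mathbb C((x))$ by $$\mathcal S(x)(v\otimes u)=\sum Y_M(u_{(2)},-x)v_{(1)}\otimes Y_M^{-1}(v_{(2)},x)u_{(1)}$$ for $u,v\in V$, where $\rho(u)=\sum u_{(1)}\otimes u_{(2)}$ and $\rho(v)=\sum v_{(1)}\otimes v_{(2)}$ in $V\otimes H$. Then $\mathcal S(x)$ is a unitary rational quantum Yang-Baxter operator, and the nonlocal vertex algebra $\mathfrak D_{Y_M}^\rho(V)$ equipped with $\mathcal S(x)$ is a quantum vertex algebra.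
   Context: All vector spaces are over $\mathbb C$; $W((x_1,x_2))=W[[x_1,x_2]][x_1^{-1},x_2^{-1}]$; powers $(x\pm z)^n$ are expanded in nonnegative powers of the second variable. A nonlocal vertex algebra is a vector space $V$ with a linear map $Y(\cdot,x):V\to(\mathrm{End}\,V)[[x,x^{-1}]]$, $Y(v,x)=\sum_{n}v_nx^{-n-1}$, and $\mathbf 1\in V$ such that $Y(u,x)v\in V((x))$; $Y(\mathbf 1,x)v=v$, $Y(v,x)\mathbf 1\in V[[x]]$ with $\lim_{x\to0}Y(v,x)\mathbf 1=v$; and for $u,v\in V$ there is $k\ge 0$ with $(x_1-x_2)^kY(u,x_1)Y(v,x_2)\in \mathrm{Hom}(V,V((x_1,x_2)))$ and $\big((x_1-x_2)^kY(u,x_1)Y(v,x_2)\big)|_{x_1=x_2+x_0}=x_0^kY(Y(u,x_0)v,x_2)$. A vertex algebra is a nonlocal vertex algebra such that for $u,v$ there is $k$ with $(x_1-x_2)^k[Y(u,x_1),Y(v,x_2)]=0$. Homomorphisms and tensor products are the obvious ones. A module $(W,Y_W)$ satisfies the analogous axioms ($Y_W(v,x)w\in W((x))$, $Y_W(\mathbf 1,x)=1_W$, and the displayed property with $Y_W$ for the outer operators). The operator $\mathcal D$ on $V$ is $\mathcal D(v)=v_{-2}\mathbf 1$. A nonlocal vertex bialgebra is a nonlocal vertex algebra $H$ with a coalgebra structure $(\Delta,\varepsilon)$ such that $\Delta:H\to H\otimes H$ and $\varepsilon:H\to\mathbb C$ are homomorphisms of nonlocal vertex algebras. An $H$-module nonlocal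 vertex algebra structure on $V$ is an $H$-module structure $Y_V^H$ on $V$ (for $H$ as a nonlocal vertex algebra) with $Y_V^H(h,x)v\in V\otimes\mathbb C((x))$, $Y_V^H(h,x)\mathbf 1=\varepsilon(h)\mathbf 1$, $Y_V^H(h,x_1)Y(u,x_2)v=\sum Y(Y_V^H(h_{(1)},x_1-x_2)u,x_2)Y_V^H(h_{(2)},x_1)v$. A right $H$-comodule (nonlocal) vertex algebra structure on $V$ is a homomorphism of nonlocal vertex algebras $\rho:V\to V\otimes H$ with $(\rho\otimes1)\rho=(1\otimes\Delta)\rho$, $(1\otimes\varepsilon)\rho=\mathrm{Id}_V$. $Y_V^H$ and $\rho$ are compatible if $\rho(Y_V^H(h,x)v)=(Y_V^H(h,x)\otimes1)\rho(v)$. $\mathfrak L_H^\rho(V)$ is the set of all $H$-module nonlocal vertex algebra structures on $V$ compatible with $\rho$. For $Y_M,Y_M'\in\mathrm{Hom}(H,\mathrm{Hom}(V,V\otimes\mathbb C((x))))$, $(Y_M*Y_M')(h,x)=\sum Y_M(h_{(1)},x)Y_M'(h_{(2)},x)$, where $\mathrm{Hom}(V,V\otimes \mathbb C((x)))\cong \mathrm{End}_{\mathbb C((x))}(V\otimes\mathbb C((x)))$ as an algebra; the identity for $*$ is $Y_M^\varepsilon(h,x)v=\varepsilon(h)v$. $Y_M$ and $Y_M'$ commute if $Y_M(h,x)Y_M'(k,z)=Y_M'(k,z)Y_M(h,x)$ for all $h,k\in H$; a subset of $\mathfrak L_H^\rho(V)$ is commutative if any two of its elements (including an element with itself) commute.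 For $H$ cocommutative and $Y_M\in\mathfrak L_H^\rho(V)$, $\mathfrak D_{Y_M}^\rho(V)$ is the nonlocal vertex algebra with underlying space $V$, vacuum $\mathbf 1$, and vertex operator map $\mathfrak D_{Y_M}^\rho(Y)(a,x)=\sum Y(a_{(1)},x)Y_M(a_{(2)},x)$, $\rho(a)=\sum a_{(1)}\otimes a_{(2)}$. A rational quantum Yang-Baxter operator on $U$ is a linear map $\mathcal S(x):U\otimes U\to U\otimes U\otimes\mathbb C((x))$ with $\mathcal S^{12}(x)\mathcal S^{13}(x+z)\mathcal S^{23}(z)=\mathcal S^{23}(z)\mathcal S^{13}(x+z)\mathcal S^{12}(x)$; it is unitary if $\mathcal S^{21}(x)\mathcal S^{12}(-x)=1$, where $\mathcal S^{21}(x)=\sigma\mathcal S(x)\sigma$ with $\sigma$ the flip. A weak quantum vertex algebra is a nonlocal vertex algebra such that for $u,v$ there exist finitely many $u^{(i)},v^{(i)}\in V$, $f_i(x)\in\mathbb C((x))$ and $k\ge0$ with $(x-z)^kY(u,x)Y(v,z)=(x-z)^k\sum_if_i(z-x)Y(v^{(i)},z)Y(u^{(i)},x)$. Write $Y(x):V\otimes V\to V((x))$ for the map induced by $Y(\cdot,x)$. A quantum vertex algebra is a weak quantum vertex algebra $V$ with a unitary rational quantum Yang-Baxter operator $\mathcal S(x)$ on $V$ such that: for $u,v\in V$ there is $k\ge 0$ with $(x-z)^kY(x)(1\otimes Y(z))(\mathcal S(x-z)(u\otimes v)\otimes w)=(x-z)^kY(z)(1\otimes Y(x))(v\otimes u\otimes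 w)$ for all $w\in V$; $[\mathcal D\otimes1,\mathcal S(x)]=-\frac{d}{dx}\mathcal S(x)$; and $\mathcal S(x)(Y(z)\otimes1)=(Y(z)\otimes1)\mathcal S^{23}(x)\mathcal S^{13}(x+z)$. *)

(* Defs.v *)
From HB Require Import structures.
From mathcomp Require Import all_boot all_order all_algebra.
From mathcomp Require Import boolp classical_sets cardinality fsbigop.
From mathcomp Require Import reals complex ring.

Set Implicit Arguments.
Unset Strict Implicit.
Unset Printing Implicit Defensive.

Import GRing.Theory.

Local Open Scope quotient_scope.
Local Open Scope ring_scope.

Notation is_bilinear f := (bilinear_for *:%R *:%R f).

(** [tensor V W] is the set of formal sums [v_1 (x) w_1 + ... + v_n (x) w_n]
    (scalars are absorbed in the [v_i]), two of them being identified when no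
    bilinear map on [V * W] distinguishes them.  The universal property is
    given by [tsum_linear], [tsum_pure] and [tensor_ext]. *)

Section Tensor.
Variables (F : fieldType) (V W : lmodType F).

Definition tev (U : lmodType F) (f : V -> W -> U) (s : seq (V * W)) : U :=
  \sum_(p <- s) f p.1 p.2.

Definition tequiv (s t : seq (V * W)) : Prop :=
  forall (U : lmodType F) (f : V -> W -> U), is_bilinear f -> tev f s = tev f t.

Definition tequivb (s t : seq (V * W)) : bool := `[< tequiv s t >].

Lemma tequivb_refl : reflexive tequivb.
Proof. by move=> s; apply/asboolP. Qed.

Lemma tequivb_sym : symmetric tequivb.
Proof. by move=> s t; apply/asboolP/asboolP => h U f /h ->. Qed.

Lemma tequivb_trans : transitive tequivb.
Proof.
by move=> t s u /asboolP h1 /asboolP h2; apply/asboolP => U f bf; rewrite h1 ?h2.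
Qed.

Canonical tequiv_rel := EquivRel tequivb tequivb_refl tequivb_sym tequivb_trans.

Definition tensor := {eq_quot tequiv_rel}.

HB.instance Definition _ := Choice.on tensor.
HB.instance Definition _ := Quotient.on tensor.

Lemma tpiP (s t : seq (V * W)) :
  \pi_tensor s = \pi_tensor t <-> tequiv s t.
Proof. by split=> [/eqmodP /asboolP|h] //; apply/eqmodP/asboolP. Qed.

Lemma tequiv_repr (s : seq (V * W)) : tequiv (repr (\pi_tensor s)) s.
Proof. by apply/tpiP; rewrite reprK. Qed.

Definition pure (v : V) (w : W) : tensor := \pi_tensor [:: (v, w)].

(** [tsum f t] is [\sum f v w] over a decomposition [t = \sum v (x) w]; for
    bilinear [f] it is the linear map induced by [f].  It renders Sweedler
    sums. *)
Definition tsum (U : lmodType F) (f : V -> W -> U) (t : tensor) : U :=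
  tev f (repr t).

Definition tadd (s t : tensor) : tensor := \pi_tensor (repr s ++ repr t).
Definition tscale (a : F) (t : tensor) : tensor :=
  \pi_tensor [seq (a *: p.1, p.2) | p <- repr t].
Definition topp (t : tensor) : tensor := tscale (-1) t.
Definition tzero : tensor := \pi_tensor [::].

Section Eval.
Variables (U : lmodType F) (f : V -> W -> U).
Hypothesis bf : is_bilinear f.

Lemma tsum_pi s : tsum f (\pi_tensor s) = tev f s.
Proof. exact: tequiv_repr. Qed.

Lemma tsum_tadd s t : tsum f (tadd s t) = tsum f s + tsum f t.
Proof. by rewrite tsum_pi /tev big_cat. Qed.

Lemma tsum_tscale a t : tsum f (tscale a t) = a *: tsum f t.
Proof.
rewrite tsum_pi /tsum /tev big_map scaler_sumr; apply: eq_bigr => p _ /=.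
exact: (scalable_linear (bf.1 p.2)).
Qed.

Lemma tsum_tzero : tsum f tzero = 0.
Proof. by rewrite tsum_pi /tev big_nil. Qed.

Lemma tsum_pure v w : tsum f (pure v w) = f v w.
Proof. by rewrite tsum_pi /tev big_seq1. Qed.

End Eval.

Lemma tsum_eqP (s t : tensor) :
  (forall (U : lmodType F) (f : V -> W -> U),
     is_bilinear f -> tsum f s = tsum f t) -> s = t.
Proof. by move=> h; rewrite -[s]reprK -[t]reprK; apply/tpiP. Qed.

Lemma taddA : associative tadd.
Proof. by move=> a b c; apply: tsum_eqP => U f bf; rewrite !tsum_tadd // addrA. Qed.

Lemma taddC : commutative tadd.
Proof. by move=> a b; apply: tsum_eqP => U f bf; rewrite !tsum_tadd // addrC. Qed.

Lemma tadd0 : left_id tzero tadd.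
Proof.
by move=> a; apply: tsum_eqP => U f bf; rewrite tsum_tadd // tsum_tzero // add0r.
Qed.

Lemma taddN : left_inverse tzero topp tadd.
Proof.
move=> a; apply: tsum_eqP => U f bf.
by rewrite tsum_tadd // tsum_tscale // tsum_tzero // scaleN1r addNr.
Qed.

HB.instance Definition _ := GRing.isZmodule.Build tensor taddA taddC tadd0 taddN.

Lemma tscaleA (a b : F) (t : tensor) : tscale a (tscale b t) = tscale (a * b) t.
Proof. by apply: tsum_eqP => U f bf; rewrite !tsum_tscale // scalerA. Qed.

Lemma tscale1 : left_id 1 tscale.
Proof. by move=> t; apply: tsum_eqP => U f bf; rewrite tsum_tscale // scale1r. Qed.

Lemma tscaleDr : right_distributive tscale +%R.
Proof.
move=> a s t; apply: tsum_eqP => U f bf.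
by rewrite tsum_tscale // !tsum_tadd // !tsum_tscale // scalerDr.
Qed.

Lemma tscaleDl (t : tensor) : {morph tscale^~ t : a b / a + b}.
Proof.
move=> a b; apply: tsum_eqP => U f bf.
by rewrite tsum_tadd // !tsum_tscale // scalerDl.
Qed.

HB.instance Definition _ :=
  GRing.Zmodule_isLmodule.Build F tensor tscaleA tscale1 tscaleDr tscaleDl.

Lemma tsum_linear (U : lmodType F) (f : V -> W -> U) :
  is_bilinear f -> linear (tsum f).
Proof. by move=> bf a s t; rewrite tsum_tadd // tsum_tscale. Qed.

Lemma pure_bilinear : is_bilinear pure.
Proof.
split=> [w a u v|v a u w]; apply: tsum_eqP => U f bf;
  rewrite tsum_tadd // tsum_tscale // !tsum_pure //.
  exact: bf.1.
exact: bf.2.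
Qed.

Lemma tensorE (t : tensor) : t = tsum pure t.
Proof.
apply: tsum_eqP => U f bf.
have fD : {morph tsum f : a b / a + b >-> a + b} := tsum_tadd bf.
have -> : tsum pure t = \sum_(p <- repr t) pure p.1 p.2 by [].
rewrite (big_morph (tsum f) fD (tsum_tzero bf)).
by apply: eq_bigr => p _; rewrite tsum_pure.
Qed.

Lemma tensor_ext (U : lmodType F) (f g : {linear tensor -> U}) :
  (forall v w, f (pure v w) = g (pure v w)) -> f =1 g.
Proof.
move=> h t; rewrite (tensorE t) /tsum /tev !linear_sum.
by apply: eq_bigr => p _; exact: h.
Qed.

End Tensor.

Notation "v ⊗ w" := (pure v w) (at level 40, left associativity) : ring_scope.

Section TensorMaps.
Variable F : fieldType.

Definition tmap (V V' W W' : lmodType F) (f : V -> V') (g : W -> W')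
    (t : tensor V W) : tensor V' W' :=
  tsum (fun v w => f v ⊗ g w) t.

Definition tswap (V W : lmodType F) (t : tensor V W) : tensor W V :=
  tsum (fun v w => w ⊗ v) t.

Definition tassoc (U V W : lmodType F) (t : tensor (tensor U V) W) :
    tensor U (tensor V W) :=
  tsum (fun p w => tsum (fun u v => u ⊗ (v ⊗ w)) p) t.

Definition tassocV (U V W : lmodType F) (t : tensor U (tensor V W)) :
    tensor (tensor U V) W :=
  tsum (fun u p => tsum (fun v w => (u ⊗ v) ⊗ w) p) t.

End TensorMaps.

(** A series in [W[[x, x^-1]]] is the function [int -> W] of its coefficients:
    [s n] is the coefficient of [x^n].  A series in two variables is a function
    [int -> int -> W], the first index being the exponent of the first variable.

    A sum [\sum_(i \in A) f i] is [0] when [f] has infinite support on [A].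
    Wherever such a sum is used below, its support is finite because of the
    membership conditions ([W((x))], [W((x1, x2))], [W (x) C((x))]) imposed on
    the series involved. *)

(** Generalized binomial coefficient, with values in [int]: for [n = - m - 1] it
    is [(-1)^j * 'C(m + j, j)]; see [binzE]. *)
Definition binz (n : int) (j : nat) : int :=
  match n with
  | Posz m => Posz 'C(m, j)
  | Negz m => (-1) ^+ j * Posz 'C(m + j, j)
  end.

Lemma binzE (n : int) (j : nat) :
  binz n j * Posz j`! = \prod_(i < j) (n - Posz i).
Proof.
case: n => m /=.
  rewrite -PoszM bin_ffact; elim: j => [|j ih]; first by rewrite big_ord0.
  rewrite big_ord_recr /= -ih ffactnSr PoszM.
  case: (leqP j m) => [le_jm|lt_mj]; first by rewrite subzn.
  by rewrite ffact_small // !mul0r.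
elim: j => [|j ih]; first by rewrite big_ord0 addn0 bin0 mulr1.
rewrite big_ord_recr /= -ih exprS factS PoszM.
have -> : Negz m - Posz j = - Posz (m + j).+1.
  by rewrite NegzE -opprD -PoszD addSn.
have e : Posz j.+1 * Posz 'C(m + j.+1, j.+1) = Posz (m + j).+1 * Posz 'C(m + j, j).
  by rewrite -!PoszM addnS mul_bin_diag.
rewrite [LHS](_ : _ = - ((-1) ^+ j * Posz j`! *
  (Posz j.+1 * Posz 'C(m + j.+1, j.+1)))); last by ring.
by rewrite e; ring.
Qed.

Section Series.
Variable F : fieldType.
Implicit Types W : lmodType F.

(** [W((x))] *)
Definition truncated (W : zmodType) (s : int -> W) : Prop :=
  exists N : int, forall n, n < N -> s n = 0.

(** [W((x1, x2))] *)
Definition truncated2 (W : zmodType) (s : int -> int -> W) : Prop :=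
  exists N : int, forall m n, (m < N) || (n < N) -> s m n = 0.

(** [W (x) C((x))], as a subspace of [W((x))] *)
Definition finite_laurent W (s : int -> W) : Prop :=
  exists (k : nat) (w : 'I_k -> W) (f : 'I_k -> int -> F),
    (forall i, truncated (f i)) /\ forall n, s n = \sum_(i < k) f i n *: w i.

Definition const_series (W : zmodType) (w : W) : int -> W :=
  fun n => if n == 0 then w else 0.

(** [s(-x)] *)
Definition neg_series W (s : int -> W) : int -> W :=
  fun n => (-1) ^+ `|n|%N *: s n.

(** [s(x + e z)], in nonnegative powers of [z], for [e = 1] or [e = -1] *)
Definition expand (e : int) (W : zmodType) (s : int -> W) : int -> int -> W :=
  fun m n =>
    match n with
    | Posz j => s (m + Posz j) *~ (e ^+ j * binz (m + Posz j) j)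
    | Negz _ => 0
    end.

Definition expand_add := expand 1.
Definition expand_sub := expand (-1).

(** [(x1 - x2)^k s(x1, x2)] *)
Definition mul_sub_pow (k : nat) (W : zmodType) (s : int -> int -> W) :
    int -> int -> W :=
  fun m n => \sum_(i < k.+1)
    s (m - Posz (k - i)) (n - Posz i) *~ ((-1) ^+ i * Posz 'C(k, i)).

(** [s(x1, x2)] at [x1 = x2 + x0], in nonnegative powers of [x0]; the result is
    a series in [(x0, x2)], and [s] is meant to lie in [W((x1, x2))]. *)
Definition subst_x1 (W : zmodType) (s : int -> int -> W) : int -> int -> W :=
  fun i p =>
    match i with
    | Posz j => \sum_(m \in [set: int]) s m (p + Posz j - m) *~ binz m j
    | Negz _ => 0
    end.

(** A map [A : T -> int -> W] is an operator series [A(x)], [A t n] being the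
    coefficient of [x^n] in [A(x) t].  [act1 A s] is [A(x) s(x)], and [act2 A s]
    is [A(x, z) s(x, z)]. *)
Definition act1 (T : Type) (W : zmodType) (A : T -> int -> W) (s : int -> T) :
    int -> W :=
  fun n => \sum_(m \in [set: int]) A (s m) (n - m).

Definition act2 (T : Type) (W : zmodType) (A : T -> int -> int -> W)
    (s : int -> int -> T) : int -> int -> W :=
  fun m n => \sum_(p \in [set: int * int]) A (s p.1 p.2) (m - p.1) (n - p.2).

(** [A(x)], [A(z)] and [A(x + z)] as operator series in [(x, z)] *)
Definition in_x (T : Type) (W : zmodType) (A : T -> int -> W) :
    T -> int -> int -> W :=
  fun t m n => if n == 0 then A t m else 0.

Definition in_z (T : Type) (W : zmodType) (A : T -> int -> W) :
    T -> int -> int -> W :=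
  fun t m n => if m == 0 then A t n else 0.

Definition in_xz (T : Type) (W : zmodType) (A : T -> int -> W) :
    T -> int -> int -> W :=
  fun t => expand_add (A t).

End Series.

Section VertexAlgebras.
Variable F : fieldType.

(** [vop A u v n] is the coefficient of [x^n] in [Y(u, x)v], that is
    [u_{-n-1} v]. *)
Record vertex_struct (V : lmodType F) := VertexStruct {
  vac : V;
  vop : V -> V -> int -> V
}.

(** [(x1 - x2)^k Y_W(u, x1) Y_W(v, x2)] lies in [Hom(W, W((x1, x2)))] and
    becomes [x0^k Y_W(Y(u, x0)v, x2)] at [x1 = x2 + x0]. *)
Definition weak_associativity (V W : lmodType F) (Y : V -> V -> int -> V)
    (YW : V -> W -> int -> W) : Prop :=
  forall u v : V, exists k : nat, forall w : W,
    let s := mul_sub_pow k (fun m n => YW u (YW v w n) m) in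
    truncated2 s /\
    forall i p : int, subst_x1 s i p = YW (Y u v (i - Posz k)) w p.

Record nva_module (V : lmodType F) (A : vertex_struct V) (W : lmodType F)
    (YW : V -> W -> int -> W) : Prop := {
  nvam_bilinear : forall n : int, is_bilinear (fun v w => YW v w n);
  nvam_truncated : forall v w, truncated (YW v w);
  nvam_vac : forall w n, YW (vac A) w n = const_series w n;
  nvam_assoc : weak_associativity (vop A) YW
}.

Record nonlocal_vertex_algebra (V : lmodType F) (A : vertex_struct V) : Prop := {
  nva_self : nva_module A (vop A);
  nva_regular : forall v n, n < 0 -> vop A v (vac A) n = 0;
  nva_limit : forall v, vop A v (vac A) 0 = v
}.

Record vertex_algebra (V : lmodType F) (A : vertex_struct V) : Prop := {
  va_nva : nonlocal_vertex_algebra A;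
  va_local : forall u v, exists k : nat, forall w m n,
    mul_sub_pow k
      (fun m n => vop A u (vop A v w n) m - vop A v (vop A u w m) n) m n = 0
}.

(** [v_{-2} 1] *)
Definition vD (V : lmodType F) (A : vertex_struct V) (v : V) : V :=
  vop A v (vac A) 1.

Record nva_hom (V W : lmodType F) (A : vertex_struct V) (B : vertex_struct W)
    (f : {linear V -> W}) : Prop := {
  hom_vac : f (vac A) = vac B;
  hom_vop : forall u v n, f (vop A u v n) = vop B (f u) (f v) n
}.

Definition tensor_struct (V W : lmodType F) (A : vertex_struct V)
    (B : vertex_struct W) : vertex_struct (tensor V W) :=
  {| vac := vac A ⊗ vac B;
     vop := fun s t n =>
       tsum (fun u h => tsum (fun v k =>
         \sum_(m \in [set: int]) vop A u v m ⊗ vop B h k (n - m)) t) s |}.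

Definition scalar_struct : vertex_struct F^o :=
  {| vac := 1; vop := fun a b => const_series (a * b) |}.

End VertexAlgebras.

Section Bialgebras.
Variables (F : fieldType) (H : lmodType F) (AH : vertex_struct H).
Variables (Delta : {linear H -> tensor H H}) (eps : {linear H -> F^o}).

Record coalgebra : Prop := {
  coalg_coassoc : forall h, tassoc (tmap Delta id (Delta h)) = tmap id Delta (Delta h);
  coalg_counitl : forall h, tsum (fun a b => eps a *: b) (Delta h) = h;
  coalg_counitr : forall h, tsum (fun a b => eps b *: a) (Delta h) = h
}.

Record nonlocal_vertex_bialgebra : Prop := {
  bialg_nva : nonlocal_vertex_algebra AH;
  bialg_coalg : coalgebra;
  bialg_Delta : nva_hom AH (tensor_struct AH AH) Delta;
  bialg_eps : nva_hom AH (scalar_struct F) eps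
}.

Definition cocommutative : Prop := forall h, tswap (Delta h) = Delta h.

Variables (V : lmodType F) (A : vertex_struct V).

(** The last clause equates the coefficients of [x1^m x2^n] in
    [Y_H(h, x1) Y(u, x2) v] and in
    [\sum Y(Y_H(h_(1), x1 - x2) u, x2) Y_H(h_(2), x1) v]. *)
Record module_nva (YH : H -> V -> int -> V) : Prop := {
  mnva_module : nva_module AH YH;
  mnva_laurent : forall h v, finite_laurent (YH h v);
  mnva_vac : forall h n, YH h (vac A) n = const_series (eps h *: vac A) n;
  mnva_vop : forall h u v m n,
    YH h (vop A u v n) m =
    tsum (fun h1 h2 =>
      act2 (fun c m n => vop A c (YH h2 v m) n) (expand_sub (YH h1 u)) m n)
      (Delta h)
}.

Variable rho : {linear V -> tensor V H}.

Record comodule_nva : Prop := {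
  cnva_hom : nva_hom A (tensor_struct A AH) rho;
  cnva_coassoc : forall v, tassoc (tmap rho id (rho v)) = tmap id Delta (rho v);
  cnva_counit : forall v, tsum (fun v1 h => eps h *: v1) (rho v) = v
}.

Definition compatible (YH : H -> V -> int -> V) : Prop :=
  forall h v n, rho (YH h v n) = tmap (fun v1 => YH h v1 n) id (rho v).

Definition compatible_structs : set (H -> V -> int -> V) :=
  [set YH | module_nva YH /\ compatible YH]%classic.

Definition ops_commute (Y Y' : H -> V -> int -> V) : Prop :=
  forall h k v m n, Y h (Y' k v n) m = Y' k (Y h v m) n.

Definition commutative_subset (S : set (H -> V -> int -> V)) : Prop :=
  (S `<=` compatible_structs)%classic /\
  forall Y Y', S Y -> S Y' -> ops_commute Y Y'.

Definition conv (Y Y' : H -> V -> int -> V) : H -> V -> int -> V :=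
  fun h v n => tsum (fun h1 h2 => act1 (Y h1) (Y' h2 v) n) (Delta h).

Definition conv_unit : H -> V -> int -> V := fun h v => const_series (eps h *: v).

Definition conv_inverses (Y Y' : H -> V -> int -> V) : Prop :=
  conv Y Y' = conv_unit /\ conv Y' Y = conv_unit.

(** The vertex operator map is [\sum Y(a_(1), x) Y_M(a_(2), x)]. *)
Definition deformation (YM : H -> V -> int -> V) : vertex_struct V :=
  {| vac := vac A;
     vop := fun a b n =>
       tsum (fun a1 a2 => act1 (vop A a1) (YM a2 b) n) (rho a) |}.

(** [v (x) u] is sent to
    [\sum Y_M(u_(2), -x) v_(1) (x) Y_M^-1(v_(2), x) u_(1)]. *)
Definition smap (YM YMinv : H -> V -> int -> V) :
    tensor V V -> int -> tensor V V :=
  fun t n =>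
    tsum (fun v u =>
      tsum (fun v1 v2 => tsum (fun u1 u2 =>
        \sum_(m \in [set: int])
          neg_series (YM u2 v1) m ⊗ YMinv v2 u1 (n - m)) (rho u)) (rho v)) t.

End Bialgebras.

Section QuantumYangBaxter.
Variables (F : fieldType) (U : lmodType F).
Variable S : tensor U U -> int -> tensor U U.

(** [U (x) U (x) U] is [(U (x) U) (x) U]. *)
Let U3 := tensor (tensor U U) U.

Definition tswap23 (t : U3) : U3 := tassocV (tmap id (@tswap F U U) (tassoc t)).

Definition S12 (t : U3) (n : int) : U3 := tmap (fun p => S p n) id t.
Definition S23 (t : U3) (n : int) : U3 := tassocV (tmap id (fun p => S p n) (tassoc t)).
Definition S13 (t : U3) (n : int) : U3 := tswap23 (S12 (tswap23 t) n).
Definition S21 (t : tensor U U) (n : int) : tensor U U := tswap (S (tswap t) n).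

Record rational_qyb_operator : Prop := {
  qyb_linear : forall n, linear (fun t => S t n);
  qyb_laurent : forall t, finite_laurent (S t);
  qyb_eq : forall (t : U3) (m n : int),
    act2 (in_x S12) (act2 (in_xz S13) (in_z S23 t)) m n =
    act2 (in_z S23) (act2 (in_xz S13) (in_x S12 t)) m n
}.

Definition unitary_operator : Prop :=
  forall t n, act1 S21 (neg_series (S t)) n = const_series t n.

End QuantumYangBaxter.

Section QuantumVertexAlgebras.
Variables (F : fieldType) (V : lmodType F) (A : vertex_struct V).

(** [f_i(z - x)] is expanded in nonnegative powers of [x]; the first index is
    the exponent of [x]. *)
Record weak_quantum_vertex_algebra : Prop := {
  wqva_nva : nonlocal_vertex_algebra A;
  wqva_local : forall u v : V,
    exists (k N : nat) (u' v' : 'I_N -> V) (f : 'I_N -> int -> F),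
      (forall i, truncated (f i)) /\
      forall w m n,
        mul_sub_pow k (fun m n => vop A u (vop A v w n) m) m n =
        mul_sub_pow k (fun m n => \sum_(i < N)
          act2 (fun (c : F) m n => c *: vop A (v' i) (vop A (u' i) w m) n)
            (fun m n => expand_sub (f i) n m) m n) m n
}.

(** [Y(x)(1 (x) Y(z))(t (x) w)] for [t] in [V (x) V] *)
Definition vop2 (w : V) (t : tensor V V) (m n : int) : V :=
  tsum (fun a b => vop A a (vop A b w n) m) t.

(** [Y(x) (x) 1] on [(V (x) V) (x) V] *)
Definition vop_id (t : tensor (tensor V V) V) (n : int) : tensor V V :=
  tmap (fun p => tsum (fun a b => vop A a b n) p) id t.

Record quantum_vertex_algebra (S : tensor V V -> int -> tensor V V) : Prop := {
  qva_weak : weak_quantum_vertex_algebra;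
  qva_qyb : rational_qyb_operator S;
  qva_unitary : unitary_operator S;
  qva_local : forall u v : V, exists k : nat, forall w m n,
    mul_sub_pow k (act2 (vop2 w) (expand_sub (S (u ⊗ v)))) m n =
    mul_sub_pow k (fun m n => vop A v (vop A u w m) n) m n;
  qva_D : forall t n,
    tmap (vD A) id (S t n) - S (tmap (vD A) id t) n =
    - (S t (n + 1) *~ (n + 1));
  qva_hexagon : forall (t : tensor (tensor V V) V) m n,
    S (vop_id t n) m =
    act2 (in_z vop_id) (act2 (in_x (S23 S)) (in_xz (S13 S) t)) m n
}.

End QuantumVertexAlgebras.

(* Main.v *)
(** For i <> j let E_ij(x) be the operator on a tensor power of V by which slot i acts on
    slot j through rho and Y_M, and let F_ij(x) be the same for the inverse structure.  The
    deformed product is Y'(x) = Y(x) E_12(x), and S(x) = E_21(-x) F_12(x).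
    Cocommutativity, compatibility with rho and commutativity of {Y_M, Y_M^-1} make all
    coefficients of all these operators commute.  This gives the Yang-Baxter equation, and
    unitarity follows because F_ij is inverse to E_ij.  The module and comodule axioms
    become exchange rules moving E past a product:
      E_{1,(23)}(x) (1 (x) Y(z)) = (1 (x) Y(z)) E_12(x - z) E_13(x),
      E_{(12),3}(x) (Y(z) (x) 1) = (Y(z) (x) 1) E_13(x + z) E_23(x),
    and these imply the hexagon identity.  They also give
      Y'(x1) (1 (x) Y'(x2)) = Y(x1) (1 (x) Y(x2)) E_12(x1 - x2) E_13(x1) E_23(x2),
    so weak associativity passes from Y to Y', the substitution x1 = x2 + x0 being
    multiplicative.  In the S-locality relation the factor F_12 of S cancels E_12, and both
    sides reduce to locality of V. *)
Require Import Defs.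
From HB Require Import structures.
From mathcomp Require Import all_boot all_order all_algebra.
From mathcomp Require Import boolp classical_sets functions cardinality fsbigop.
From mathcomp Require Import reals complex zify ring.

Set Implicit Arguments.
Unset Strict Implicit.
Unset Printing Implicit Defensive.

Import Order.TTheory GRing.Theory Num.Theory.

Local Open Scope ring_scope.

(** Two finiteness questions shape the proof. A sum over an infinite index type is 0 by default
    unless its support is finite, so every interchange of sums needs a bound on a joint support.
    Such bounds hold because a series in W ⊗ C((x)) has coefficients in a finite-dimensional space,
    on which an operator that truncates each vector truncates uniformly. Negative powers of x + z
    contain arbitrarily low powers of x, so two-variable operators are kept in W((x))((z)) rather
    than in W((x, z)). Moreover, the exponent k in weak associativity and in S-locality must be
    chosen before w. The factors E_13(x1) E_23(x2) use only the coactions of u and v, so slots 1 and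
    2 stay in the span of finitely many u_(1) ⊗ v_(1), whatever w is. On that span the poles of
    E_12(x1 - x2) have order at most some C. The factor (x1 - x2)^C makes it a power series in x1 -
    x2, which may be expanded in either order and becomes a series in x0 under x1 = x2 + x0. The
    image again involves finitely many generators in slots 1 and 2, on which one exponent K serves
    for V itself. Hence k = K + C. *)

Section Linear.
Variable F : fieldType.
Implicit Types U V W X : lmodType F.

Lemma lin0 V W (f : V -> W) : linear f -> f 0 = 0.
Proof. by move=> lf; have := lf (-1) 0 0; rewrite scaler0 addr0 scaleN1r addNr. Qed.

Lemma linD V W (f : V -> W) : linear f -> {morph f : a b / a + b}.
Proof. by move=> lf a b; rewrite -[a]scale1r lf !scale1r. Qed.

Lemma linZ V W (f : V -> W) : linear f -> forall a v, f (a *: v) = a *: f v.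
Proof. by move=> lf a v; rewrite -[a *: v]addr0 lf lin0 // addr0. Qed.

Lemma linN V W (f : V -> W) : linear f -> {morph f : a / - a}.
Proof. by move=> lf a; rewrite -scaleN1r linZ // scaleN1r. Qed.

Lemma linMz V W (f : V -> W) : linear f -> forall v n, f (v *~ n) = f v *~ n.
Proof. by move=> lf v n; rewrite -!scaler_int linZ. Qed.

Lemma lin_big V W (f : V -> W) I (r : seq I) (E : I -> V) :
  linear f -> f (\sum_(i <- r) E i) = \sum_(i <- r) f (E i).
Proof. by move=> lf; apply: (big_morph f (linD lf) (lin0 lf)). Qed.

Lemma lin_tsum U V W X (f : V -> W) (g : U -> X -> V) t :
  linear f -> f (tsum g t) = tsum (fun a b => f (g a b)) t.
Proof. exact: lin_big. Qed.

Lemma eq_tsum V W X (f g : V -> W -> X) t :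
  (forall a b, f a b = g a b) -> tsum f t = tsum g t.
Proof. by move=> e; rewrite /tsum /tev; apply: eq_bigr => p _; exact: e. Qed.

Lemma tsum_exchange U V W X (Y : lmodType F) (f : U -> V -> W -> X -> Y) s t :
  tsum (fun a b => tsum (fun c d => f a b c d) t) s =
  tsum (fun c d => tsum (fun a b => f a b c d) s) t.
Proof. exact: exchange_big. Qed.

Lemma lin_id V : linear (fun x : V => x).
Proof. by []. Qed.

Lemma lin_comp U V W (g : V -> W) (f : U -> V) :
  linear g -> linear f -> linear (fun x => g (f x)).
Proof. by move=> lg lf a u v; rewrite lf lg. Qed.

Lemma lin_fun U V W (g : {linear V -> W}) (f : U -> V) :
  linear f -> linear (fun x => g (f x)).
Proof. by apply: lin_comp; apply: linearP. Qed.

Lemma lin_add U V (f g : U -> V) :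
  linear f -> linear g -> linear (fun x => f x + g x).
Proof. by move=> lf lg a u v; rewrite lf lg scalerDr addrACA. Qed.

Lemma lin_mulz U V (f : U -> V) n : linear f -> linear (fun x => f x *~ n).
Proof. by move=> lf a u v; rewrite lf mulrzDl -!scaler_int !scalerA mulrC. Qed.

Lemma lin_scale U V (f : U -> V) (c : F) :
  linear f -> linear (fun x => c *: f x).
Proof. by move=> lf a u v; rewrite lf scalerDr !scalerA mulrC. Qed.

Lemma lin_scalel U V (f : U -> F^o) (w : V) :
  linear f -> linear (fun x => (f x : F) *: w).
Proof. by move=> lf a u v; rewrite lf scalerDl scalerA. Qed.

Lemma lin_sum U V I (r : seq I) (E : U -> I -> V) :
  (forall i, linear (E^~ i)) -> linear (fun x => \sum_(i <- r) E x i).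
Proof.
move=> lE a u v; rewrite scaler_sumr -big_split; apply: eq_bigr => i _.
exact: lE.
Qed.

Lemma lin_0 U V : linear (fun _ : U => 0 : V).
Proof. by move=> a u v; rewrite scaler0 addr0. Qed.

Lemma bilinP U V W (f : U -> V -> W) :
  (forall v, linear (f^~ v)) -> (forall u, linear (f u)) -> is_bilinear f.
Proof. by split. Qed.

Lemma lin_pure1 U V W (f : U -> V) (w : W) :
  linear f -> linear (fun x => f x ⊗ w).
Proof. by move=> lf a u v; rewrite lf (pure_bilinear V W).1. Qed.

Lemma lin_pure2 U V W (f : U -> V) (w : W) :
  linear f -> linear (fun x => w ⊗ f x).
Proof. by move=> lf a u v; rewrite lf (pure_bilinear W V).2. Qed.

Lemma lin_tsumf U V W X (f : U -> V -> W -> X) t :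
  (forall a b, linear (fun x => f x a b)) -> linear (fun x => tsum (f x) t).
Proof. by move=> lf; apply: lin_sum => p; apply: lf. Qed.

Lemma lin_tsumt U V W X (f : V -> W -> X) (g : U -> tensor V W) :
  (forall w, linear (f^~ w)) -> (forall v, linear (f v)) -> linear g ->
  linear (fun x => tsum f (g x)).
Proof.
by move=> l1 l2 lg; apply: (lin_comp (g := tsum f)) => //; apply: tsum_linear.
Qed.

Lemma lin_tmap U V V' W W' (f : V -> V') (g : W -> W') (h : U -> tensor V W) :
  linear f -> linear g -> linear h -> linear (fun x => tmap f g (h x)).
Proof.
move=> lf lg lh; apply: lin_tsumt => // [w|v].
  exact: lin_pure1.
exact: lin_pure2.
Qed.

Lemma tsumE V W X (f : V -> W -> X) v w :
  (forall w, linear (f^~ w)) -> (forall v, linear (f v)) ->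
  tsum f (v ⊗ w) = f v w.
Proof. by move=> l1 l2; apply: tsum_pure. Qed.

Lemma tmapE V V' W W' (f : V -> V') (g : W -> W') v w :
  linear f -> linear g -> tmap f g (v ⊗ w) = f v ⊗ g w.
Proof.
by move=> lf lg; rewrite /tmap tsumE // => ?; [apply: lin_pure1|apply: lin_pure2].
Qed.

Lemma tsum_pureE V W X (f : tensor V W -> X) t :
  linear f -> f t = tsum (fun v w => f (v ⊗ w)) t.
Proof. by move=> lf; rewrite {1}(tensorE t) lin_tsum. Qed.

Lemma ext2 V W X (f g : tensor V W -> X) :
  linear f -> linear g -> (forall v w, f (v ⊗ w) = g (v ⊗ w)) -> f =1 g.
Proof.
by move=> lf lg e t; rewrite (tsum_pureE t lf) (tsum_pureE t lg); apply: eq_tsum.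
Qed.

Lemma ext3 U V W X (f g : tensor (tensor U V) W -> X) :
  linear f -> linear g ->
  (forall u v w, f (u ⊗ v ⊗ w) = g (u ⊗ v ⊗ w)) -> f =1 g.
Proof.
move=> lf lg e; apply: ext2 => // p w.
by apply: (ext2 (f := fun p => f (p ⊗ w)) (g := fun p => g (p ⊗ w))) => //;
  apply: lin_comp => //; apply: lin_pure1; apply: lin_id.
Qed.

End Linear.

(** Linearity is kept as a bare predicate, since most maps are partial applications of unbundled
    families; the tactic rebuilds it from the shape of the body. *)
Ltac lin1 := first
  [ exact: lin_id | exact: lin_0 | solve [auto 2 with nocore]
  | apply: lin_pure1 | apply: lin_pure2 | apply: lin_add
  | apply: lin_mulz | apply: lin_scale
  | apply: lin_tsumf => ? ? | apply: lin_tsumt => [?|?|]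
  | apply: lin_tmap | apply: lin_fun | apply: lin_scalel ].
Ltac lin := repeat (cbv beta; lin1).

(** * Finite sums over infinite index types *)

Section FiniteSums.
Variable I : choiceType.
Implicit Type W : zmodType.

Definition fsupp W (f : I -> W) : Prop :=
  exists s : seq I, forall i, i \notin s -> f i = 0.

Lemma fsumE W (f : I -> W) (s : seq I) :
  uniq s -> (forall i, i \notin s -> f i = 0) ->
  \sum_(i \in [set: I]) f i = \sum_(i <- s) f i.
Proof.
move=> us f0; rewrite (fsbigE s) // => [|i _]; last exact: f0.
by apply: eq_bigl => i; rewrite in_setT. Qed.

Lemma eq_fsum W (f g : I -> W) : f =1 g ->
  \sum_(i \in [set: I]) f i = \sum_(i \in [set: I]) g i.
Proof. by move=> e; apply: eq_fsbigr => i _; exact: e. Qed.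

Lemma fsum0 W (f : I -> W) : (forall i, f i = 0) -> \sum_(i \in [set: I]) f i = 0.
Proof. by move=> f0; apply: fsbig1 => i _; exact: f0. Qed.

Lemma fsuppP W (f : I -> W) : fsupp f ->
  exists2 s, uniq s & forall i, i \notin s -> f i = 0.
Proof.
by case=> s f0; exists (undup s); rewrite ?undup_uniq // => i; rewrite mem_undup; apply: f0.
Qed.

(** The default value 0 of a sum with infinite support satisfies [P] as well. *)
Lemma fsum_ind W (P : W -> Prop) (f : I -> W) :
  P 0 -> (forall x y, P x -> P y -> P (x + y)) -> (forall i, P (f i)) ->
  P (\sum_(i \in [set: I]) f i).
Proof. by move=> P0 PD Pf; apply: big_ind => // i _; exact: Pf. Qed.

Lemma fsum_one W (f : I -> W) i0 :
  (forall i, i != i0 -> f i = 0) -> \sum_(i \in [set: I]) f i = f i0.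
Proof.
by move=> f0; rewrite (fsumE (s := [:: i0])) ?big_seq1 // => i; rewrite inE; apply: f0.
Qed.

End FiniteSums.

(** If the joint support were infinite, the right side would default to 0 while the left one could
    be finite row by row and nonzero. *)
Lemma fsum_pair (I J : choiceType) (W : zmodType) (f : I -> J -> W) :
  fsupp (fun p : I * J => f p.1 p.2) ->
  \sum_(i \in [set: I]) \sum_(j \in [set: J]) f i j =
  \sum_(p \in [set: I * J]) f p.1 p.2.
Proof.
case=> s f0; pose s1 := undup (map fst s); pose s2 := undup (map snd s).
have f12 i j : (i \notin s1) || (j \notin s2) -> f i j = 0.
  move=> h; apply: (f0 (i, j)); apply: contraL h => ijs.
  by rewrite negb_or !negbK !mem_undup (map_f fst ijs) (map_f snd ijs).
rewrite (fsumE (s := s1)) ?undup_uniq //; last first.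
  by move=> i i1; apply: fsum0 => j; rewrite f12 ?i1.
rewrite (fsumE (s := [seq (i, j) | i <- s1, j <- s2])); first last.
- move=> [i j] /= ijs; apply: f12; rewrite -negb_and.
  by apply: contra ijs => /andP[i1 j2]; apply/allpairsP; exists (i, j).
- by rewrite allpairs_uniq ?undup_uniq // => -[? ?] [? ?].
rewrite big_allpairs; apply: eq_bigr => i _.
by rewrite (fsumE (s := s2)) ?undup_uniq // => j j2; rewrite f12 ?j2 ?orbT.
Qed.

(** The two supports are in bijection, so both sums also take the default value 0 together. *)
Lemma fsum_inj (I J : choiceType) (W : zmodType) (h : J -> I) (f : I -> W) : injective h ->
  (forall i, (forall j, h j <> i) -> f i = 0) ->
  \sum_(i \in [set: I]) f i = \sum_(j \in [set: J]) f (h j).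
Proof.
move=> hi f0.
have hb : set_bij [set: J]%classic (h @` [set: J])%classic h.
  by apply: inj_bij => x y _ _; apply: hi.
rewrite -(reindex_fsbig _ _ _ _ hb) -(@fsbig_widen _ _ _ _ (h @` setT)%classic) //.
move=> i [_ hi'] /=; apply: f0 => j e; apply: hi'; exists j => //.
Qed.

Lemma fsum_bij (I J : choiceType) (W : zmodType) (h : J -> I) (k : I -> J) (f : I -> W) :
  cancel h k -> cancel k h ->
  \sum_(i \in [set: I]) f i = \sum_(j \in [set: J]) f (h j).
Proof.
move=> hk kh; apply: fsum_inj; first exact: can_inj hk.
by move=> i /(_ (k i)); rewrite kh.
Qed.

Lemma fsupp_inj (I J : choiceType) (W : zmodType) (h : J -> I) (k : I -> J) (f : I -> W) :
  cancel h k -> fsupp f -> fsupp (fun j => f (h j)).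
Proof.
move=> hk [s f0]; exists (map k s) => j js; apply: f0; apply: contra js => hs.
by rewrite -(hk j) map_f.
Qed.

Lemma fsum_exchange (I J : choiceType) (W : zmodType) (f : I -> J -> W) :
  fsupp (fun p : I * J => f p.1 p.2) ->
  \sum_(i \in [set: I]) \sum_(j \in [set: J]) f i j =
  \sum_(j \in [set: J]) \sum_(i \in [set: I]) f i j.
Proof.
move=> fs; pose h p : I * J := (p.2, p.1); pose k p : J * I := (p.2, p.1).
have hk : cancel h k by case.
have kh : cancel k h by case.
rewrite fsum_pair // fsum_pair; last exact: (fsupp_inj hk fs).
exact: fsum_bij hk kh.
Qed.

Section LinearSums.
Variables (F : fieldType) (I : choiceType).
Implicit Types U V W : lmodType F.

Lemma lin_fsum_comm V W (A : V -> W) (f : I -> V) : linear A -> fsupp f ->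
  A (\sum_(i \in [set: I]) f i) = \sum_(i \in [set: I]) A (f i).
Proof.
move=> lA /fsuppP[s us f0]; rewrite (fsumE us f0) (fsumE us) ?lin_big //.
by move=> i /f0 ->; exact: lin0.
Qed.

Lemma fsupp_lin V W (A : V -> W) (f : I -> V) : linear A -> fsupp f ->
  fsupp (fun i => A (f i)).
Proof. by move=> lA [s f0]; exists s => i /f0 ->; exact: lin0. Qed.

Lemma fsupp_cat V W (f : I -> V) (g : I -> W) : fsupp f -> fsupp g ->
  exists2 s, uniq s & forall i, i \notin s -> f i = 0 /\ g i = 0.
Proof.
case=> s f0 [t g0]; exists (undup (s ++ t)); rewrite ?undup_uniq // => i.
by rewrite mem_undup mem_cat negb_or => /andP[/f0 -> /g0 ->].
Qed.

Lemma fsum_lin_comb W (f g : I -> W) a : fsupp f -> fsupp g ->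
  \sum_(i \in [set: I]) (a *: f i + g i) =
  a *: (\sum_(i \in [set: I]) f i) + \sum_(i \in [set: I]) g i.
Proof.
move=> ff fg; have [s us fg0] := fsupp_cat ff fg.
rewrite !(fsumE us); try by move=> i /fg0[e1 e2]; rewrite ?e1 ?e2 ?scaler0 ?addr0.
by rewrite big_split scaler_sumr.
Qed.

Lemma fsumD W (f g : I -> W) : fsupp f -> fsupp g ->
  \sum_(i \in [set: I]) (f i + g i) =
  \sum_(i \in [set: I]) f i + \sum_(i \in [set: I]) g i.
Proof.
move=> ff fg; rewrite -[X in X + _]scale1r -fsum_lin_comb //.
by apply: eq_fsum => i; rewrite scale1r.
Qed.

Lemma lin_fsum U W (E : U -> I -> W) :
  (forall i, linear (E^~ i)) -> (forall u, fsupp (E u)) ->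
  linear (fun x => \sum_(i \in [set: I]) E x i).
Proof.
move=> lE fE a u v; rewrite -fsum_lin_comb //; apply: eq_fsum => i; exact: lE.
Qed.

Lemma fsupp_big (J : Type) W (r : seq J) (f : J -> I -> W) :
  (forall j, fsupp (f j)) -> fsupp (fun i => \sum_(j <- r) f j i).
Proof.
move=> fs; elim: r => [|j r [s f0]]; first by exists [::] => i _; rewrite big_nil.
have [s' f0'] := fs j; exists (s' ++ s) => i.
by rewrite mem_cat negb_or => /andP[is' is0]; rewrite big_cons f0' // f0 // addr0.
Qed.

Lemma fsum_big (J : Type) W (r : seq J) (f : J -> I -> W) :
  (forall j, fsupp (f j)) ->
  \sum_(i \in [set: I]) \sum_(j <- r) f j i =
  \sum_(j <- r) \sum_(i \in [set: I]) f j i.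
Proof.
move=> fs; elim: r => [|j r ih].
  by rewrite big_nil fsum0 // => i; rewrite big_nil.
rewrite big_cons -ih -fsumD //; last exact: fsupp_big.
by apply: eq_fsum => i; rewrite big_cons.
Qed.

Lemma fsupp_tsum U V W (f : U -> V -> I -> W) t :
  (forall a b, fsupp (f a b)) -> fsupp (fun i => tsum (fun a b => f a b i) t).
Proof. by move=> fs; apply: fsupp_big => p; apply: fs. Qed.

Lemma fsum_tsum U V W (f : U -> V -> I -> W) t : (forall a b, fsupp (f a b)) ->
  tsum (fun a b => \sum_(i \in [set: I]) f a b i) t =
  \sum_(i \in [set: I]) tsum (fun a b => f a b i) t.
Proof. by move=> fs; rewrite fsum_big. Qed.

End LinearSums.

Lemma fsum_shift (W : zmodType) (f : int -> W) (a : int) :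
  \sum_(i \in [set: int]) f i = \sum_(i \in [set: int]) f (i + a).
Proof.
by apply: (fsum_bij (h := fun i => i + a) (k := fun i => i - a)) => i;
  rewrite ?addrK ?subrK.
Qed.

Lemma fsum_sub (W : zmodType) (f : int -> W) (a : int) :
  \sum_(i \in [set: int]) f i = \sum_(i \in [set: int]) f (a - i).
Proof.
by apply: (fsum_bij (h := fun i => a - i) (k := fun i => a - i)) => i; rewrite subKr.
Qed.

(** For b < a the list is not empty. This is harmless: it contains the interval from a to b, and the
    summands vanish elsewhere. *)
Definition irange (a b : int) : seq int := [seq a + Posz i | i <- iota 0 `|b - a|.+1].

Lemma mem_irange (a b n : int) : a <= n -> n <= b -> n \in irange a b.
Proof.
move=> an nb; apply/mapP; exists `|n - a|%N; last by lia.
by rewrite mem_iota; lia.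
Qed.

Lemma fsupp_int (W : zmodType) (f : int -> W) a b :
  (forall n, (n < a) || (b < n) -> f n = 0) -> fsupp f.
Proof.
move=> f0; exists (irange a b) => n h; apply: f0.
by apply: contraR h; rewrite negb_or -!leNgt => /andP[]; apply: mem_irange.
Qed.

Lemma fsupp_int2 (W : zmodType) (f : int * int -> W) a b :
  (forall p, [|| p.1 < a, b < p.1, p.2 < a | b < p.2] -> f p = 0) -> fsupp f.
Proof.
move=> f0; exists [seq (m, n) | m <- irange a b, n <- irange a b] => -[m n] h.
apply: f0; apply: contraR h; rewrite !negb_or -!leNgt => /and4P[*].
by apply/allpairsP; exists (m, n); split=> //; apply: mem_irange.
Qed.

Lemma fsupp_prod (W : zmodType) (I J : choiceType) (f : I * J -> W)
    (s : seq I) (t : seq J) :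
  (forall i j, (i \notin s) || (j \notin t) -> f (i, j) = 0) -> fsupp f.
Proof.
move=> f0; exists [seq (i, j) | i <- s, j <- t] => -[i j] h; apply: f0.
rewrite -negb_and; apply: contra h => /andP[? ?]; apply/allpairsP.
by exists (i, j).
Qed.

(** * Laurent series with coefficients in a finite-dimensional subspace *)

Section Spans.
Variable F : fieldType.
Implicit Types T U V W X : lmodType F.

Definition subspace W (P : W -> Prop) : Prop :=
  P 0 /\ forall a x y, P x -> P y -> P (a *: x + y).

(** The impredicative form makes extension of a linear property from the generators to their span a
    mere application. *)
Definition inspan W (l : seq W) (w : W) : Prop :=
  forall P : W -> Prop, subspace P -> (forall x, x \in l -> P x) -> P w.

Definition finspan (I : Type) W (g : I -> W) : Prop :=
  exists l, forall i, inspan l (g i).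

Lemma subspaceD W (P : W -> Prop) x y : subspace P -> P x -> P y -> P (x + y).
Proof. by case=> _ PD Px Py; rewrite -[x]scale1r; apply: PD. Qed.

Lemma subspaceMz W (P : W -> Prop) x n : subspace P -> P x -> P (x *~ n).
Proof. by case=> P0 PD Px; rewrite -scaler_int -[_ *: _]addr0; apply: PD. Qed.

Lemma subspace_fsum W (P : W -> Prop) (I : choiceType) (f : I -> W) :
  subspace P -> (forall i, P (f i)) -> P (\sum_(i \in [set: I]) f i).
Proof. by move=> sP; apply: fsum_ind; [case: sP|move=> x y; apply: subspaceD]. Qed.

Lemma inspanP W (l : seq W) : subspace (inspan l).
Proof.
split=> [P [] //|a x y lx ly P sP lP].
by apply: sP.2; [apply: lx|apply: ly].
Qed.

Lemma inspan_gen W (l : seq W) x : x \in l -> inspan l x.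
Proof. by move=> xl P _; apply. Qed.

Lemma inspan_trans W (l l' : seq W) w :
  (forall x, x \in l -> inspan l' x) -> inspan l w -> inspan l' w.
Proof. by move=> ll' lw; apply: (lw (inspan l')) => //; apply: inspanP. Qed.

Lemma inspan_cat W (l l' : seq W) w : inspan l w \/ inspan l' w -> inspan (l ++ l') w.
Proof.
by case; apply: inspan_trans => x xl; apply: inspan_gen; rewrite mem_cat xl ?orbT.
Qed.

Lemma finspan_comp (I J : Type) W (g : I -> W) (h : J -> I) :
  finspan g -> finspan (fun j => g (h j)).
Proof. by case=> l lg; exists l => j. Qed.

Lemma eq_finspan (I : Type) W (f g : I -> W) : f =1 g -> finspan f -> finspan g.
Proof. by move=> e [l h]; exists l => i; rewrite -e. Qed.

Lemma finspan_cst (I : Type) W (w : W) : finspan (fun _ : I => w).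
Proof. by exists [:: w] => _; apply: inspan_gen; rewrite mem_seq1. Qed.

Lemma finspan0 (I : Type) W (f : I -> W) : (forall i, f i = 0) -> finspan f.
Proof. by move=> f0; exists [::] => i; rewrite f0; case: (inspanP [::] : @subspace W _). Qed.

Lemma finspanMz (I : Type) W (g : I -> W) (k : I -> int) :
  finspan g -> finspan (fun i => g i *~ k i).
Proof.
by case=> l lg; exists l => i; apply: (subspaceMz (P := inspan l)) => //; apply: inspanP.
Qed.

Lemma finspanZ (I : Type) W (g : I -> W) (k : I -> F) :
  finspan g -> finspan (fun i => k i *: g i).
Proof.
case=> l lg; exists l => i; rewrite -[_ *: _]addr0.
by apply: (inspanP l).2 => //; case: (inspanP l).
Qed.

Lemma finspan_if (I : Type) W (b : I -> bool) (g h : I -> W) :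
  finspan g -> finspan h -> finspan (fun i => if b i then g i else h i).
Proof.
case=> l lg [l' lh]; exists (l ++ l') => i; apply: inspan_cat.
by case: (b i); [left|right].
Qed.

Lemma finspanD (I : Type) W (g h : I -> W) :
  finspan g -> finspan h -> finspan (fun i => g i + h i).
Proof.
case=> l lg [l' lh]; exists (l ++ l') => i; apply: (subspaceD (P := inspan (l ++ l'))) => //.
- exact: inspanP.
- by apply: inspan_cat; left.
- by apply: inspan_cat; right.
Qed.

Lemma finspan_big (I J : Type) W (r : seq J) (g : J -> I -> W) :
  (forall j, finspan (g j)) -> finspan (fun i => \sum_(j <- r) g j i).
Proof.
move=> fg; elim: r => [|j r ih]; first by apply: finspan0 => i; rewrite big_nil.
have := finspanD (fg j) ih; apply: eq_finspan => i; by rewrite big_cons.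
Qed.

Lemma finspan_tsum (I : Type) U V W (t : tensor U V) (g : U -> V -> I -> W) :
  (forall u v, finspan (g u v)) -> finspan (fun i => tsum (fun u v => g u v i) t).
Proof. by move=> fg; apply: finspan_big => p; apply: fg. Qed.

Lemma finspan_lin (I : Type) V W (g : I -> V) (A : V -> W) :
  linear A -> finspan g -> finspan (fun i => A (g i)).
Proof.
move=> lA [l lg]; exists (map A l) => i.
apply: (lg i (fun v => inspan (map A l) (A v))) => [|x xl].
  split=> [|a x y lx ly]; first by rewrite lin0 //; case: (inspanP (map A l)).
  by rewrite lA; apply: (inspanP (map A l)).2.
by apply: inspan_gen; apply: map_f.
Qed.

Lemma finspan_op (I J : Type) V W (g : I -> V) (A : V -> J -> W) :
  (forall j, linear (A^~ j)) -> (forall v, finspan (A v)) -> finspan g ->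
  finspan (fun p : I * J => A (g p.1) p.2).
Proof.
move=> lA fA [l lg].
have [L hL] : exists L, forall x, x \in l -> forall j, inspan L (A x j).
  elim: l {lg} => [|y l [L hL]]; first by exists [::].
  have [L' hL'] := fA y; exists (L' ++ L) => x; rewrite inE => /orP[/eqP->|xl] j.
    by apply: inspan_cat; left.
  by apply: inspan_cat; right; apply: hL.
exists L => -[i j] /=; move: j.
apply: (lg i (fun v => forall j, inspan L (A v j))) => //; split=> [j|a x y hx hy j].
  by rewrite (lin0 (lA j)); case: (inspanP L).
by rewrite lA; apply: (inspanP L).2.
Qed.

(** [Q N] is a filtration by subspaces, stronger for larger [N]; the least of the finitely many
    bounds of the generators holds on their whole span. *)
Lemma finspan_unif (I : Type) W (g : I -> W) (Q : int -> W -> Prop) :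
  finspan g -> (forall N, subspace (Q N)) ->
  (forall M N w, M <= N -> Q N w -> Q M w) -> (forall w, exists N, Q N w) ->
  exists N, forall i, Q N (g i).
Proof.
move=> [l lg] sQ mQ eQ.
suff [N hN] : exists N, forall x, x \in l -> Q N x by exists N => i; apply: (lg i (Q N)).
elim: l {lg} => [|y l [N hN]]; first by exists 0.
have [M hM] := eQ y; exists (Order.min M N) => x; rewrite inE => /orP[/eqP->|/hN].
  by apply: mQ hM; lia.
by apply: mQ; lia.
Qed.

End Spans.

(** * Operator series in one variable *)

Section OneVariable.
Variable F : fieldType.
Implicit Types T U V W X : lmodType F.

Definition lin_op T W (A : T -> int -> W) : Prop := forall n, linear (fun t => A t n).

Definition trunc_op T W (A : T -> int -> W) : Prop :=
  lin_op A /\ forall t, truncated (A t).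

(** Encodes membership in [W (x) F((x))]. *)
Definition flaurent W (s : int -> W) : Prop := truncated s /\ finspan s.

Definition fl_op T W (A : T -> int -> W) : Prop :=
  lin_op A /\ forall t, flaurent (A t).

Lemma fl_trunc T W (A : T -> int -> W) : fl_op A -> trunc_op A.
Proof. by case=> lA sA; split=> // t; case: (sA t). Qed.

Lemma subspace_trunc T W (A : T -> int -> W) N : lin_op A ->
  subspace (fun t => forall n, n < N -> A t n = 0).
Proof.
move=> lA; split=> [n _|a x y hx hy n nN]; first by rewrite (lin0 (lA n)).
by rewrite lA hx // hy // scaler0 addr0.
Qed.

(** This is what finite-dimensional spans are for: bounds of [A] that depend on the vector become
    one bound along [g]. *)
Lemma trunc_unif (I : Type) T W (A : T -> int -> W) (g : I -> T) :
  trunc_op A -> finspan g -> exists N, forall i n, n < N -> A (g i) n = 0.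
Proof.
move=> [lA tA] fg; apply: (finspan_unif (Q := fun N t => forall n, n < N -> A t n = 0)) => //.
  by move=> N; exact: (@subspace_trunc _ _ A N lA).
by move=> M N w MN h n nM; apply: h; lia.
Qed.

Lemma act1_bound T W (A : T -> int -> W) s : trunc_op A -> flaurent s ->
  exists N, forall m n, (m < N) || (n < N) -> A (s m) n = 0.
Proof.
move=> wA [[N1 h1] fs]; have [N2 h2] := trunc_unif wA fs.
exists (Order.min N1 N2) => m n /orP[h|h]; last by apply: h2; lia.
by rewrite h1 ?(lin0 (wA.1 n)) //; lia.
Qed.

Lemma act1_supp T W (A : T -> int -> W) s n : trunc_op A -> flaurent s ->
  fsupp (fun m => A (s m) (n - m)).
Proof.
move=> wA ss; have [N h] := act1_bound wA ss.
by apply: (@fsupp_int _ _ N (n - N)) => m hm; apply: h; lia.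
Qed.

Lemma act1_trunc T W (A : T -> int -> W) s : trunc_op A -> flaurent s -> truncated (act1 A s).
Proof.
move=> wA ss; have [N h] := act1_bound wA ss.
by exists (N + N) => n hn; apply: fsum0 => m; apply: h; lia.
Qed.

Lemma act1_ss T W (A : T -> int -> W) s : fl_op A -> flaurent s -> flaurent (act1 A s).
Proof.
move=> sA ss; split; first exact: (act1_trunc (fl_trunc sA) ss).
have [L hL] : finspan (fun p : int * int => A (s p.1) p.2).
  exact: (finspan_op sA.1 (fun v => (sA.2 v).2) ss.2).
exists L => n; apply: (subspace_fsum (P := inspan L)) => [|m]; first exact: inspanP.
exact: (hL (m, n - m)).
Qed.

Lemma act1_lin T V W (A : V -> int -> W) (B : T -> int -> V) : trunc_op A -> fl_op B ->
  lin_op (fun t => act1 A (B t)).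
Proof.
move=> wA sB n; apply: lin_fsum => [m|t]; last by apply: act1_supp => //; apply: sB.2.
by move=> a u v /=; rewrite sB.1 wA.1.
Qed.

Lemma trunc_op_comp T V W (A : V -> int -> W) (B : T -> int -> V) : trunc_op A -> fl_op B ->
  trunc_op (fun t => act1 A (B t)).
Proof.
move=> wA sB; split=> [|t]; first exact: act1_lin.
by apply: act1_trunc => //; apply: sB.2.
Qed.

Lemma fl_op_comp T V W (A : V -> int -> W) (B : T -> int -> V) : fl_op A -> fl_op B ->
  fl_op (fun t => act1 A (B t)).
Proof.
move=> sA sB; split=> [|t]; first by apply: act1_lin => //; apply: fl_trunc.
by apply: act1_ss => //; apply: sB.2.
Qed.

Lemma act1_comm T (A B : T -> int -> T) s : (forall m n t, A (B t m) n = B (A t n) m) ->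
  act1 A (B s) = act1 B (A s).
Proof.
move=> AB; apply/funext => n; rewrite /act1 [LHS](fsum_sub _ n).
by apply: eq_fsum => m; rewrite AB subKr.
Qed.

(** All coefficients of all [B (s p)] lie in one finite-dimensional space, so [A] has a common bound
    on them and the double sum has finite support. *)
Lemma act1_assoc T V W (A : V -> int -> W) (B : T -> int -> V) s :
  trunc_op A -> fl_op B -> flaurent s ->
  act1 A (act1 B s) = act1 (fun t => act1 A (B t)) s.
Proof.
move=> wA sB ss; apply/funext => n; have wB := fl_trunc sB.
have fB : finspan (fun p : int * int => B (s p.1) p.2).
  exact: (finspan_op sB.1 (fun v => (sB.2 v).2) ss.2).
have [N hN] := act1_bound wB ss.
have [M hM] := trunc_unif wA fB.
transitivity (\sum_(m \in [set: int]) \sum_(p \in [set: int])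
    A (B (s p) (m - p)) (n - m)).
  apply: eq_fsum => m; rewrite (lin_fsum_comm (wA.1 (n - m))) //.
  exact: act1_supp.
rewrite fsum_exchange; last first.
  apply: (@fsupp_int2 _ _ (Order.min N (N + N)) (Order.max (n - M) (n - M - N))).
  move=> [m p] /= h; have [hp|hp] := boolP ((p < N) || (m - p < N)).
    by rewrite hN // (lin0 (wA.1 _)).
  by apply: (hM (p, m - p)); lia.
apply: eq_fsum => p; rewrite (fsum_shift _ p); apply: eq_fsum => m.
by rewrite addrK opprD addrA (addrC n) -addrA addrC -addrA.
Qed.

Lemma act1_congr T W (A B : T -> int -> W) s :
  (forall m, A (s m) = B (s m)) -> act1 A s = act1 B s.
Proof. by move=> e; apply/funext => n; apply: eq_fsum => m; rewrite e. Qed.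

End OneVariable.

(** * Operator series with values in W((x))((z)) *)

Section TwoVariables.
Variable F : fieldType.
Implicit Types T U V W : lmodType F.

(** [zlaurent s] says that [s] lies in [W((x))((z))]. *)
Definition zlaurent W (s : int -> int -> W) : Prop :=
  forall X : int, exists N : int, forall m n, n <= X -> (m < N) || (n < N) -> s m n = 0.

Definition flaurent2 W (s : int -> int -> W) : Prop :=
  zlaurent s /\ finspan (fun p : int * int => s p.1 p.2).

Definition lin_op2 T W (A : T -> int -> int -> W) : Prop :=
  forall m n, linear (fun t => A t m n).

Definition trunc_op2 T W (A : T -> int -> int -> W) : Prop :=
  lin_op2 A /\ forall t, zlaurent (A t).

Definition fl_op2 T W (A : T -> int -> int -> W) : Prop :=
  lin_op2 A /\ forall t, flaurent2 (A t).

Lemma fl_trunc2 T W (A : T -> int -> int -> W) : fl_op2 A -> trunc_op2 A.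
Proof. by case=> lA sA; split=> // t; case: (sA t). Qed.

Lemma zlaurent_unif (I : Type) T W (A : T -> int -> int -> W) (g : I -> T) :
  trunc_op2 A -> finspan g ->
  forall X : int, exists N : int, forall i m n,
    n <= X -> (m < N) || (n < N) -> A (g i) m n = 0.
Proof.
move=> [lA zA] fg X; apply: (finspan_unif (Q := fun N t => forall m n,
  n <= X -> (m < N) || (n < N) -> A t m n = 0)) => //.
- move=> N; split=> [m n _ _|a x y hx hy m n nX nN]; first by rewrite (lin0 (lA m n)).
  by rewrite lA hx // hy // scaler0 addr0.
- by move=> M N w MN h m n nX nM; apply: h => //; lia.
- by move=> t; apply: zA.
Qed.

Lemma zlaurent_low W (s : int -> int -> W) : zlaurent s -> exists N, forall m n, n < N -> s m n = 0.
Proof.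
move=> /(_ 0)[N h]; exists (Order.min N 0) => m n hn; apply: h; lia.
Qed.

Lemma zlaurent_unif_low (I : Type) T W (A : T -> int -> int -> W) (g : I -> T) :
  trunc_op2 A -> finspan g -> exists N, forall i m n, n < N -> A (g i) m n = 0.
Proof.
move=> wA fg; have [N h] := zlaurent_unif wA fg 0.
by exists (Order.min N 0) => i m n hn; apply: h; lia.
Qed.

(** Lower bounds on [q] and [n] together with q + n <= X bound both from above, and for bounded
    powers of z the powers of x are bounded below. *)
Lemma act2_bound T W (A : T -> int -> int -> W) s X : trunc_op2 A -> flaurent2 s ->
  exists N, forall p q m n, q + n <= X ->
    [|| p < N, q < N, m < N | n < N] -> A (s p q) m n = 0.
Proof.
move=> wA [zs fs]; have [N1 h1] := zlaurent_low zs; have [N2 h2] := zlaurent_unif_low wA fs.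
have [N3 h3] := zs (X - N2); have [N4 h4] := zlaurent_unif wA fs (X - N1).
exists (Order.min (Order.min N1 N2) (Order.min N3 N4)) => p q m n qn h.
have [q1|q1] := ltP q N1; first by rewrite h1 // (lin0 (wA.1 _ _)).
have [n2|n2] := ltP n N2; first exact: (h2 (p, q)).
have [p3|p3] := ltP p N3.
  by rewrite h3 ?p3 ?(lin0 (wA.1 _ _)) //; lia.
by apply: (h4 (p, q)); lia.
Qed.

Lemma act2_supp T W (A : T -> int -> int -> W) s m n : trunc_op2 A -> flaurent2 s ->
  fsupp (fun p : int * int => A (s p.1 p.2) (m - p.1) (n - p.2)).
Proof.
move=> wA ss; have [N h] := act2_bound n wA ss.
by apply: (@fsupp_int2 _ _ N (Order.max (m - N) (n - N))) => -[p q] /= hp; apply: h; lia.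
Qed.

Lemma act2_zlaurent T W (A : T -> int -> int -> W) s :
  trunc_op2 A -> flaurent2 s -> zlaurent (act2 A s).
Proof.
move=> wA ss X; have [N h] := act2_bound X wA ss.
by exists (N + N) => m n nX hn; apply: fsum0 => -[p q] /=; apply: h; lia.
Qed.

Lemma act2_span T W (A : T -> int -> int -> W) s : fl_op2 A ->
  finspan (fun p : int * int => s p.1 p.2) ->
  finspan (fun p : int * int => act2 A s p.1 p.2).
Proof.
move=> sA fs.
have [L hL] := finspan_op (A := fun t (p : int * int) => A t p.1 p.2)
  (fun p => sA.1 p.1 p.2) (fun t => (sA.2 t).2) fs.
exists L => -[m n] /=; apply: (subspace_fsum (P := inspan L)) => [|[p q] /=].
  exact: inspanP.
exact: (hL ((p, q), (m - p, n - q))).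
Qed.

Lemma act2_ss T W (A : T -> int -> int -> W) s : fl_op2 A -> flaurent2 s -> flaurent2 (act2 A s).
Proof.
move=> sA [zs fs]; split; last exact: act2_span.
by apply: act2_zlaurent => //; apply: fl_trunc2.
Qed.

Lemma act2_lin T V W (A : V -> int -> int -> W) (B : T -> int -> int -> V) :
  trunc_op2 A -> fl_op2 B -> lin_op2 (fun t => act2 A (B t)).
Proof.
move=> wA sB m n; apply: lin_fsum => [p|t]; last exact: (act2_supp _ _ wA (sB.2 t)).
by move=> a u v /=; rewrite sB.1 wA.1.
Qed.

Lemma trunc_op2_comp T V W (A : V -> int -> int -> W) (B : T -> int -> int -> V) :
  trunc_op2 A -> fl_op2 B -> trunc_op2 (fun t => act2 A (B t)).
Proof.
move=> wA sB; split=> [|t]; first exact: act2_lin.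
exact: (act2_zlaurent wA (sB.2 t)).
Qed.

Lemma fl_op2_comp T V W (A : V -> int -> int -> W) (B : T -> int -> int -> V) :
  fl_op2 A -> fl_op2 B -> fl_op2 (fun t => act2 A (B t)).
Proof.
move=> sA sB; split=> [|t]; first by apply: act2_lin => //; apply: fl_trunc2.
exact: (act2_ss sA (sB.2 t)).
Qed.

Lemma act2_congr (T : Type) W (A B : T -> int -> int -> W) s :
  (forall p q, A (s p q) = B (s p q)) -> act2 A s = act2 B s.
Proof. by move=> e; apply/funext => m; apply/funext => n; apply: eq_fsum => p; rewrite e. Qed.

Lemma act2_comm T (A B : T -> int -> int -> T) t :
  (forall p q m n, A (B t p q) m n = B (A t m n) p q) ->
  act2 A (B t) = act2 B (A t).
Proof.
move=> AB; apply/funext => m; apply/funext => n; rewrite /act2.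
rewrite [LHS](fsum_bij (h := fun p : int * int => (m - p.1, n - p.2))
  (k := fun p : int * int => (m - p.1, n - p.2))) => [|[p q]|[p q]] /=; rewrite ?subKr //.
by apply: eq_fsum => -[p q] /=; rewrite AB !subKr.
Qed.

Lemma act2_assoc T V W (A : V -> int -> int -> W) (B : T -> int -> int -> V) s :
  trunc_op2 A -> fl_op2 B -> flaurent2 s ->
  act2 A (act2 B s) = act2 (fun t => act2 A (B t)) s.
Proof.
move=> wA sB ss; apply/funext => m; apply/funext => n; have wB := fl_trunc2 sB.
have fB : finspan (fun p : (int * int) * (int * int) =>
    B (s p.1.1 p.1.2) p.2.1 p.2.2).
  exact: (finspan_op (A := fun t (p : int * int) => B t p.1 p.2)
    (fun p => sB.1 p.1 p.2) (fun t => (sB.2 t).2) ss.2).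
(* [A] contributes a power of z at least [M], so [s] and [B] share at most [n - M]. Each of these
   contributes at least [N], which leaves at most [n - N - N] for [A]. *)
have [M hM] := zlaurent_unif_low wA fB.
have [N hN] := act2_bound (n - M) wB ss.
have [L hL] := zlaurent_unif wA fB (n - N - N).
transitivity (\sum_(p \in [set: int * int]) \sum_(q \in [set: int * int])
    A (B (s q.1 q.2) (p.1 - q.1) (p.2 - q.2)) (m - p.1) (n - p.2)).
  apply: eq_fsum => p; rewrite (lin_fsum_comm (wA.1 _ _)) //.
  exact: (act2_supp _ _ wB ss).
rewrite fsum_exchange; last first.
  pose a := Order.min N (N + N).
  pose b := Order.max (Order.max (m - L) (n - M)) (Order.max (m - L - N) (n - M - N)).
  pose sq := [seq (i, j) | i <- irange a b, j <- irange a b].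
  have sqP i j : a <= i -> i <= b -> a <= j -> j <= b -> (i, j) \in sq.
    by move=> *; apply/allpairsP; exists (i, j); split=> //; apply: mem_irange.
  apply: (fsupp_prod (s := sq) (t := sq)) => -[p1 p2] [q1 q2] /= h.
  have [hM'|hM'] := ltP (n - p2) M; first exact: (hM ((q1, q2), (p1 - q1, p2 - q2))).
  have [hN'|/norP[g1 /norP[g2 /norP[g3 g4]]]] :=
    boolP [|| q1 < N, q2 < N, p1 - q1 < N | p2 - q2 < N].
    by rewrite hN ?(lin0 (wA.1 _ _)) //; lia.
  apply: (hL ((q1, q2), (p1 - q1, p2 - q2))) => /=; first by lia.
  apply/orP; left; rewrite ltNge; apply: contraL h => h.
  by rewrite negb_or !negbK; apply/andP; split; apply: sqP; lia.
apply: eq_fsum => -[q1 q2] /=.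
rewrite [LHS](fsum_bij (h := fun p : int * int => (p.1 + q1, p.2 + q2))
  (k := fun p : int * int => (p.1 - q1, p.2 - q2))) => [|[p1 p2]|[p1 p2]] /=;
  rewrite ?addrK ?subrK //.
apply: eq_fsum => -[p1 p2] /=; rewrite !addrK.
by congr (A _ _ _); ring.
Qed.

End TwoVariables.

(** * Integer ranges and generalized binomial coefficients *)

Lemma irange_uniq (a b : int) : uniq (irange a b).
Proof. by rewrite map_inj_uniq ?iota_uniq // => i j /addrI[]. Qed.

Lemma fsum_range (W : zmodType) (f : int -> W) a b :
  (forall n, (n < a) || (b < n) -> f n = 0) ->
  \sum_(i \in [set: int]) f i = \sum_(i <- irange a b) f i.
Proof.
move=> f0; apply: fsumE => [|n h]; first exact: irange_uniq.
apply: f0; apply: contraR h; rewrite negb_or -!leNgt => /andP[].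
exact: mem_irange.
Qed.

Lemma mulz_big (W : zmodType) (x : W) I (r : seq I) (f : I -> int) :
  x *~ (\sum_(i <- r) f i) = \sum_(i <- r) x *~ f i.
Proof. by apply: (big_morph _ (mulrzDr x)); rewrite mulr0z. Qed.

Lemma big_mulz (W : zmodType) k I (r : seq I) (f : I -> W) :
  (\sum_(i <- r) f i) *~ k = \sum_(i <- r) f i *~ k.
Proof. by apply: (big_morph (fun x => x *~ k)) => [x y|]; rewrite ?mulrzDl ?mul0rz. Qed.

(** Allowing every integer as lower index frees Pascal's rule and the expansion kernels from case
    distinctions. *)
Definition bz (a n : int) : int := if n is Posz j then binz a j else 0.

Lemma binz0 a : binz a 0 = 1.
Proof. by case: a => m /=; rewrite ?bin0 // addn0 binn. Qed.

Lemma binzS a j : binz (a + 1) j.+1 = binz a j.+1 + binz a j.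
Proof.
case: a => [m|[|m]].
- by rewrite -PoszD addn1 /= binS PoszD.
- rewrite (_ : Negz 0 + 1 = 0) //= !add0n !binn exprS.
  by rewrite bin0n /= !mulr1 mulN1r addNr.
- rewrite (_ : Negz m.+1 + 1 = Negz m); last by lia.
  by rewrite /= !exprS [in RHS]addSn binS PoszD addSnnS; ring.
Qed.

Lemma bz_lt0 a n : n < 0 -> bz a n = 0.
Proof. by case: n. Qed.

Lemma bzS a n : bz (a + 1) n = bz a n + bz a (n - 1).
Proof.
case: n => [[|j]|j] //; first by rewrite /= !binz0.
by rewrite (_ : Posz j.+1 - 1 = Posz j) /= ?binzS //; lia.
Qed.

Lemma bz0n n : bz 0 n = (n == 0)%:Z.
Proof. by case: n => [[|j]|j] //=; rewrite bin0n. Qed.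

(** Both sides obey Pascal's rule in [a] and agree at a = 0. Downwards in [a] the rule yields the
    value at [n.+1] from the value at [n], whence the inner induction. *)
Lemma vandermonde a b (n : nat) :
  \sum_(i < n.+1) binz a i * binz b (n - i) = binz (a + b) n.
Proof.
pose c a n := \sum_(i < n.+1) binz a i * binz b (n - i).
have c0 x : c x 0%N = 1 by rewrite /c big_ord1 !binz0.
have cS x m : c (x + 1) m.+1 = c x m.+1 + c x m.
  rewrite /c big_ord_recl /= [in RHS]big_ord_recl /= !binz0 -addrA; congr (_ + _).
  rewrite -big_split; apply: eq_bigr => i _ /=.
  by rewrite !/bump /= !add1n subSS binzS mulrDl.
rewrite -/(c a n); elim/int_rect: a n => [|k ih|k ih].
- case=> [|n]; first by rewrite c0 binz0.
  rewrite /c big_ord_recl /= subn0 mul1r add0r big1 ?addr0 // => i _.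
  by rewrite mul0r.
- case=> [|n]; first by rewrite c0 binz0.
  by rewrite -addn1 PoszD cS !ih -binzS; congr (binz _ _); ring.
- elim=> [|n IH]; first by rewrite c0 binz0.
  have e : - (Posz k.+1) + 1 = - Posz k by lia.
  have := cS (- (Posz k.+1)) n; rewrite e ih IH.
  have -> : - Posz k + b = (- Posz k.+1 + b) + 1 by lia.
  by rewrite binzS => /addIr ->.
Qed.

Lemma bz_conv a b n :
  \sum_(i <- irange 0 n) bz a i * bz b (n - i) = bz (a + b) n.
Proof.
case: n => n; last first.
  by apply: big1_seq => i /andP[_ /mapP[j _ ->]]; rewrite [bz b _]bz_lt0 ?mulr0 //; lia.
rewrite -[RHS]vandermonde /irange big_map (_ : `|Posz n - 0|%N = n); last by lia.
rewrite -(big_mkord xpredT (fun i => binz a i * binz b (n - i))).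
rewrite -[iota 0 n.+1]/(index_iota 0 n.+1) !big_nat; apply: eq_bigr => i hi.
by rewrite add0r subzn //; lia.
Qed.

(** * Substitution of sums of variables *)

Section Substitutions.
Variable F : fieldType.
Implicit Types T U V W : lmodType F.

(** The coefficient of x^(c - n) z^n in (x + e z)^c. *)
Definition expker (e c n : int) : int := e ^+ `|n|%N * bz c n.

Lemma expandE e (W : zmodType) (s : int -> W) m n :
  expand e s m n = s (m + n) *~ expker e (m + n) n.
Proof. by case: n => n //=; rewrite /expker /= mulr0 mulr0z. Qed.

Lemma expker_lt0 e c n : n < 0 -> expker e c n = 0.
Proof. by move=> h; rewrite /expker bz_lt0 // mulr0. Qed.

(** Vandermonde's identity in the form (x + e z)^a (x + e z)^b = (x + e z)^(a + b). *)
Lemma expker_conv e a b n :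
  \sum_(i <- irange 0 n) expker e a i * expker e b (n - i) = expker e (a + b) n.
Proof.
rewrite /expker -bz_conv mulr_sumr big_seq [RHS]big_seq; apply: eq_bigr => i /mapP[j].
rewrite mem_iota => hj ->; rewrite add0r.
have [jn|nj] := leP (Posz j) n; last by rewrite [bz b _]bz_lt0 ?mulr0 //; lia.
have -> : `|n|%N = (`|Posz j| + `|n - Posz j|)%N by lia.
by rewrite exprD; ring.
Qed.

Lemma trunc_op2_in_x T W (A : T -> int -> W) : trunc_op A -> trunc_op2 (in_x A).
Proof.
case=> lA tA; split=> [m n|t X].
  by move=> a u v; rewrite /in_x; case: eqP; rewrite ?lA ?scaler0 ?addr0.
have [N h] := tA t; exists (Order.min N 0) => m n nX hn; rewrite /in_x.
by case: eqP => // n0; apply: h; lia.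
Qed.

Lemma fl_op2_in_x T W (A : T -> int -> W) : fl_op A -> fl_op2 (in_x A).
Proof.
move=> sA; have [lA zA] := trunc_op2_in_x (fl_trunc sA); split=> // t; split=> //.
apply: finspan_if; last by apply: finspan0.
by apply: (finspan_comp fst); case: (sA.2 t).
Qed.

Lemma trunc_op2_in_z T W (A : T -> int -> W) : trunc_op A -> trunc_op2 (in_z A).
Proof.
case=> lA tA; split=> [m n|t X].
  by move=> a u v; rewrite /in_z; case: eqP; rewrite ?lA ?scaler0 ?addr0.
have [N h] := tA t; exists (Order.min N 0) => m n nX hn; rewrite /in_z.
by case: eqP => // n0; apply: h; lia.
Qed.

Lemma fl_op2_in_z T W (A : T -> int -> W) : fl_op A -> fl_op2 (in_z A).
Proof.
move=> sA; have [lA zA] := trunc_op2_in_z (fl_trunc sA); split=> // t; split=> //.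
apply: finspan_if; last by apply: finspan0.
by apply: (finspan_comp snd); case: (sA.2 t).
Qed.

Lemma zlaurent_expand e W (s : int -> W) : truncated s -> zlaurent (expand e s).
Proof.
case=> N h X; exists (Order.min (N - X) 0) => m n nX hn; rewrite expandE.
have [n0|n0] := ltP n 0; first by rewrite expker_lt0 // mulr0z.
by rewrite h ?mul0rz //; lia.
Qed.

Lemma flaurent2_expand e W (s : int -> W) : flaurent s -> flaurent2 (expand e s).
Proof.
case=> ts fs; split; first exact: zlaurent_expand.
apply: (eq_finspan (f := fun p : int * int =>
  s (p.1 + p.2) *~ expker e (p.1 + p.2) p.2)) => [p|]; first by rewrite expandE.
by apply: finspanMz; apply: (finspan_comp (fun p : int * int => p.1 + p.2)).
Qed.

Lemma lin_expand e T W (A : T -> int -> W) : lin_op A ->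
  lin_op2 (fun t => expand e (A t)).
Proof.
move=> lA m n a u v; rewrite !expandE lA mulrzDl.
by rewrite -!scaler_int !scalerA mulrC.
Qed.

Lemma fl_op2_expand e T W (A : T -> int -> W) : fl_op A -> fl_op2 (fun t => expand e (A t)).
Proof.
move=> sA; split=> [|t]; first exact: lin_expand sA.1.
exact: flaurent2_expand (sA.2 t).
Qed.

Lemma in_x_comp T V W (A : V -> int -> W) (B : T -> int -> V) t :
  trunc_op A -> flaurent (B t) ->
  act2 (in_x A) (in_x B t) = in_x (fun t => act1 A (B t)) t.
Proof.
move=> wA sB; apply/funext => m; apply/funext => n; rewrite /act2.
rewrite (fsum_inj (h := fun p : int => (p, 0))) => [|? ? []//|[p q] h]; last first.
  rewrite /in_x /=; have [q0|_] := eqVneq q 0; first by case: (h p); rewrite q0.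
  by rewrite (lin0 (wA.1 _)) if_same.
by rewrite /in_x /= subr0; case: eqP => // _; apply: fsum0.
Qed.

Lemma act2_in_x T W (A : T -> int -> W) s m n : lin_op A ->
  act2 (in_x A) s m n = act1 A (s^~ n) m.
Proof.
move=> lA; rewrite /act2 (fsum_inj (h := fun p : int => (p, n))) => [|? ? []//|[p q] h].
  by apply: eq_fsum => p /=; rewrite /in_x subrr eqxx.
rewrite /in_x /=; case: eqP => // /eqP; rewrite subr_eq0 => /eqP e.
by case: (h p); rewrite e.
Qed.

Lemma act2_in_z T W (A : T -> int -> W) s m n : lin_op A ->
  act2 (in_z A) s m n = act1 A (s m) n.
Proof.
move=> lA; rewrite /act2 (fsum_inj (h := fun q : int => (m, q))) => [|? ? []//|[p q] h].
  by apply: eq_fsum => p /=; rewrite /in_z subrr eqxx.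
rewrite /in_z /=; case: eqP => // /eqP; rewrite subr_eq0 => /eqP e.
by case: (h q); rewrite e.
Qed.

Lemma act2_in_xr T W (A : T -> int -> int -> W) V (B : V -> int -> T) t m n : lin_op2 A ->
  act2 A (in_x B t) m n = \sum_(p \in [set: int]) A (B t p) (m - p) n.
Proof.
move=> lA; rewrite /act2 (fsum_inj (h := fun p : int => (p, 0))) => [|? ? []//|[p q] h].
  by apply: eq_fsum => p /=; rewrite /in_x eqxx subr0.
rewrite /in_x /=; have [q0|_] := eqVneq q 0; first by case: (h p); rewrite q0.
exact: lin0 (lA _ _).
Qed.

Lemma act2_in_zr T W (A : T -> int -> int -> W) V (B : V -> int -> T) t m n : lin_op2 A ->
  act2 A (in_z B t) m n = \sum_(q \in [set: int]) A (B t q) m (n - q).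
Proof.
move=> lA; rewrite /act2 (fsum_inj (h := fun p : int => (0, p))) => [|? ? []//|[p q] h].
  by apply: eq_fsum => p /=; rewrite /in_z eqxx subr0.
rewrite /in_z /=; have [q0|_] := eqVneq p 0; first by case: (h q); rewrite q0.
exact: lin0 (lA _ _).
Qed.

Lemma in_z_comp T V W (A : V -> int -> W) (B : T -> int -> V) t :
  lin_op A ->
  act2 (in_z A) (in_z B t) = in_z (fun t => act1 A (B t)) t.
Proof.
move=> lA; apply/funext => m; apply/funext => n; rewrite act2_in_z // /in_z.
by case: eqP => // _; apply: fsum0 => p; rewrite (lin0 (lA _)).
Qed.

Lemma in_x_in_z T V W (A : V -> int -> W) (B : T -> int -> V) t m n :
  lin_op A -> act2 (in_x A) (in_z B t) m n = A (B t n) m.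
Proof.
move=> lA; rewrite act2_in_x // /act1 (fsum_one (i0 := 0)) => [|p /negPf p0].
  by rewrite /in_z eqxx subr0.
by rewrite /in_z p0 (lin0 (lA _)).
Qed.

(** Substituting x + e z is multiplicative: once the exponents of [A] and [B] before the
    substitution are fixed, the kernels convolve. *)
Lemma expand_comp e T V W (A : V -> int -> W) (B : T -> int -> V) t :
  trunc_op A -> flaurent (B t) ->
  act2 (fun t => expand e (A t)) (expand e (B t)) = expand e (act1 A (B t)).
Proof.
move=> wA sB; apply/funext => m; apply/funext => n.
rewrite expandE /act2.
(* In the new pair the first entry is the exponent of [B] before the substitution, the second the
   power of z that it contributes. *)
pose h (p : int * int) : int * int := (p.1 - p.2, p.2).
pose k (p : int * int) : int * int := (p.1 + p.2, p.2).
have hk : cancel h k by case=> a b; rewrite /h /k /= subrK.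
have kh : cancel k h by case=> a b; rewrite /h /k /= addrK.
have [s us s0] := fsuppP (act1_supp (m + n) wA sB).
have e1 (c i : int) : expand e (A (expand e (B t) (c - i) i)) (m - (c - i)) (n - i) =
    A (B t c) (m + n - c) *~ (expker e c i * expker e (m + n - c) (n - i)).
  rewrite !expandE subrK (linMz (wA.1 _)) -mulrzA (_ : m - _ + _ = m + n - c) //.
  by ring.
rewrite [LHS](fsum_bij _ hk kh) -(fsum_pair (f := fun c i =>
  expand e (A (expand e (B t) (c - i) i)) (m - (c - i)) (n - i))); last first.
  apply: (fsupp_prod (s := s) (t := irange 0 n)) => c i /orP[cs|ni] /=.
    by rewrite e1 s0 // mul0rz.
  rewrite e1; have [i0|i0] := ltP i 0; first by rewrite expker_lt0 // mul0r mulr0z.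
  have [ni'|ni'] := ltP n i; last by case/negP: ni; apply: mem_irange.
  by rewrite [expker e _ (n - i)]expker_lt0 ?mulr0 ?mulr0z //; lia.
rewrite /act1 (fsumE us s0) (fsumE us); last first.
  by move=> c cs; apply: fsum0 => i; rewrite e1 s0 // mul0rz.
rewrite big_mulz; apply: eq_bigr => c _.
rewrite (@fsum_range _ _ 0 n); last first.
  move=> i /orP[i0|ni]; rewrite e1; first by rewrite expker_lt0 // mul0r mulr0z.
  by rewrite [expker e _ (n - i)]expker_lt0 ?mulr0 ?mulr0z //; lia.
under eq_bigr do rewrite e1.
rewrite -mulz_big expker_conv (_ : c + (m + n - c) = m + n) //; ring.
Qed.

End Substitutions.

(** * Powers of x1 - x2 and the substitution x1 = x2 + x0 *)

Section Differences.
Variable F : fieldType.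
Implicit Types T U V W : lmodType F.

Lemma fsumB (I : choiceType) W (f g : I -> W) : fsupp f -> fsupp g ->
  \sum_(i \in [set: I]) (f i - g i) =
  \sum_(i \in [set: I]) f i - \sum_(i \in [set: I]) g i.
Proof.
move=> ff fg; rewrite [RHS]addrC -scaleN1r -fsum_lin_comb //.
by apply: eq_fsum => i; rewrite scaleN1r addrC.
Qed.

Lemma eq_fsumz (W : zmodType) (f g : int -> W) : (forall n : int, f n = g n) ->
  \sum_(i \in [set: int]) f i = \sum_(i \in [set: int]) g i.
Proof. exact: eq_fsum. Qed.

Lemma fsum0z (W : zmodType) (f : int -> W) : (forall n : int, f n = 0) ->
  \sum_(i \in [set: int]) f i = 0.
Proof. exact: fsum0. Qed.

Definition mul_sub W (s : int -> int -> W) : int -> int -> W :=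
  fun m n => s (m - 1) n - s m (n - 1).

Lemma mul_sub_pow0 W (s : int -> int -> W) : mul_sub_pow 0 s = s.
Proof.
apply/funext => m; apply/funext => n.
by rewrite /mul_sub_pow big_ord1 /= !subr0 mulr1z.
Qed.

(** Pascal's rule; it reduces facts about (x1 - x2)^k to a single factor by induction on [k]. *)
Lemma mul_sub_powS k W (s : int -> int -> W) :
  mul_sub_pow k.+1 s = mul_sub (mul_sub_pow k s).
Proof.
apply/funext => m; apply/funext => n; rewrite /mul_sub /mul_sub_pow.
pose a (i : nat) := s (m - Posz k.+1 + Posz i) (n - Posz i) *~ ((-1) ^+ i).
have -> : \sum_(i < k.+2) s (m - Posz (k.+1 - i)) (n - Posz i) *~
    ((-1) ^+ i * Posz 'C(k.+1, i)) = \sum_(i < k.+2) a i *~ 'C(k.+1, i).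
  apply: eq_bigr => -[i hi] _ /=; rewrite /a mulrzA; congr (s _ _ *~ _ *~ _).
  by lia.
have -> : \sum_(i < k.+1) s (m - 1 - Posz (k - i)) (n - Posz i) *~
    ((-1) ^+ i * Posz 'C(k, i)) = \sum_(i < k.+2) a i *~ 'C(k, i).
  rewrite [RHS]big_ord_recr /= [in RHS]bin_small // mulr0z addr0.
  apply: eq_bigr => -[i hi] _ /=; rewrite /a mulrzA; congr (s _ _ *~ _ *~ _).
  by lia.
have -> : \sum_(i < k.+1) s (m - Posz (k - i)) (n - 1 - Posz i) *~
    ((-1) ^+ i * Posz 'C(k, i)) = - \sum_(i < k.+1) a i.+1 *~ 'C(k, i).
  rewrite -sumrN; apply: eq_bigr => -[i hi] _ /=.
  rewrite /a mulrzA exprS mulN1r mulrNz mulNrz opprK.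
  by congr (s _ _ *~ _ *~ _); lia.
rewrite opprK big_ord_recl [in RHS]big_ord_recl /= !bin0 -addrA; congr (_ + _).
by rewrite -big_split; apply: eq_bigr => i _; rewrite /= /bump /= add1n binS PoszD mulrzDr.
Qed.

Lemma mul_sub_pow_add k l W (s : int -> int -> W) :
  mul_sub_pow (k + l) s = mul_sub_pow k (mul_sub_pow l s).
Proof. by elim: k => [|k ih]; rewrite ?mul_sub_pow0 // addSn !mul_sub_powS ih. Qed.

Lemma flaurent2_mul_sub W (s : int -> int -> W) : flaurent2 s -> flaurent2 (mul_sub s).
Proof.
case=> zs fs; split=> [X|].
  have [N h] := zs X; exists N => m n nX hn.
  by rewrite /mul_sub !h ?subr0 //; lia.
rewrite /mul_sub.
have f1 := finspan_comp (fun p : int * int => (p.1 - 1, p.2)) fs.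
have f2 := finspan_comp (fun p : int * int => (p.1, p.2 - 1)) fs.
by have := finspanD f1 (finspanMz (fun=> -1) f2); apply: eq_finspan => p /=; rewrite mulrNz.
Qed.

Lemma trunc_op2_mul_sub T W (A : T -> int -> int -> W) :
  trunc_op2 A -> trunc_op2 (fun t => mul_sub (A t)).
Proof.
case=> lA zA; split=> [m n a u v|t X]; first by rewrite /mul_sub !lA scalerBr opprD addrACA.
have [N h] := zA t X; exists N => m n nX hn.
by rewrite /mul_sub !h ?subr0 //; lia.
Qed.

Lemma trunc_op2_mul_sub_pow k T W (A : T -> int -> int -> W) :
  trunc_op2 A -> trunc_op2 (fun t => mul_sub_pow k (A t)).
Proof.
move=> wA; elim: k => [|k ih].
  by rewrite (_ : (fun t => _) = A) //; apply/funext => t; rewrite mul_sub_pow0.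
have := trunc_op2_mul_sub ih; congr trunc_op2; apply/funext => t; by rewrite mul_sub_powS.
Qed.

Lemma flaurent2_mul_sub_pow k W (s : int -> int -> W) : flaurent2 s -> flaurent2 (mul_sub_pow k s).
Proof.
by move=> ss; elim: k => [|k ih]; rewrite ?mul_sub_pow0 // mul_sub_powS; apply: flaurent2_mul_sub.
Qed.

Lemma mul_sub_act2l T W (A : T -> int -> int -> W) s : trunc_op2 A -> flaurent2 s ->
  mul_sub (act2 A s) = act2 (fun t => mul_sub (A t)) s.
Proof.
move=> wA ss; apply/funext => m; apply/funext => n; rewrite /mul_sub /act2.
rewrite -fsumB; try exact: (act2_supp _ _ wA ss).
by apply: eq_fsum => p /=; rewrite ![_ - 1 - _]addrAC.
Qed.

Lemma mul_sub_pow_act2l k T W (A : T -> int -> int -> W) s : trunc_op2 A -> flaurent2 s ->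
  mul_sub_pow k (act2 A s) = act2 (fun t => mul_sub_pow k (A t)) s.
Proof.
move=> wA ss; elim: k => [|k ih].
  by rewrite mul_sub_pow0; apply: act2_congr => p q; rewrite mul_sub_pow0.
rewrite mul_sub_powS ih mul_sub_act2l //; last exact: trunc_op2_mul_sub_pow.
by apply: act2_congr => p q; rewrite mul_sub_powS.
Qed.

Lemma mul_sub_act2r T W (A : T -> int -> int -> W) s : trunc_op2 A -> flaurent2 s ->
  mul_sub (act2 A s) = act2 A (mul_sub s).
Proof.
move=> wA ss; apply/funext => m; apply/funext => n; rewrite /mul_sub /act2.
have e1 : \sum_(p \in [set: int * int]) A (s p.1 p.2) (m - 1 - p.1) (n - p.2) =
    \sum_(p \in [set: int * int]) A (s (p.1 - 1) p.2) (m - p.1) (n - p.2).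
  rewrite [LHS](fsum_bij (h := fun p : int * int => (p.1 - 1, p.2))
    (k := fun p : int * int => (p.1 + 1, p.2))) => [|[p q]|[p q]] /=;
    rewrite ?subrK ?addrK //.
  by apply: eq_fsum => p /=; congr (A _ _ _); ring.
have e2 : \sum_(p \in [set: int * int]) A (s p.1 p.2) (m - p.1) (n - 1 - p.2) =
    \sum_(p \in [set: int * int]) A (s p.1 (p.2 - 1)) (m - p.1) (n - p.2).
  rewrite [LHS](fsum_bij (h := fun p : int * int => (p.1, p.2 - 1))
    (k := fun p : int * int => (p.1, p.2 + 1))) => [|[p q]|[p q]] /=;
    rewrite ?subrK ?addrK //.
  by apply: eq_fsum => p /=; congr (A _ _ _); ring.
rewrite e1 e2 -fsumB.
- by apply: eq_fsum => p; rewrite (linD (wA.1 _ _)) (linN (wA.1 _ _)).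
- apply: (fsupp_inj (h := fun p : int * int => (p.1, p.2)) (k := id)
    (f := fun p => A (s (p.1 - 1) p.2) (m - p.1) (n - p.2))) => [[]//|].
  apply: (act2_supp (s := fun p q => s (p - 1) q)) => //.
  split; last exact: (finspan_comp (fun p : int * int => (p.1 - 1, p.2)) ss.2).
  by move=> X; have [N h] := ss.1 X; exists N => i j jX hj; apply: h => //; lia.
- apply: (act2_supp (s := fun p q => s p (q - 1))) => //.
  split; last exact: (finspan_comp (fun p : int * int => (p.1, p.2 - 1)) ss.2).
  by move=> X; have [N h] := ss.1 X; exists N => i j jX hj; apply: h => //; lia.
Qed.

Lemma mul_sub_pow_act2r k T W (A : T -> int -> int -> W) s : trunc_op2 A -> flaurent2 s ->
  mul_sub_pow k (act2 A s) = act2 A (mul_sub_pow k s).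
Proof.
move=> wA ss; elim: k => [|k ih]; first by rewrite !mul_sub_pow0.
by rewrite !mul_sub_powS ih mul_sub_act2r //; apply: flaurent2_mul_sub_pow.
Qed.

(** The sign is that of (x2 - x1)^k = (-1)^k (x1 - x2)^k. *)
Lemma mul_sub_pow_tr k W (s : int -> int -> W) m n :
  mul_sub_pow k (fun m n => s n m) m n = (-1) ^+ k *: mul_sub_pow k s n m.
Proof.
elim: k m n => [|k ih] m n; first by rewrite !mul_sub_pow0 scale1r.
by rewrite !mul_sub_powS /mul_sub !ih -scalerBr exprS mulN1r scaleNr -scalerN opprB.
Qed.

(** Multiplying s(x1 - x2) by (x1 - x2)^k amounts to multiplying s(x) by x^k beforehand, which is
    how poles at x1 = x2 are cleared. *)
Lemma expand_sub_shift W (s : int -> W) k :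
  mul_sub_pow k (expand_sub s) = expand_sub (fun c => s (c - Posz k)).
Proof.
elim: k => [|k ih].
  by rewrite mul_sub_pow0; congr expand_sub; apply/funext => c; rewrite subr0.
rewrite mul_sub_powS ih; apply/funext => m; apply/funext => n.
rewrite /mul_sub /expand_sub !expandE.
rewrite (_ : m + (n - 1) = m - 1 + n); last by ring.
rewrite (_ : m - 1 + n - Posz k = m + n - Posz k.+1); last by lia.
rewrite -mulrzBr; congr (_ *~ _); rewrite /expker.
have -> : m + n = m - 1 + n + 1 by ring.
rewrite bzS.
have [n0|n0] := leP n 0.
  by rewrite [bz _ (n - 1)]bz_lt0 ?mulr0 ?subr0 ?addr0 //; lia.
by rewrite (_ : `|n|%N = `|n - 1|.+1) ?exprS; [ring|lia].
Qed.

Lemma truncated2_mul_sub W (s : int -> int -> W) : truncated2 s -> truncated2 (mul_sub s).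
Proof.
case=> N h; exists N => m n hn; rewrite /mul_sub !h ?subr0 //; lia.
Qed.

Lemma truncated2_mul_sub_pow k W (s : int -> int -> W) :
  truncated2 s -> truncated2 (mul_sub_pow k s).
Proof.
by move=> ts; elim: k => [|k ih]; rewrite ?mul_sub_pow0 // mul_sub_powS; apply: truncated2_mul_sub.
Qed.

Lemma subst_x1E W (s : int -> int -> W) i p :
  subst_x1 s i p = \sum_(m \in [set: int]) s m (p + i - m) *~ bz m i.
Proof. by case: i => j //=; rewrite fsum0 // => m; rewrite mulr0z. Qed.

Lemma truncated2_supp W (s : int -> int -> W) k : truncated2 s ->
  fsupp (fun m => s m (k - m)).
Proof.
case=> N h; apply: (@fsupp_int _ _ N (k - N)) => m hm; apply: h; lia.
Qed.

Lemma fsuppMz (I : choiceType) W (f : I -> W) (g : I -> int) :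
  fsupp f -> fsupp (fun i => f i *~ g i).
Proof. by case=> s h; exists s => i /h ->; rewrite mul0rz. Qed.

(** The factor x1 - x2 becomes x0; on coefficients this is Pascal's rule once more, and truncation
    allows the sum to be split. *)
Lemma subst_mul_sub W (s : int -> int -> W) i p : truncated2 s ->
  subst_x1 (mul_sub s) i p = subst_x1 s (i - 1) p.
Proof.
move=> ts; rewrite !subst_x1E /mul_sub.
transitivity (\sum_(m \in [set: int]) (s (m - 1) (p + i - m) *~ bz m i -
    s m (p + i - m - 1) *~ bz m i)).
  by apply: eq_fsum => m; rewrite mulrzBl.
have h1 : fsupp (fun m => s m (p + i - 1 - m)) by exact: truncated2_supp.
have h2 : fsupp (fun m => s (m - 1) (p + i - 1 - (m - 1))).
  exact: (fsupp_inj (h := fun m : int => m - 1) (k := fun m => m + 1)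
    (f := fun m => s m (p + i - 1 - m)) (subrK _) h1).
rewrite fsumB; last first.
- by apply: fsuppMz; case: h1 => r hr; exists r => m /hr; congr (s _ _ = 0); ring.
- by apply: fsuppMz; case: h2 => r hr; exists r => m /hr; congr (s _ _ = 0); ring.
rewrite [X in X - _](fsum_shift _ 1) -fsumB; last first.
- by apply: fsuppMz; case: h1 => r hr; exists r => m /hr; congr (s _ _ = 0); ring.
- by apply: fsuppMz; case: h1 => r hr; exists r => m /hr; congr (s _ _ = 0); ring.
apply: eq_fsum => m; rewrite bzS addrK.
rewrite (_ : p + i - (m + 1) = p + (i - 1) - m); last by ring.
rewrite (_ : p + i - m - 1 = p + (i - 1) - m); last by ring.
by rewrite mulrzDr addrAC subrr add0r.
Qed.

Lemma subst_mul_sub_pow k W (s : int -> int -> W) i p : truncated2 s ->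
  subst_x1 (mul_sub_pow k s) i p = subst_x1 s (i - Posz k) p.
Proof.
move=> ts; elim: k i => [|k ih] i; first by rewrite mul_sub_pow0 subr0.
rewrite mul_sub_powS subst_mul_sub ?ih; last exact: truncated2_mul_sub_pow.
by congr (subst_x1 _ _ _); lia.
Qed.

(** Substitution [x1 = x2 + x0] is multiplicative; on coefficients this is
    Vandermonde's identity. *)
Lemma subst_act2 T W (A : T -> int -> int -> W) s N : lin_op2 A ->
  (forall a b, (a < N) || (b < N) -> s a b = 0) ->
  (forall a b m n, (m < N) || (n < N) -> A (s a b) m n = 0) ->
  subst_x1 (act2 A s) = act2 (fun t => subst_x1 (A t)) (subst_x1 s).
Proof.
move=> lA s0 A0; apply/funext => i; apply/funext => p.
(* Four exponents, each at least [N], add up to [p + i], so none exceeds [M]. *)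
pose M := p + i - N - N - N.
pose g (a b m : int) := A (s a b) m (p + i - a - b - m).
pose r := irange N M; pose ri := irange 0 i.
have g0 a b m : [|| a < N, b < N, m < N | p + i - a - b - m < N] -> g a b m = 0.
  move=> h; have [ab|ab] := boolP ((a < N) || (b < N)).
    by rewrite /g s0 // (lin0 (lA _ _)).
  by apply: A0; lia.
(* Common form of both sides: [j] is the power of x0 that comes from [s] and [i - j] the one that
   comes from [A]. Vandermonde's identity sums over [j]. *)
transitivity (\sum_(a <- r) \sum_(b <- r) \sum_(m <- r) \sum_(j <- ri)
    g a b m *~ (bz a j * bz m (i - j))).
  rewrite subst_x1E.
  transitivity (\sum_(m \in [set: int]) \sum_(a \in [set: int]) \sum_(b \in [set: int])
      g a b (m - a) *~ bz m i).
    apply: eq_fsumz => m; rewrite /act2 -(fsum_pair (f := fun a b =>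
      A (s a b) (m - a) (p + i - m - b))); last first.
      apply: (@fsupp_int2 _ _ N (Order.max (m - N) (p + i - m - N))) => -[a b] /= h.
      have [ab|ab] := boolP ((a < N) || (b < N)).
        by rewrite s0 // (lin0 (lA _ _)).
      by apply: A0; lia.
    have fa (a : int) : (a < N) || (M < a) -> \sum_(b \in [set: int]) g a b (m - a) = 0.
      by move=> ha; apply: fsum0z => b; apply: g0; rewrite /M in ha; lia.
    transitivity ((\sum_(a \in [set: int]) \sum_(b \in [set: int]) g a b (m - a)) *~ bz m i).
      congr (_ *~ _); apply: eq_fsumz => a; apply: eq_fsumz => b.
      by rewrite /g; congr (A _ _ _); ring.
    have gb (a b : int) : (b < N) || (M < b) -> g a b (m - a) = 0.
      move=> hb; have [?|?] := ltP a N; apply: g0; rewrite /M in hb; lia.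
    rewrite (fsum_range fa) [RHS](@fsum_range _ _ N M); last first.
      by move=> a ha; apply: fsum0z => b; rewrite g0 ?mul0rz //; rewrite /M in ha; lia.
    rewrite big_mulz; apply: eq_bigr => a _.
    rewrite (@fsum_range _ _ N M); last exact: gb.
    rewrite [RHS](@fsum_range _ _ N M) ?big_mulz // => b hb.
    by rewrite gb // mul0rz.
  transitivity (\sum_(m \in [set: int]) \sum_(a <- r) \sum_(b <- r)
      g a b (m - a) *~ bz m i).
    apply: eq_fsumz => m; rewrite (@fsum_range _ _ N M); last first.
      by move=> a ha; apply: fsum0z => b; rewrite g0 ?mul0rz //; rewrite /M in ha; lia.
    apply: eq_bigr => a _; rewrite (@fsum_range _ _ N M) // => b hb.
    by rewrite g0 ?mul0rz //; rewrite /M in hb; lia.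
  have fs (a b : int) : fsupp (fun m => g a b (m - a) *~ bz m i).
    apply: (@fsupp_int _ _ (N + a) (p + i - b - N)) => m hm.
    by rewrite g0 ?mul0rz //; lia.
  rewrite (fsum_big (f := fun a m => \sum_(b <- r) g a b (m - a) *~ bz m i) _
    (fun a => fsupp_big _ (fs a))).
  apply: eq_bigr => a _; rewrite (fsum_big _ (fs a)); apply: eq_bigr => b _.
  rewrite (fsum_shift _ a) (@fsum_range _ _ N M); last first.
    move=> m hm; have [ab|ab] := boolP ((a < N) || (b < N)).
      by rewrite g0 ?mul0rz //; lia.
    by rewrite addrK g0 ?mul0rz //; rewrite /M in hm; lia.
  apply: eq_bigr => m _; rewrite addrK addrC -bz_conv mulz_big.
  by [].
have e1 j q : subst_x1 (A (subst_x1 s j q)) (i - j) (p - q) =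
    \sum_(m <- r) \sum_(a <- r) g a (q + j - a) m *~ (bz a j * bz m (i - j)).
  have fs : fsupp (fun a => s a (q + j - a) *~ bz a j).
    apply: (@fsupp_int _ _ N (q + j - N)) => a ha; rewrite s0 ?mul0rz //; lia.
  have e2 (m : int) : A (subst_x1 s j q) m (p - q + (i - j) - m) =
      \sum_(a <- r) g a (q + j - a) m *~ bz a j.
    rewrite subst_x1E (lin_fsum_comm (lA _ _) fs).
    transitivity (\sum_(a \in [set: int]) g a (q + j - a) m *~ bz a j).
      by apply: eq_fsumz => a; rewrite (linMz (lA _ _)) /g; congr (A _ _ _ *~ _); ring.
    apply: fsum_range => a ha; rewrite g0 ?mul0rz //; rewrite /M in ha; lia.
  rewrite subst_x1E (@fsum_range _ _ N M); last first.
    move=> m hm; rewrite e2 big1 ?mul0rz // => a _.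
    have [?|?] := ltP a N; (rewrite g0 ?mul0rz //; rewrite /M in hm; lia).
  apply: eq_bigr => m _; rewrite e2 big_mulz; apply: eq_bigr => a _.
  by rewrite mulrzA.
have e3 (j : int) : (j < 0) || (i < j) -> forall a m, bz a j * bz m (i - j) = 0.
  by case/orP=> hj a m; [rewrite bz_lt0 ?mul0r|rewrite [bz m _]bz_lt0 ?mulr0 //; lia].
rewrite /act2 -(fsum_pair (f := fun j q =>
  subst_x1 (A (subst_x1 s j q)) (i - j) (p - q))); last first.
  apply: (fsupp_prod (s := ri) (t := irange (N + N - i) (p + i - N - N))) => j q h /=.
  rewrite e1 big1 // => m _; rewrite big1 // => a _.
  have [hj|hj] := boolP ((j < 0) || (i < j)); first by rewrite e3 // mulr0z.
  rewrite g0 ?mul0rz //; apply: contraLR h => h; rewrite negb_or !negbK.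
  by apply/andP; split; apply: mem_irange; lia.
rewrite (@fsum_range _ _ 0 i); last first.
  move=> j hj; apply: fsum0z => q; rewrite e1 big1 // => m _; rewrite big1 // => a _.
  by rewrite e3 // mulr0z.
transitivity (\sum_(j <- ri) \sum_(m <- r) \sum_(a <- r) \sum_(b <- r)
    g a b m *~ (bz a j * bz m (i - j))).
  under eq_bigr => a _ do rewrite exchange_big.
  rewrite exchange_big /=; under eq_bigr => m _ do under eq_bigr => a _ do rewrite exchange_big.
  under eq_bigr => m _ do rewrite exchange_big.
  by rewrite exchange_big.
apply: eq_bigr => j _.
transitivity (\sum_(q \in [set: int]) \sum_(m <- r) \sum_(a <- r)
    g a (q + j - a) m *~ (bz a j * bz m (i - j))); last first.
  by apply: eq_fsumz => q; rewrite e1.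
have fs (m a : int) : fsupp (fun q => g a (q + j - a) m *~ (bz a j * bz m (i - j))).
  apply: (@fsupp_int _ _ (N - j + a) (p + i - m - N - j)) => q hq.
  by rewrite g0 ?mul0rz //; lia.
pose h m q := \sum_(a <- r) g a (q + j - a) m *~ (bz a j * bz m (i - j)).
rewrite (fsum_big (f := h) _ (fun m => fsupp_big _ (fs m))).
apply: eq_bigr => m _; rewrite /h (fsum_big _ (fs m)).
apply: eq_bigr => a _; rewrite (fsum_shift _ (a - j)) (@fsum_range _ _ N M).
  by apply: eq_bigr => b _; rewrite (_ : b + (a - j) + j - a = b) //; ring.
move=> b hb; rewrite (_ : b + (a - j) + j - a = b); last by ring.
have [?|?] := ltP a N; (have [?|?] := ltP m N; (rewrite g0 ?mul0rz //; rewrite /M in hb; lia)).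
Qed.

End Differences.

(** * Operators on tensor slots *)

Section Slots.
Variable F : fieldType.
Implicit Types T U V W X : lmodType F.

Lemma lin_tswap U V W (f : U -> tensor V W) :
  linear f -> linear (fun x => tswap (f x)).
Proof. by move=> lf; apply: lin_tsumt => // ?; lin. Qed.

Lemma tswapE V W (v : V) (w : W) : tswap (v ⊗ w) = w ⊗ v.
Proof. by apply: tsumE => ?; lin. Qed.

Lemma tswapK V W (t : tensor V W) : tswap (tswap t) = t.
Proof.
apply: (ext2 (f := fun t => tswap (tswap t)) (g := fun t : tensor V W => t)).
- by do 2![apply: lin_tswap]; lin.
- by lin.
- by move=> v w; rewrite !tswapE.
Qed.

Lemma lin_tassoc T U V W (f : T -> tensor (tensor U V) W) :
  linear f -> linear (fun x => tassoc (f x)).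
Proof. by move=> lf; apply: lin_tsumt => // ?; lin. Qed.

Lemma lin_tassocV T U V W (f : T -> tensor U (tensor V W)) :
  linear f -> linear (fun x => tassocV (f x)).
Proof. by move=> lf; apply: lin_tsumt => // ?; lin. Qed.

Lemma tassocE U V W (u : U) (v : V) (w : W) : tassoc (u ⊗ v ⊗ w) = u ⊗ (v ⊗ w).
Proof. by rewrite /tassoc !tsumE // => *; lin. Qed.

Lemma tassocVE U V W (u : U) (v : V) (w : W) : tassocV (u ⊗ (v ⊗ w)) = u ⊗ v ⊗ w.
Proof. by rewrite /tassocV !tsumE // => *; lin. Qed.

Lemma tassocVK U V W (t : tensor U (tensor V W)) : tassoc (tassocV t) = t.
Proof.
apply: (ext2 (f := fun t => tassoc (tassocV t))
  (g := fun t : tensor U (tensor V W) => t)).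
- by apply: lin_tassoc; apply: lin_tassocV; lin.
- by lin.
move=> u; apply: (ext2 (f := fun p => tassoc (tassocV (u ⊗ p)))
  (g := fun p : tensor V W => u ⊗ p)) => [||v w].
- by apply: lin_tassoc; apply: lin_tassocV; lin.
- by lin.
- by rewrite tassocVE tassocE.
Qed.

Definition amplify T X W (A : T -> int -> X) (t : tensor T W) (n : int) : tensor X W :=
  tmap (fun p => A p n) id t.

Lemma amplifyE T X W (A : T -> int -> X) p w n : lin_op A ->
  @amplify T X W A (p ⊗ w) n = A p n ⊗ w.
Proof. by move=> lA; rewrite /amplify tmapE. Qed.

Lemma trunc_big X I (r : seq I) (s : I -> int -> X) :
  (forall i, truncated (s i)) -> truncated (fun n => \sum_(i <- r) s i n).
Proof.
move=> ts; elim: r => [|i r [N h]]; first by exists 0 => n _; rewrite big_nil.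
have [M h'] := ts i; exists (Order.min M N) => n hn.
by rewrite big_cons h' ?h ?addr0 //; lia.
Qed.

Lemma trunc_tsum V W X (t : tensor V W) (s : V -> W -> int -> X) :
  (forall v w, truncated (s v w)) -> truncated (fun n => tsum (fun v w => s v w n) t).
Proof. by move=> ts; apply: trunc_big => p; apply: ts. Qed.

Lemma trunc_lin V W (s : int -> V) (A : V -> W) :
  linear A -> truncated s -> truncated (fun n => A (s n)).
Proof. by move=> lA [N h]; exists N => n /h ->; rewrite lin0. Qed.

Lemma flaurent_tsum V W X (t : tensor V W) (s : V -> W -> int -> X) :
  (forall v w, flaurent (s v w)) -> flaurent (fun n => tsum (fun v w => s v w n) t).
Proof.
move=> hs; split; first by apply: trunc_tsum => v w; case: (hs v w).
by apply: finspan_tsum => v w; case: (hs v w).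
Qed.

Lemma flaurent_lin V W (s : int -> V) (A : V -> W) :
  linear A -> flaurent s -> flaurent (fun n => A (s n)).
Proof.
by move=> lA [ts fs]; split; [apply: trunc_lin|apply: finspan_lin].
Qed.

Lemma trunc_op_amplify T X W (A : T -> int -> X) : trunc_op A -> trunc_op (@amplify T X W A).
Proof.
case=> lA tA; split=> [n|t]; first by apply: lin_tmap => //; lin.
by apply: trunc_tsum => p w; apply: (trunc_lin (A := fun x => x ⊗ w)) => //; lin.
Qed.

Lemma fl_op_amplify T X W (A : T -> int -> X) : fl_op A -> fl_op (@amplify T X W A).
Proof.
move=> sA; have [lA _] := trunc_op_amplify W (fl_trunc sA); split=> // t.
apply: flaurent_tsum => p w; apply: (flaurent_lin (A := fun x => x ⊗ w)); first by lin.
exact: sA.2.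
Qed.

Lemma amplify_comp T U X W (A : U -> int -> X) (B : T -> int -> U) t :
  trunc_op A -> fl_op B ->
  act1 (@amplify U X W A) (amplify B t) = amplify (fun p => act1 A (B p)) t.
Proof.
move=> wA sB; apply/funext => n; move: t.
apply: (ext2 (f := fun t => act1 (@amplify U X W A) (amplify B t) n)
  (g := fun t => amplify (fun p => act1 A (B p)) t n)) => [||p w].
- exact: (act1_lin (trunc_op_amplify W wA) (fl_op_amplify W sB)).
- by apply: lin_tmap; [exact: act1_lin|lin|lin].
rewrite amplifyE; last exact: act1_lin.
rewrite /act1 (lin_fsum_comm (A := fun x => x ⊗ w)); last first.
- exact: (act1_supp _ wA (sB.2 p)).
- by lin.
apply: eq_fsum => m; rewrite (amplifyE _ _ _ sB.1) (amplifyE _ _ _ wA.1) //.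
Qed.

Lemma fl_op_conj T U V W (A : U -> int -> V) (P : V -> W) (Q : T -> U) :
  linear P -> linear Q -> fl_op A -> fl_op (fun t n => P (A (Q t) n)).
Proof.
move=> lP lQ sA; split=> [n a u v|t]; first by rewrite lQ sA.1 lP.
by apply: flaurent_lin => //; apply: sA.2.
Qed.

(** Operators on slots 1, 3 and on slots 2, 3 are conjugates of operators on slots 1, 2; this
    transports their composition. *)
Lemma act1_conj T U U' V V' W (A : U' -> int -> V) (B : U -> int -> U')
    (P : V -> W) (Q : T -> U) (P' : U' -> V') (Q' : V' -> U') t :
  linear P -> trunc_op A -> fl_op B -> (forall x, Q' (P' x) = x) ->
  act1 (fun t n => P (A (Q' t) n)) (fun n => P' (B (Q t) n)) =
  fun n => P (act1 A (B (Q t)) n).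
Proof.
move=> lP wA sB QP; apply/funext => n; rewrite /act1.
rewrite (lin_fsum_comm lP); last exact: (act1_supp _ wA (sB.2 (Q t))).
by apply: eq_fsum => m; rewrite QP.
Qed.

(** All coefficients are compared pairwise, so that commutation survives any substitution for the
    two variables. *)
Definition commute_ops T (A B : T -> int -> T) : Prop :=
  forall m n t, A (B t m) n = B (A t n) m.

Lemma commute_ops_sym T (A B : T -> int -> T) : commute_ops A B -> commute_ops B A.
Proof. by move=> AB m n t; rewrite AB. Qed.

Lemma commute_ops_comp T (A B C : T -> int -> T) : fl_op A -> fl_op B -> fl_op C ->
  commute_ops A C -> commute_ops B C -> commute_ops (fun t => act1 A (B t)) C.
Proof.
move=> sA sB sC AC BC m n t; rewrite /act1 (lin_fsum_comm (sC.1 m)).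
  by apply: eq_fsum => p; rewrite BC AC.
by apply: act1_supp; [apply: fl_trunc|apply: sB.2].
Qed.

Section ThreeSlots.
Variable U : lmodType F.
Implicit Types A B : tensor U U -> int -> tensor U U.
Let U3 := tensor (tensor U U) U.

(** The rotation of u ⊗ v ⊗ w to v ⊗ w ⊗ u, bringing slots 2 and 3 to the front. *)
Definition cyc3 (t : U3) : U3 := tswap (tassoc t).
Definition uncyc3 (t : U3) : U3 := tassocV (tswap t).

Lemma uncyc3K t : cyc3 (uncyc3 t) = t.
Proof. by rewrite /cyc3 /uncyc3 tassocVK tswapK. Qed.

Lemma lin_cyc3 : linear cyc3.
Proof. by rewrite /cyc3; apply: lin_tswap; apply: lin_tassoc; lin. Qed.

Lemma lin_uncyc3 : linear uncyc3.
Proof. by rewrite /uncyc3; apply: lin_tassocV; apply: lin_tswap; lin. Qed.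

Lemma lin_tswap23 : linear (@tswap23 F U).
Proof.
rewrite /tswap23; apply: lin_tassocV.
apply: lin_tmap; [by lin|by apply: (lin_tswap (f := id)); lin|].
by apply: lin_tassoc; lin.
Qed.

Lemma tswap23E (u v w : U) : tswap23 (u ⊗ v ⊗ w) = u ⊗ w ⊗ v.
Proof.
rewrite /tswap23 tassocE tmapE ?tswapE ?tassocVE //.
by apply: (lin_tswap (f := id)); lin.
Qed.

Lemma tswap23K (t : U3) : tswap23 (tswap23 t) = t.
Proof.
apply: (ext3 (f := fun t : U3 => tswap23 (tswap23 t)) (g := fun t : U3 => t)).
- by apply: lin_comp lin_tswap23 lin_tswap23.
- by lin.
- by move=> u v w; rewrite !tswap23E.
Qed.

Lemma S23_cyc3 A t n : lin_op A -> S23 A t n = uncyc3 (S12 A (cyc3 t) n).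
Proof.
move=> lA; rewrite /S23 /uncyc3 /cyc3; congr tassocV; move: (tassoc t) => {t}.
have lAn := lA n.
apply: (ext2 (f := fun t => tmap id (fun p => A p n) t)
  (g := fun t => tswap (S12 A (tswap t) n))) => [||u p].
- by lin.
- apply: lin_tswap; apply: lin_tmap => //; first by lin.
- by rewrite tswapE /S12 !tmapE // tswapE.
Qed.

Lemma fl_op_S12 A : fl_op A -> fl_op (S12 A).
Proof. exact: fl_op_amplify. Qed.

Lemma fl_op_S13 A : fl_op A -> fl_op (S13 A).
Proof.
move=> sA; apply: (fl_op_conj (A := S12 A)); try exact: lin_tswap23.
exact: fl_op_S12.
Qed.

Lemma fl_op_S23 A : fl_op A -> fl_op (S23 A).
Proof.
move=> sA; have -> : S23 A = fun t n => uncyc3 (S12 A (cyc3 t) n).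
  by apply/funext => t; apply/funext => n; apply: S23_cyc3 sA.1.
by apply: fl_op_conj; [exact: lin_uncyc3|exact: lin_cyc3|exact: fl_op_S12].
Qed.

Lemma S12_comp A B t : fl_op A -> fl_op B ->
  act1 (S12 A) (S12 B t) = S12 (fun p => act1 A (B p)) t.
Proof. by move=> sA sB; apply: amplify_comp => //; apply: fl_trunc. Qed.

Lemma S13_comp A B t : fl_op A -> fl_op B ->
  act1 (S13 A) (S13 B t) = S13 (fun p => act1 A (B p)) t.
Proof.
move=> sA sB; rewrite /S13.
rewrite (act1_conj (A := S12 A) (B := S12 B) (P := @tswap23 F U)
  (P' := @tswap23 F U) (Q' := @tswap23 F U) (@tswap23 F U) t).
- by apply/funext => n; rewrite S12_comp.
- exact: lin_tswap23.
- by apply: fl_trunc; apply: fl_op_S12.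
- exact: fl_op_S12.
- exact: tswap23K.
Qed.

Lemma S23_comp A B t : fl_op A -> fl_op B ->
  act1 (S23 A) (S23 B t) = S23 (fun p => act1 A (B p)) t.
Proof.
move=> sA sB; have e C : lin_op C -> S23 C = fun t n => uncyc3 (S12 C (cyc3 t) n).
  by move=> lC; apply/funext => x; apply/funext => n; apply: S23_cyc3.
have sAB := fl_op_comp sA sB.
rewrite (e _ sA.1) (e _ sB.1) (e _ sAB.1).
rewrite (act1_conj (A := S12 A) (B := S12 B) (P := uncyc3)
  (P' := uncyc3) (Q' := cyc3) cyc3 t).
- by apply/funext => n; rewrite S12_comp.
- exact: lin_uncyc3.
- by apply: fl_trunc; apply: fl_op_S12.
- exact: fl_op_S12.
- exact: uncyc3K.
Qed.

Lemma S12E A (u v w : U) n : lin_op A -> S12 A (u ⊗ v ⊗ w) n = A (u ⊗ v) n ⊗ w.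
Proof. exact: amplifyE. Qed.

Lemma S23E A (u v w : U) n : lin_op A ->
  S23 A (u ⊗ v ⊗ w) n = tassocV (u ⊗ A (v ⊗ w) n).
Proof. by move=> lA; rewrite /S23 tassocE tmapE. Qed.

Lemma S13E A (u v w : U) n : lin_op A ->
  S13 A (u ⊗ v ⊗ w) n = tswap23 (A (u ⊗ w) n ⊗ v).
Proof. by move=> lA; rewrite /S13 tswap23E S12E. Qed.

End ThreeSlots.
End Slots.

Lemma tsum_tmap (F : fieldType) (V V' W W' X : lmodType F) (f : V' -> W' -> X)
    (a : V -> V') (b : W -> W') t :
  (forall w, linear (f^~ w)) -> (forall v, linear (f v)) ->
  tsum f (tmap a b t) = tsum (fun v w => f (a v) (b w)) t.
Proof.
move=> l1 l2; rewrite /tmap lin_tsum; last by apply: tsum_linear.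
by apply: eq_tsum => v w; rewrite tsumE.
Qed.

Lemma scale_tmap (F : fieldType) (V W : lmodType F) (c : F) (t : tensor V W) :
  c *: t = tmap (fun v => c *: v) id t.
Proof.
apply: (ext2 (f := fun t => c *: t) (g := fun t => tmap (fun v => c *: v) id t)) => [||v w].
- by lin.
- by lin.
- rewrite tmapE //; last by lin.
  by rewrite (linZ (f := fun x => x ⊗ w)) //; lin.
Qed.

(** * Slots acting on each other through the coaction *)

Section Coaction.
Variables (F : fieldType) (H V : lmodType F).
Variables (Delta : {linear H -> tensor H H}) (eps : {linear H -> F^o}).
Variable rho : {linear V -> tensor V H}.
Hypothesis coassoc : forall v, tassoc (tmap rho id (rho v)) = tmap id Delta (rho v).
Hypothesis counit : forall v, tsum (fun v1 h => eps h *: v1) (rho v) = v.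
Hypothesis cocomm : cocommutative Delta.
Implicit Type X : lmodType F.

Lemma rho_coassoc X (G : V -> H -> H -> X) v :
  (forall h k, linear (fun a => G a h k)) -> (forall a k, linear (fun h => G a h k)) ->
  (forall a h, linear (G a h)) ->
  tsum (fun a h => tsum (fun a' h' => G a' h' h) (rho a)) (rho v) =
  tsum (fun a h => tsum (fun h1 h2 => G a h1 h2) (Delta h)) (rho v).
Proof.
move=> l1 l2 l3.
transitivity (tsum (fun a p => tsum (G a) p) (tmap id Delta (rho v))).
  rewrite -coassoc /tassoc lin_tsum; last by apply: tsum_linear; apply: bilinP => ?; lin.
  rewrite (tsum_tmap (f := fun p w => tsum (fun a p => tsum (G a) p)
    (tsum (fun a h => a ⊗ (h ⊗ w)) p))); first last.
  - by move=> ?; lin.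
  - by move=> ?; lin.
  apply: eq_tsum => a h; rewrite lin_tsum; last by lin.
  apply: eq_tsum => a' h'; rewrite !tsumE // => ?; lin.
by rewrite tsum_tmap // => ?; lin.
Qed.

(** This is where cocommutativity enters: the two H-legs of an iterated coaction are
    interchangeable, so two actions issued by one slot can trade places. *)
Lemma rho_swap X (G : V -> H -> H -> X) v :
  (forall h k, linear (fun a => G a h k)) -> (forall a k, linear (fun h => G a h k)) ->
  (forall a h, linear (G a h)) ->
  tsum (fun a h => tsum (fun a' h' => G a' h' h) (rho a)) (rho v) =
  tsum (fun a h => tsum (fun a' h' => G a' h h') (rho a)) (rho v).
Proof.
move=> l1 l2 l3; rewrite rho_coassoc // (rho_coassoc (G := fun a h h' => G a h' h)) //.
apply: eq_tsum => a h; rewrite -{1}(cocomm h) /tswap lin_tsum; last by lin.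
by apply: eq_tsum => h1 h2; rewrite tsumE.
Qed.

Lemma rho_counit X (g : V -> X) v : linear g ->
  tsum (fun v1 h => eps h *: g v1) (rho v) = g v.
Proof.
move=> lg; rewrite -{2}(counit v) lin_tsum //.
by apply: eq_tsum => a h; rewrite linZ.
Qed.

(** One coefficient of a compatible module structure. Since [f] commutes with the coaction, a slot
    that has been acted on still issues the same H-legs. *)
Record co_op (f : H -> V -> V) : Prop := {
  co_op_l : forall v, linear (f^~ v);
  co_op_r : forall h, linear (f h);
  co_op_rho : forall h v, rho (f h v) = tmap (f h) id (rho v)
}.

Definition hcommute (f g : H -> V -> V) : Prop :=
  forall h k v, f h (g k v) = g k (f h v).

Definition counit_op (h : H) (v : V) : V := eps h *: v.

Lemma co_op_counit_op : co_op counit_op.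
Proof.
split=> [v|h|h v]; rewrite /counit_op; [by lin|by lin|].
rewrite linearZ /=; exact: scale_tmap.
Qed.

Lemma hcommute_eopl f : co_op f -> hcommute counit_op f.
Proof. by case=> _ l2 _ h k v; rewrite /counit_op linZ. Qed.

Lemma hcommute_eopr f : co_op f -> hcommute f counit_op.
Proof. by case=> _ l2 _ h k v; rewrite /counit_op linZ. Qed.

Lemma lin_co_op_l X f (E : X -> H) v : co_op f -> linear E -> linear (fun x => f (E x) v).
Proof. by case=> l1 _ _ lE; apply: (lin_comp (g := f^~ v)). Qed.

Lemma lin_co_op_r X f (E : X -> V) h : co_op f -> linear E -> linear (fun x => f h (E x)).
Proof. by case=> _ l2 _ lE; apply: lin_comp. Qed.

Lemma tsum_co_op X f (G : V -> H -> X) h v : co_op f ->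
  (forall k, linear (G^~ k)) -> (forall a, linear (G a)) ->
  tsum G (rho (f h v)) = tsum (fun a k => G (f h a) k) (rho v).
Proof. by move=> hf l1 l2; rewrite (co_op_rho hf) tsum_tmap. Qed.

Ltac linh := match goal with
  | [ h : co_op _ |- _ ] => first [apply: (lin_co_op_l _ h) | apply: (lin_co_op_r _ h)]
  end.
Ltac hlin := repeat (cbv beta; first [lin1 | linh]).

(** The two slots act on each other simultaneously. With [counit_op] for [f] or [g] the action is
    one-way, so coefficients of E_12, E_21, F_12 and F_21 are all instances. *)
Definition twist (f g : H -> V -> V) (t : tensor V V) : tensor V V :=
  tsum (fun v u => tsum (fun v1 v2 => tsum (fun u1 u2 =>
    f u2 v1 ⊗ g v2 u1) (rho u)) (rho v)) t.

Lemma lin_twist f g : co_op f -> co_op g -> linear (twist f g).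
Proof. by move=> hf hg; rewrite /twist; hlin. Qed.

Lemma twistE f g v u : co_op f -> co_op g ->
  twist f g (v ⊗ u) =
  tsum (fun v1 v2 => tsum (fun u1 u2 => f u2 v1 ⊗ g v2 u1) (rho u)) (rho v).
Proof. by move=> hf hg; rewrite /twist tsumE // => ?; hlin. Qed.

Lemma twist_eopl g v u : co_op g ->
  twist counit_op g (v ⊗ u) = tsum (fun v1 v2 => v1 ⊗ g v2 u) (rho v).
Proof.
move=> hg; rewrite twistE //; last exact: co_op_counit_op.
apply: eq_tsum => v1 v2; rewrite -(rho_counit (g := fun u => v1 ⊗ g v2 u)); last by hlin.
apply: eq_tsum => u1 u2; rewrite /counit_op.
by rewrite (linZ (f := fun x => x ⊗ _)) //; lin.
Qed.

Lemma twist_eopr f v u : co_op f ->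
  twist f counit_op (v ⊗ u) = tsum (fun u1 u2 => f u2 v ⊗ u1) (rho u).
Proof.
move=> hf; rewrite twistE //; last exact: co_op_counit_op.
rewrite tsum_exchange; apply: eq_tsum => u1 u2.
rewrite -(rho_counit (g := fun v => f u2 v ⊗ u1)); last by hlin.
apply: eq_tsum => v1 v2; rewrite /counit_op.
by rewrite (linZ (f := fun x => _ ⊗ x)) //; lin.
Qed.

Lemma twist_comp f g f' g' v u : co_op f -> co_op g -> co_op f' -> co_op g' ->
  twist f g (twist f' g' (v ⊗ u)) =
  tsum (fun v0 h0 => tsum (fun u0 k0 => tsum (fun v1 h => tsum (fun u1 k =>
    f k (f' k0 v1) ⊗ g h (g' h0 u1)) (rho u0)) (rho v0)) (rho u)) (rho v).
Proof.
move=> hf hg hf' hg'; have lT := lin_twist hf hg.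
rewrite twistE // lin_tsum //; apply: eq_tsum => v0 h0.
rewrite lin_tsum //; apply: eq_tsum => u0 k0.
rewrite twistE // tsum_co_op //; try by move=> ?; hlin.
by apply: eq_tsum => v1 h; rewrite tsum_co_op // => ?; hlin.
Qed.

(** Each slot issues two H-legs and receives two operators: [rho_swap] exchanges the legs, the
    commutation hypotheses exchange the operators. *)
Lemma twist_comm f g f' g' t : co_op f -> co_op g -> co_op f' -> co_op g' ->
  hcommute f f' -> hcommute g g' -> twist f g (twist f' g' t) = twist f' g' (twist f g t).
Proof.
move=> hf hg hf' hg' ff' gg'.
have lT := lin_twist hf hg; have lT' := lin_twist hf' hg'.
apply: (ext2 (f := fun t => twist f g (twist f' g' t)) (g := fun t => twist f' g' (twist f g t)));
  try exact: lin_comp.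
move=> v u; rewrite !twist_comp //.
transitivity (tsum (fun v0 h0 => tsum (fun v1 h => tsum (fun u0 k0 => tsum (fun u1 k =>
    f k (f' k0 v1) ⊗ g h (g' h0 u1)) (rho u0)) (rho u)) (rho v0)) (rho v)).
  by apply: eq_tsum => v0 h0; rewrite tsum_exchange.
rewrite (rho_swap (G := fun v1 h h0 => tsum (fun u0 k0 => tsum (fun u1 k =>
    f k (f' k0 v1) ⊗ g h (g' h0 u1)) (rho u0)) (rho u))); try by move=> ? ?; hlin.
apply: eq_tsum => v0 h0; rewrite tsum_exchange.
transitivity (tsum (fun v1 h => tsum (fun u0 k0 => tsum (fun u1 k =>
    f' k (f k0 v1) ⊗ g' h (g h0 u1)) (rho u0)) (rho u)) (rho v0)); last exact: tsum_exchange.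
rewrite [LHS]tsum_exchange; apply: eq_tsum => v1 h.
rewrite (rho_swap (G := fun u1 k k0 => f k (f' k0 v1) ⊗ g h0 (g' h u1)));
  try by move=> ? ?; hlin.
by apply: eq_tsum => u0 k0; apply: eq_tsum => u1 k; rewrite ff' gg'.
Qed.

Let V3 := tensor (tensor V V) V.

(** [T12], [T23] and [T13] are [S12], [S23] and [S13] for a single coefficient. *)
Definition T12 (a : tensor V V -> tensor V V) (t : V3) : V3 := tmap a id t.
Definition T23 (a : tensor V V -> tensor V V) (t : V3) : V3 :=
  tassocV (tmap id a (tassoc t)).
Definition T13 (a : tensor V V -> tensor V V) (t : V3) : V3 :=
  tswap23 (T12 a (tswap23 t)).

Lemma lin_T12 a : linear a -> linear (T12 a).
Proof. by move=> la; rewrite /T12; lin. Qed.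

Lemma lin_T23 a : linear a -> linear (T23 a).
Proof.
move=> la; rewrite /T23; apply: lin_tassocV; apply: lin_tmap; [by lin|by []|].
by apply: lin_tassoc; lin.
Qed.

Lemma lin_T13 a : linear a -> linear (T13 a).
Proof.
move=> la; have l23 := @lin_tswap23 F V.
exact: (lin_comp l23 (lin_comp (lin_T12 la) l23)).
Qed.

Section Two.
Variables f g : H -> V -> V.
Hypotheses (hf : co_op f) (hg : co_op g).

Lemma T12_twist u v w : T12 (twist f g) (u ⊗ v ⊗ w) =
  tsum (fun u1 h => tsum (fun v1 k => f k u1 ⊗ g h v1 ⊗ w) (rho v)) (rho u).
Proof.
rewrite /T12 tmapE //; last exact: lin_twist.
rewrite twistE // (lin_tsum (f := fun x => x ⊗ w)); last by lin.
apply: eq_tsum => u1 h; rewrite (lin_tsum (f := fun x => x ⊗ w)) //; lin.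
Qed.

Lemma T13_twist u v w : T13 (twist f g) (u ⊗ v ⊗ w) =
  tsum (fun u1 h => tsum (fun w1 k => f k u1 ⊗ v ⊗ g h w1) (rho w)) (rho u).
Proof.
have l23 := @lin_tswap23 F V.
rewrite /T13 tswap23E T12_twist lin_tsum //; apply: eq_tsum => u1 h.
by rewrite lin_tsum //; apply: eq_tsum => w1 k; rewrite tswap23E.
Qed.

Lemma T23_twist u v w : T23 (twist f g) (u ⊗ v ⊗ w) =
  tsum (fun v1 h => tsum (fun w1 k => u ⊗ f k v1 ⊗ g h w1) (rho w)) (rho v).
Proof.
have lT : linear (fun p : tensor V V => tassocV (u ⊗ p)).
  by apply: lin_tassocV; lin.
rewrite /T23 tassocE tmapE //; last exact: lin_twist.
rewrite twistE // (lin_tsum (f := fun p => tassocV (u ⊗ p))) //.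
apply: eq_tsum => v1 h; rewrite (lin_tsum (f := fun p => tassocV (u ⊗ p))) //.
by apply: eq_tsum => w1 k; rewrite tassocVE.
Qed.

End Two.

Variables f g f' g' : H -> V -> V.
Hypotheses (hf : co_op f) (hg : co_op g) (hf' : co_op f') (hg' : co_op g').

Let l12 := lin_T12 (lin_twist hf hg).
Let l13 := lin_T13 (lin_twist hf hg).
Let l13' := lin_T13 (lin_twist hf' hg').
Let l23' := lin_T23 (lin_twist hf' hg').

(** The shared slot is 1: it receives [f] and [f'], and its two H-legs are exchanged by [rho_swap].
    The operators [g] and [g'] land in different slots. *)
Lemma T12_T13 t : hcommute f f' ->
  T12 (twist f g) (T13 (twist f' g') t) = T13 (twist f' g') (T12 (twist f g) t).
Proof.
move=> ff'; apply: (ext3 (f := fun t => T12 (twist f g) (T13 (twist f' g') t))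
  (g := fun t => T13 (twist f' g') (T12 (twist f g) t))); try exact: lin_comp.
move=> u v w; rewrite T13_twist // T12_twist //.
transitivity (tsum (fun u1 h => tsum (fun a l => tsum (fun v1 m => tsum (fun w1 k =>
   f m (f' k a) ⊗ g l v1 ⊗ g' h w1) (rho w)) (rho v)) (rho u1)) (rho u)).
  rewrite lin_tsum //; apply: eq_tsum => u1 h.
  transitivity (tsum (fun w1 k => tsum (fun a l => tsum (fun v1 m =>
      f m (f' k a) ⊗ g l v1 ⊗ g' h w1) (rho v)) (rho u1)) (rho w)).
    rewrite lin_tsum //; apply: eq_tsum => w1 k.
    by rewrite T12_twist // tsum_co_op // => ?; hlin.
  rewrite tsum_exchange; apply: eq_tsum => a l; exact: tsum_exchange.
rewrite (rho_swap (G := fun a l h => tsum (fun v1 m => tsum (fun w1 k =>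
   f m (f' k a) ⊗ g l v1 ⊗ g' h w1) (rho w)) (rho v))); try by move=> ? ?; hlin.
rewrite lin_tsum //; apply: eq_tsum => u1 h.
rewrite lin_tsum // tsum_exchange; apply: eq_tsum => v1 m.
rewrite T13_twist // tsum_co_op //; try by move=> ?; hlin.
by apply: eq_tsum => a l; apply: eq_tsum => w1 k; rewrite ff'.
Qed.

(** The shared slot is 2, which receives [g] and [f']. *)
Lemma T12_T23 t : hcommute g f' ->
  T12 (twist f g) (T23 (twist f' g') t) = T23 (twist f' g') (T12 (twist f g) t).
Proof.
move=> gf'; apply: (ext3 (f := fun t => T12 (twist f g) (T23 (twist f' g') t))
  (g := fun t => T23 (twist f' g') (T12 (twist f g) t))); try exact: lin_comp.
move=> u v w; rewrite T23_twist // T12_twist //.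
transitivity (tsum (fun v1 h => tsum (fun a m => tsum (fun u1 l => tsum (fun w1 k =>
   f m u1 ⊗ g l (f' k a) ⊗ g' h w1) (rho w)) (rho u)) (rho v1)) (rho v)).
  rewrite lin_tsum //; apply: eq_tsum => v1 h.
  transitivity (tsum (fun w1 k => tsum (fun u1 l => tsum (fun a m =>
      f m u1 ⊗ g l (f' k a) ⊗ g' h w1) (rho v1)) (rho u)) (rho w)).
    rewrite lin_tsum //; apply: eq_tsum => w1 k.
    rewrite T12_twist //; apply: eq_tsum => u1 l.
    by rewrite tsum_co_op // => ?; hlin.
  rewrite tsum_exchange [RHS]tsum_exchange; apply: eq_tsum => a l; exact: tsum_exchange.
rewrite (rho_swap (G := fun a m h => tsum (fun u1 l => tsum (fun w1 k =>
   f m u1 ⊗ g l (f' k a) ⊗ g' h w1) (rho w)) (rho u))); try by move=> ? ?; hlin.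
transitivity (tsum (fun u1 l => tsum (fun v1 m => tsum (fun a h => tsum (fun w1 k =>
   f m u1 ⊗ f' k (g l a) ⊗ g' h w1) (rho w)) (rho v1)) (rho v)) (rho u)).
  rewrite [RHS]tsum_exchange; apply: eq_tsum => v1 m.
  rewrite tsum_exchange; apply: eq_tsum => u1 l.
  by apply: eq_tsum => a h; apply: eq_tsum => w1 k; rewrite gf'.
rewrite lin_tsum //; apply: eq_tsum => u1 l.
rewrite lin_tsum //; apply: eq_tsum => v1 m.
by rewrite T23_twist // tsum_co_op // => ?; hlin.
Qed.

(** The shared slot is 3, which receives [g] and [g']. *)
Lemma T13_T23 t : hcommute g g' ->
  T13 (twist f g) (T23 (twist f' g') t) = T23 (twist f' g') (T13 (twist f g) t).
Proof.
move=> gg'; apply: (ext3 (f := fun t => T13 (twist f g) (T23 (twist f' g') t))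
  (g := fun t => T23 (twist f' g') (T13 (twist f g) t))); try exact: lin_comp.
move=> u v w; rewrite T23_twist // T13_twist //.
transitivity (tsum (fun v1 h => tsum (fun u1 l => tsum (fun w0 k => tsum (fun w1 m =>
   f m u1 ⊗ f' k v1 ⊗ g l (g' h w1)) (rho w0)) (rho w)) (rho u)) (rho v)).
  rewrite lin_tsum //; apply: eq_tsum => v1 h.
  rewrite lin_tsum // [RHS]tsum_exchange; apply: eq_tsum => w0 k.
  rewrite T13_twist //; apply: eq_tsum => u1 l.
  by rewrite tsum_co_op // => ?; hlin.
rewrite tsum_exchange lin_tsum //; apply: eq_tsum => u1 l.
transitivity (tsum (fun v1 h => tsum (fun w0 m => tsum (fun w1 k =>
   f m u1 ⊗ f' k v1 ⊗ g' h (g l w1)) (rho w0)) (rho w)) (rho v)).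
  apply: eq_tsum => v1 h; rewrite (rho_swap (G := fun w1 m k =>
     f m u1 ⊗ f' k v1 ⊗ g l (g' h w1))); try by move=> ? ?; hlin.
  by apply: eq_tsum => w0 k; apply: eq_tsum => w1 m; rewrite gg'.
rewrite lin_tsum // tsum_exchange; apply: eq_tsum => w0 m.
rewrite T23_twist //; apply: eq_tsum => v1 h.
by rewrite tsum_co_op // => ?; hlin.
Qed.

End Coaction.

(** * Membership in W ⊗ C((x)), default sums and signs *)

Section SeriesFacts.
Variable F : fieldType.
Implicit Types T U V W X : lmodType F.

Lemma finite_laurent_ss W (s : int -> W) : finite_laurent s -> flaurent s.
Proof.
case=> k [w [f [tf sE]]]; have e : s = fun n => \sum_(i < k) f i n *: w i by apply/funext.
rewrite e; split.
  apply: trunc_big => i; have [N h] := tf i; exists N => n /h ->.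
  by rewrite scale0r.
by apply: finspan_big => i; apply: finspanZ; apply: finspan_cst.
Qed.

Lemma ss_finite_laurent W (s : int -> W) : flaurent s -> finite_laurent s.
Proof.
case=> [[N h] [l hl]].
have hc n : exists c : 'I_(size l) -> F, s n = \sum_i c i *: l`_i.
  apply: (hl n (fun w => exists c : 'I_(size l) -> F, w = \sum_i c i *: l`_i)).
  - split=> [|a x y [c ->] [d ->]].
      by exists (fun=> 0); rewrite big1 // => i _; rewrite scale0r.
    exists (fun i => a * c i + d i); rewrite scaler_sumr -big_split.
    by apply: eq_bigr => i _; rewrite scalerDl scalerA.
  - move=> x xl; have hx : (index x l < size l)%N by rewrite index_mem.
    exists (fun i => (i == Ordinal hx)%:R); rewrite (bigD1 (Ordinal hx)) //= eqxx scale1r.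
    rewrite nth_index // big1 ?addr0 // => i /negPf ->; by rewrite scale0r.
(* The generators may be dependent, so coordinates are chosen separately at each exponent; replacing
   them by 0 below [N] makes every coordinate series truncated. *)
have [c hc'] := boolp.choice hc.
exists (size l), (fun i => l`_i), (fun i n => if n < N then 0 else c n i); split=> [i|n].
  by exists N => n ->.
have [nN|nN] := ltP n N; last exact: hc'.
by rewrite h // big1 // => i _; rewrite scale0r.
Qed.

Lemma flaurent_neg W (s : int -> W) : flaurent s -> flaurent (neg_series s).
Proof.
case=> [[N h] fs]; split; last exact: finspanZ.
by exists N => n /h e; rewrite /neg_series e scaler0.
Qed.

Lemma fl_op_neg T W (A : T -> int -> W) : fl_op A -> fl_op (fun t => neg_series (A t)).
Proof.
move=> sA; split=> [n|t]; last by apply: flaurent_neg; apply: sA.2.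
by rewrite /neg_series; apply: lin_scale; apply: sA.1.
Qed.

Lemma truncated2_op V W (A : V -> int -> W) (s : int -> V) : trunc_op A -> flaurent s ->
  truncated2 (fun m n => A (s n) m).
Proof.
move=> wA ss; have [N h] := act1_bound wA ss.
by exists N => m n hmn; apply: h; rewrite orbC.
Qed.

(** The coefficient of [x^s z^k] in [Y(z) A(x + e z) B(x) t]. *)
Lemma act2_expandE e T U V W (Y : V -> int -> W) (A : U -> int -> V) (B : T -> int -> U)
    t s k : trunc_op Y -> fl_op A -> fl_op B ->
  act2 (in_z Y) (act2 (fun t => expand e (A t)) (in_x B t)) s k =
  \sum_(q \in [set: int]) \sum_(p \in [set: int])
    Y (A (B t p) (s - p + q)) (k - q) *~ expker e (s - p + q) q.
Proof.
move=> wY sA sB; rewrite act2_in_z; last by case: wY.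
apply: eq_fsumz => q; rewrite act2_in_xr; last by apply: lin_expand sA.1.
have [N h] := act1_bound (fl_trunc sA) (sB.2 t).
rewrite (lin_fsum_comm (wY.1 (k - q))).
  by apply: eq_fsumz => p; rewrite expandE (linMz (wY.1 _)).
apply: (@fsupp_int _ _ N (s + q - N)) => p hp; rewrite expandE h ?mul0rz //; lia.
Qed.

Lemma fsum_nsupp (I : choiceType) W (f : I -> W) : ~ fsupp f ->
  \sum_(i \in [set: I]) f i = 0.
Proof.
move=> nf; apply: fsbig_dflt => /finite_seqP[s e]; apply: nf; exists s => i h.
apply: contrapT => fi; move/negP: h; apply.
by have : [set` s]%classic i by rewrite -e; split.
Qed.

(** A nonzero scalar preserves the support, so both sides take the default value together. *)
Lemma fsum_scale (I : choiceType) W (f : I -> W) (c : F) : c != 0 ->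
  c *: (\sum_(i \in [set: I]) f i) = \sum_(i \in [set: I]) c *: f i.
Proof.
move=> c0; have [fs|nfs] := pselect (fsupp f).
  by apply: (lin_fsum_comm (A := fun x => c *: x)) => //; apply: lin_scale; apply: lin_id.
rewrite !fsum_nsupp ?scaler0 // => -[s h]; apply: nfs; exists s => i /h /eqP.
by rewrite scaler_eq0 (negPf c0) => /eqP.
Qed.

Lemma signzD (a b : int) : (-1) ^+ `|(a + b)%R|%N = (-1) ^+ `|a|%N * (-1) ^+ `|b|%N :> F.
Proof.
rewrite -exprD -signr_odd -[RHS]signr_odd; congr (_ ^+ (nat_of_bool _)).
by lia.
Qed.

Lemma mulz_sign W (x : W) n : x *~ ((-1) ^+ n) = (-1) ^+ n *: x.
Proof. by rewrite -scaler_int rmorphXn /= rmorphN1. Qed.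

Lemma tsumD U V W (f g : U -> V -> W) t :
  tsum f t + tsum g t = tsum (fun a b => f a b + g a b) t.
Proof. by rewrite /tsum /tev big_split. Qed.

Lemma tsumB U V W (f g : U -> V -> W) t :
  tsum f t - tsum g t = tsum (fun a b => f a b - g a b) t.
Proof. by rewrite /tsum /tev sumrB. Qed.

End SeriesFacts.

Lemma binz1 n : n = binz n 1.
Proof. by case: n => m; rewrite /binz bin1 ?addn1 ?expr1 ?NegzE ?mulN1r. Qed.

(** * The exchange rules *)

Section Module.
Variables (F : fieldType) (H : lmodType F) (AH : vertex_struct H).
Variables (Delta : {linear H -> tensor H H}) (eps : {linear H -> F^o}).
Hypothesis H_bialg : nonlocal_vertex_bialgebra AH Delta eps.
Hypothesis cocomm : cocommutative Delta.
Variables (V : lmodType F) (A : vertex_struct V).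
Hypothesis V_nva : nonlocal_vertex_algebra A.
Variable rho : {linear V -> tensor V H}.
Hypothesis V_com : comodule_nva AH Delta eps A rho.

Let coassoc := cnva_coassoc V_com.
Let counit := cnva_counit V_com.

Lemma vop_lin1 b n : linear (fun a => vop A a b n).
Proof. exact: (nvam_bilinear (nva_self V_nva) n).1. Qed.

Lemma vop_lin2 a n : linear (fun b => vop A a b n).
Proof. exact: (nvam_bilinear (nva_self V_nva) n).2. Qed.

Lemma lin_vop1 (X : lmodType F) (E : X -> V) b n : linear E -> linear (fun x => vop A (E x) b n).
Proof. exact: (lin_comp (vop_lin1 b n)). Qed.

Lemma lin_vop2 (X : lmodType F) (E : X -> V) a n : linear E -> linear (fun x => vop A a (E x) n).
Proof. exact: (lin_comp (vop_lin2 a n)). Qed.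

Definition Yt (p : tensor V V) (n : int) : V := tsum (fun a b => vop A a b n) p.

Lemma YtE a b n : Yt (a ⊗ b) n = vop A a b n.
Proof. by apply: tsumE => ?; [apply: lin_vop1|apply: lin_vop2]; lin. Qed.

Lemma trunc_op_Yt : trunc_op Yt.
Proof.
split=> [n|t]; last by apply: trunc_tsum => a b; apply: (nvam_truncated (nva_self V_nva)).
by apply: lin_tsumt => [?|?|]; [apply: lin_vop1|apply: lin_vop2|]; lin.
Qed.

Definition Yid : tensor (tensor V V) V -> int -> tensor V V := amplify Yt.

Lemma trunc_op_Yid : trunc_op Yid.
Proof. exact: trunc_op_amplify trunc_op_Yt. Qed.

Lemma YidE u v w n : Yid (u ⊗ v ⊗ w) n = vop A u v n ⊗ w.
Proof. by rewrite /Yid amplifyE ?YtE //; case: trunc_op_Yt. Qed.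

Definition YL (t : tensor (tensor V V) V) (n : int) : tensor V V :=
  tmap id (fun p => Yt p n) (tassoc t).

Lemma trunc_op_YL : trunc_op YL.
Proof.
have [lY tY] := trunc_op_Yt; split=> [n|t].
  by apply: lin_tmap; [by lin|exact: lY|by apply: (lin_tassoc (f := id)); lin].
apply: trunc_tsum => u p; apply: (trunc_lin (A := fun x => u ⊗ x)) => //; lin.
Qed.

Lemma YLE u v w n : YL (u ⊗ v ⊗ w) n = u ⊗ vop A v w n.
Proof. by rewrite /YL tassocE tmapE ?YtE //; case: trunc_op_Yt. Qed.

Section OneStructure.
Variable Y : H -> V -> int -> V.
Hypothesis Y_mod : module_nva AH Delta eps A Y.
Hypothesis Y_comp : compatible rho Y.

Lemma mod_lin1 v n : linear (fun h => Y h v n).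
Proof. exact: (nvam_bilinear (mnva_module Y_mod) n).1. Qed.

Lemma mod_lin2 h n : linear (fun v => Y h v n).
Proof. exact: (nvam_bilinear (mnva_module Y_mod) n).2. Qed.

Lemma co_op_coef n : co_op rho (fun h v => Y h v n).
Proof.
split=> [v|h|h v]; [exact: mod_lin1|exact: mod_lin2|exact: Y_comp].
Qed.

Lemma lin_mod2 (X : lmodType F) (E : X -> V) h n : linear E -> linear (fun x => Y h (E x) n).
Proof. exact: (lin_comp (mod_lin2 h n)). Qed.

Lemma mod_ss h v : flaurent (Y h v).
Proof. exact/finite_laurent_ss/(mnva_laurent Y_mod). Qed.

Lemma mod_fl_op2 h : fl_op (Y h).
Proof. by split=> [n|v]; [exact: mod_lin2|exact: mod_ss]. Qed.

Lemma mod_trunc2 h k w : truncated2 (fun m n => Y h (Y k w n) m).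
Proof. by apply: truncated2_op; [apply/fl_trunc/mod_fl_op2|exact: mod_ss]. Qed.

(** Since [Y_M(h, x)v] is in [V (x) C((x))], products of two operators of the
    module satisfy weak associativity with [k = 0]. *)
Lemma mod_iterate h k w i p :
  Y (vop AH h k i) w p = subst_x1 (fun m n => Y h (Y k w n) m) i p.
Proof.
have [l /(_ w)[_ h2]] := nvam_assoc (mnva_module Y_mod) h k.
have := h2 (i + Posz l) p; rewrite addrK => <-.
by rewrite subst_mul_sub_pow ?addrK //; apply: mod_trunc2.
Qed.

(** For the structure [Y] this is E_12(x), and [coactL] is E_21(x). *)
Definition coactR (p : tensor V V) (n : int) : tensor V V :=
  twist rho (counit_op eps) (fun h v => Y h v n) p.

Definition coactL (p : tensor V V) (n : int) : tensor V V :=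
  twist rho (fun h v => Y h v n) (counit_op eps) p.

Let he := co_op_counit_op eps rho.

Lemma coactRE a b n : coactR (a ⊗ b) n = tsum (fun a1 a2 => a1 ⊗ Y a2 b n) (rho a).
Proof. by rewrite /coactR (twist_eopl counit) //; apply: co_op_coef. Qed.

Lemma coactLE a b n : coactL (a ⊗ b) n = tsum (fun b1 b2 => Y b2 a n ⊗ b1) (rho b).
Proof. by rewrite /coactL (twist_eopr counit) //; apply: co_op_coef. Qed.

Lemma lin_coactR n : linear (fun p => coactR p n).
Proof. by apply: lin_twist => //; apply: co_op_coef. Qed.

Lemma lin_coactL n : linear (fun p => coactL p n).
Proof. by apply: lin_twist => //; apply: co_op_coef. Qed.

Lemma fl_op_pure (B : tensor V V -> int -> tensor V V) : lin_op B ->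
  (forall a b, flaurent (B (a ⊗ b))) -> fl_op B.
Proof.
move=> lB hB; split=> // t.
have -> : B t = fun n => tsum (fun a b => B (a ⊗ b) n) t.
  by apply/funext => n; apply: (tsum_pureE (f := fun p => B p n)).
by apply: flaurent_tsum.
Qed.

Lemma fl_op_coactR : fl_op coactR.
Proof.
apply: fl_op_pure => [|a b]; first exact: lin_coactR.
have -> : coactR (a ⊗ b) = fun n => tsum (fun a1 a2 => a1 ⊗ Y a2 b n) (rho a).
  by apply/funext => n; apply: coactRE.
apply: flaurent_tsum => a1 a2; apply: (flaurent_lin (A := fun x => a1 ⊗ x)); first by lin.
exact: mod_ss.
Qed.

Lemma fl_op_coactL : fl_op coactL.
Proof.
apply: fl_op_pure => [|a b]; first exact: lin_coactL.
have -> : coactL (a ⊗ b) = fun n => tsum (fun b1 b2 => Y b2 a n ⊗ b1) (rho b).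
  by apply/funext => n; apply: coactLE.
apply: flaurent_tsum => b1 b2; apply: (flaurent_lin (A := fun x => x ⊗ b1)); first by lin.
exact: mod_ss.
Qed.

Lemma trunc_op2_vop_mod h w : trunc_op2 (fun c m n => vop A c (Y h w m) n).
Proof.
split=> [m n|c X]; first exact: vop_lin1.
have wc : trunc_op (vop A c).
  by split=> [n|b]; [exact: vop_lin2|exact: (nvam_truncated (nva_self V_nva))].
have [N hN] := act1_bound wc (mod_ss h w).
by exists N => m n _; apply: hN.
Qed.

Lemma S12_coactR u v w n : S12 coactR (u ⊗ v ⊗ w) n =
  tsum (fun a h => a ⊗ Y h v n ⊗ w) (rho u).
Proof.
rewrite S12E; last exact: lin_coactR.
by rewrite coactRE (lin_tsum (f := fun x => x ⊗ w)) //; lin.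
Qed.

Lemma S13_coactR u v w n : S13 coactR (u ⊗ v ⊗ w) n =
  tsum (fun a h => a ⊗ v ⊗ Y h w n) (rho u).
Proof.
have l23 : linear (fun x => tswap23 (x ⊗ v)).
  by apply: (lin_comp (@lin_tswap23 F V)); lin.
rewrite S13E; last exact: lin_coactR.
rewrite coactRE (lin_tsum (f := fun x => tswap23 (x ⊗ v))) //.
by apply: eq_tsum => a h; rewrite tswap23E.
Qed.

Lemma S23_coactR u v w n : S23 coactR (u ⊗ v ⊗ w) n =
  tsum (fun a h => u ⊗ a ⊗ Y h w n) (rho v).
Proof.
have la : linear (fun x : tensor V V => tassocV (u ⊗ x)) by apply: lin_tassocV; lin.
rewrite S23E; last exact: lin_coactR.
rewrite coactRE (lin_tsum (f := fun x => tassocV (u ⊗ x))) //.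
by apply: eq_tsum => a h; rewrite tassocVE.
Qed.

Lemma S13_coactL u v w n : S13 coactL (u ⊗ v ⊗ w) n =
  tsum (fun a h => Y h u n ⊗ v ⊗ a) (rho w).
Proof.
have l23 : linear (fun x => tswap23 (x ⊗ v)).
  by apply: (lin_comp (@lin_tswap23 F V)); lin.
rewrite S13E; last exact: lin_coactL.
rewrite coactLE (lin_tsum (f := fun x => tswap23 (x ⊗ v))) //.
by apply: eq_tsum => a h; rewrite tswap23E.
Qed.

Lemma S23_coactL u v w n : S23 coactL (u ⊗ v ⊗ w) n =
  tsum (fun a h => u ⊗ Y h v n ⊗ a) (rho w).
Proof.
have la : linear (fun x : tensor V V => tassocV (u ⊗ x)) by apply: lin_tassocV; lin.
rewrite S23E; last exact: lin_coactL.
rewrite coactLE (lin_tsum (f := fun x => tassocV (u ⊗ x))) //.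
by apply: eq_tsum => a h; rewrite tassocVE.
Qed.

Lemma mod_supp h1 h2 v w m n : fsupp (fun p : int * int =>
  vop A (expand_sub (Y h1 v) p.1 p.2) (Y h2 w (m - p.1)) (n - p.2)).
Proof.
exact: (act2_supp m n (trunc_op2_vop_mod h2 w) (flaurent2_expand (-1) (mod_ss h1 v))).
Qed.

Lemma fsum_rule (X : lmodType F) (K : int * int -> X) (G : int -> int -> X) a : fsupp K ->
  (forall p q, K (p, q) = G q (a - p)) ->
  \sum_(p \in [set: int * int]) K p =
  \sum_(q \in [set: int]) \sum_(p \in [set: int]) G q p.
Proof.
move=> fK KG.
have fK' : fsupp (fun p : int * int => K (p.1, p.2)).
  by apply: (fsupp_inj (h := fun p : int * int => (p.1, p.2)) (k := id)) fK => -[].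
transitivity (\sum_(p \in [set: int]) \sum_(q \in [set: int]) K (p, q)).
  by rewrite (fsum_pair fK'); apply: eq_fsum => -[].
rewrite (fsum_exchange fK'); apply: eq_fsumz => q; rewrite [RHS](fsum_sub _ a).
by apply: eq_fsumz => p; rewrite KG.
Qed.

(** [coactR] intertwines [1 (x) Y(z)] with the product of [coactR] on the slots [1, 2]
    at [x - z] and on the slots [1, 3] at [x]. *)
Lemma coactR_YL t a k : coactR (YL t k) a =
  act2 (in_z YL) (act2 (fun t => expand_sub (S12 coactR t)) (in_x (S13 coactR) t)) a k.
Proof.
have wL := trunc_op_YL; have s12 := fl_op_S12 fl_op_coactR; have s13 := fl_op_S13 fl_op_coactR.
move: t; apply: (ext3 (f := fun t => coactR (YL t k) a) (g := fun t => act2 (in_z YL)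
  (act2 (fun t => expand_sub (S12 coactR t)) (in_x (S13 coactR) t)) a k)) => [||u v w].
- exact: lin_comp (lin_coactR a) (wL.1 k).
- exact: act2_lin (trunc_op2_in_z wL) (fl_op2_comp (fl_op2_expand (-1) s12) (fl_op2_in_x s13)) a k.
pose K (u1 : V) (h1 h2 : H) (p : int * int) :=
  u1 ⊗ vop A (expand_sub (Y h1 v) p.1 p.2) (Y h2 w (a - p.1)) (k - p.2).
have lu (u1 : V) : linear (fun x : V => u1 ⊗ x) by lin.
have fK u1 h1 h2 : fsupp (K u1 h1 h2).
  exact: (fsupp_lin (lu u1) (mod_supp h1 h2 v w a k)).
rewrite YLE coactRE (act2_expandE (-1)) //.
transitivity (\sum_(p \in [set: int * int])
  tsum (fun a h => tsum (fun a' h' => K a' h' h p) (rho a)) (rho u)).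
  transitivity (tsum (fun u1 h => tsum (fun h1 h2 =>
      \sum_(p \in [set: int * int]) K u1 h1 h2 p) (Delta h)) (rho u)).
    apply: eq_tsum => u1 h; rewrite (mnva_vop Y_mod) (lin_tsum (f := fun x => u1 ⊗ x)) //.
    apply: eq_tsum => h1 h2; rewrite /act2 (lin_fsum_comm (lu u1)) //.
    exact: mod_supp.
  transitivity (\sum_(p \in [set: int * int])
      tsum (fun u1 h => tsum (fun h1 h2 => K u1 h1 h2 p) (Delta h)) (rho u)).
    rewrite -fsum_tsum => [|u1 h]; last by apply: fsupp_tsum.
    by apply: eq_tsum => u1 h; rewrite fsum_tsum.
  apply: eq_fsum => -[p q]; rewrite -(rho_coassoc coassoc (G := fun a h h' => K a h h' (p, q))) //.
  - by move=> h1 h2; rewrite /K; lin.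
  - move=> u1 h2; rewrite /K; apply: lin_pure2; apply: lin_vop1.
    exact: (lin_expand (-1) (fun n => mod_lin1 v n) p q).
  - by move=> u1 h1; rewrite /K; apply: lin_pure2; apply: lin_vop2; apply: mod_lin1.
apply: (fsum_rule (a := a)) => [|p q].
  by apply: fsupp_tsum => u1 h; apply: fsupp_tsum.
rewrite S13_coactR (lin_tsum _ _ (s12.1 _)) (lin_tsum _ _ (wL.1 _)).
rewrite (lin_tsum (f := fun x => x *~ _)); last by apply: lin_mulz; lin.
apply: eq_tsum => a1 h; rewrite S12_coactR (lin_tsum _ _ (wL.1 _)).
rewrite (lin_tsum (f := fun x => x *~ _)); last by apply: lin_mulz; lin.
apply: eq_tsum => a' h'; rewrite YLE /K /= /expand_sub expandE.
by rewrite (linMz (vop_lin1 _ _)) (linMz (lu a')) subKr.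
Qed.

(** Slot 3 acts on a product, so the module axiom gives a third rule: E_{3,(12)}(x) (Y(z) ⊗ 1) =
    (Y(z) ⊗ 1) E_31(x - z) E_32(x). *)
Lemma coactL_Yid t a k : coactL (Yid t k) a =
  act2 (in_z Yid) (act2 (fun t => expand_sub (S13 coactL t)) (in_x (S23 coactL) t)) a k.
Proof.
have wL := trunc_op_Yid; have s13 := fl_op_S13 fl_op_coactL; have s23 := fl_op_S23 fl_op_coactL.
move: t; apply: (ext3 (f := fun t => coactL (Yid t k) a) (g := fun t => act2 (in_z Yid)
  (act2 (fun t => expand_sub (S13 coactL t)) (in_x (S23 coactL) t)) a k)) => [||u v w].
- exact: lin_comp (lin_coactL a) (wL.1 k).
- exact: act2_lin (trunc_op2_in_z wL) (fl_op2_comp (fl_op2_expand (-1) s13) (fl_op2_in_x s23)) a k.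
pose K (w1 : V) (h1 h2 : H) (p : int * int) :=
  vop A (expand_sub (Y h1 u) p.1 p.2) (Y h2 v (a - p.1)) (k - p.2) ⊗ w1.
have lu (w1 : V) : linear (fun x : V => x ⊗ w1) by lin.
have fK u1 h1 h2 : fsupp (K u1 h1 h2).
  exact: (fsupp_lin (lu u1) (mod_supp h1 h2 u v a k)).
rewrite YidE coactLE (act2_expandE (-1)) //.
transitivity (\sum_(p \in [set: int * int])
  tsum (fun a h => tsum (fun a' h' => K a' h' h p) (rho a)) (rho w)).
  transitivity (tsum (fun u1 h => tsum (fun h1 h2 =>
      \sum_(p \in [set: int * int]) K u1 h1 h2 p) (Delta h)) (rho w)).
    apply: eq_tsum => u1 h; rewrite (mnva_vop Y_mod) (lin_tsum (f := fun x => x ⊗ u1)) //.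
    apply: eq_tsum => h1 h2; rewrite /act2 (lin_fsum_comm (lu u1)) //.
    exact: mod_supp.
  transitivity (\sum_(p \in [set: int * int])
      tsum (fun u1 h => tsum (fun h1 h2 => K u1 h1 h2 p) (Delta h)) (rho w)).
    rewrite -fsum_tsum => [|u1 h]; last by apply: fsupp_tsum.
    by apply: eq_tsum => u1 h; rewrite fsum_tsum.
  apply: eq_fsum => -[p q]; rewrite -(rho_coassoc coassoc (G := fun a h h' => K a h h' (p, q))) //.
  - by move=> h1 h2; rewrite /K; lin.
  - move=> u1 h2; rewrite /K; apply: lin_pure1; apply: lin_vop1.
    exact: (lin_expand (-1) (fun n => mod_lin1 u n) p q).
  - by move=> u1 h1; rewrite /K; apply: lin_pure1; apply: lin_vop2; apply: mod_lin1.
apply: (fsum_rule (a := a)) => [|p q].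
  by apply: fsupp_tsum => u1 h; apply: fsupp_tsum.
rewrite S23_coactL (lin_tsum _ _ (s13.1 _)) (lin_tsum _ _ (wL.1 _)).
rewrite (lin_tsum (f := fun x => x *~ _)); last by apply: lin_mulz; lin.
apply: eq_tsum => a1 h; rewrite S13_coactL (lin_tsum _ _ (wL.1 _)).
rewrite (lin_tsum (f := fun x => x *~ _)); last by apply: lin_mulz; lin.
apply: eq_tsum => a' h'; rewrite YidE /K /= /expand_sub expandE.
by rewrite (linMz (vop_lin1 _ _)) (linMz (lu a')) subKr.
Qed.

Definition coactLn (p : tensor V V) : int -> tensor V V := neg_series (coactL p).

Lemma fl_op_coactLn : fl_op coactLn.
Proof. exact: fl_op_neg fl_op_coactL. Qed.

(** At -x the shifted argument is -x - z = -(x + z), so the signs turn [expand_sub] into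
    [expand_add], the form that the hexagon requires. *)
Lemma coactLn_Yid t a k : coactLn (Yid t k) a =
  act2 (in_z Yid) (act2 (fun t => expand_add (S13 coactLn t)) (in_x (S23 coactLn) t)) a k.
Proof.
have wL := trunc_op_Yid.
have s13 := fl_op_S13 fl_op_coactL; have s23 := fl_op_S23 fl_op_coactL.
have s13' := fl_op_S13 fl_op_coactLn; have s23' := fl_op_S23 fl_op_coactLn.
have e13 x n : S13 coactLn x n = (-1) ^+ `|n|%N *: S13 coactL x n.
  rewrite /S13 /S12 /coactLn /neg_series.
  rewrite -[RHS](linZ (@lin_tswap23 F V)); congr tswap23; move: (tswap23 x).
  have l := lin_coactL n.
  apply: (ext2 (f := fun t => tmap (fun p => (-1) ^+ `|n|%N *: coactL p n) id t)
    (g := fun t => (-1) ^+ `|n|%N *: tmap (fun p => coactL p n) id t)) => [||p y]; try by lin.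
  by rewrite !tmapE //; try by lin; rewrite (linZ (f := fun x => x ⊗ y)) //; lin.
have e23 x n : S23 coactLn x n = (-1) ^+ `|n|%N *: S23 coactL x n.
  rewrite !S23_cyc3; [|exact: lin_coactL|by case: fl_op_coactLn].
  rewrite -[RHS](linZ (@lin_uncyc3 F V)); congr uncyc3; move: (cyc3 x).
  have l := lin_coactL n.
  apply: (ext2 (f := fun t => tmap (fun p => (-1) ^+ `|n|%N *: coactL p n) id t)
    (g := fun t => (-1) ^+ `|n|%N *: tmap (fun p => coactL p n) id t)) => [||p y]; try by lin.
  by rewrite !tmapE //; try by lin; rewrite (linZ (f := fun x => x ⊗ y)) //; lin.
rewrite /coactLn {1}/neg_series coactL_Yid (act2_expandE (-1)) // (act2_expandE 1) //.
rewrite fsum_scale ?signr_eq0 //; apply: eq_fsumz => q.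
rewrite fsum_scale ?signr_eq0 //; apply: eq_fsumz => p.
rewrite e23 e13 (linZ (s13.1 _)) !(linZ (wL.1 _)) scalerA -signzD.
rewrite (_ : a - p + q + p = a + q); last by ring.
rewrite /expker expr1n mul1r mulrC mulrzA mulz_sign -!scaler_int !scalerA.
by rewrite signzD mulrC.
Qed.

(** As [rho] is a homomorphism, the H-leg of Y(u, z)v is a product Y(h, z)h', which by [mod_iterate]
    acts as Y(h, x + z) Y(h', x). *)
Lemma coactR_Yid t a k : coactR (Yid t k) a =
  act2 (in_z Yid) (act2 (fun t => expand_add (S13 coactR t)) (in_x (S23 coactR) t)) a k.
Proof.
have wL := trunc_op_Yid; have s13 := fl_op_S13 fl_op_coactR; have s23 := fl_op_S23 fl_op_coactR.
move: t; apply: (ext3 (f := fun t => coactR (Yid t k) a) (g := fun t => act2 (in_z Yid)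
  (act2 (fun t => expand_add (S13 coactR t)) (in_x (S23 coactR) t)) a k)) => [||u v w].
- exact: lin_comp (lin_coactR a) (wL.1 k).
- exact: act2_lin (trunc_op2_in_z wL) (fl_op2_comp (fl_op2_expand 1 s13) (fl_op2_in_x s23)) a k.
pose K (u1 : V) (h : H) (v1 : V) (h' : H) (p : int * int) :=
  vop A u1 v1 p.1 ⊗ (Y h (Y h' w (a + (k - p.1) - p.2)) p.2 *~ bz p.2 (k - p.1)).
have lG : linear (tsum (fun (b1 : V) b2 => b1 ⊗ Y b2 w a)).
  by apply: tsum_linear; apply: bilinP => ?; [lin|apply: lin_pure2; apply: mod_lin1].
have fK u1 h v1 h' : fsupp (K u1 h v1 h').
  have [N hN] := nvam_truncated (nva_self V_nva) u1 v1.
  have [M hM] := mod_trunc2 h h' w.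
  apply: (fsupp_prod (s := irange N k) (t := irange M (a + k - N - M))) => m m' hm.
  rewrite /K /=; have [mN|mN] := ltP m N.
    by rewrite hN // (lin0 (f := fun x => x ⊗ _)) //; lin.
  have [km|km] := ltP k m.
    by rewrite bz_lt0 ?mulr0z ?(lin0 (f := fun x => _ ⊗ x)) //; [lin|lia].
  rewrite hM ?mul0rz ?(lin0 (f := fun x => _ ⊗ x)) //; first by lin.
  move: hm; rewrite (mem_irange mN km) /=; apply: contraR.
  by rewrite negb_or -!leNgt => /andP[h1 h2]; apply: mem_irange; lia.
rewrite YidE coactRE (act2_expandE 1) // (hom_vop (cnva_hom V_com)) /=.
transitivity (\sum_(p \in [set: int * int])
  tsum (fun u1 h => tsum (fun v1 h' => K u1 h v1 h' p) (rho v)) (rho u)).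
  rewrite (lin_tsum _ _ lG).
  rewrite -(fsum_tsum (f := fun u1 h p => tsum (fun v1 h' => K u1 h v1 h' p) (rho v)));
    last by move=> u1 h; apply: fsupp_tsum.
  apply: eq_tsum => u1 h; rewrite (lin_tsum _ _ lG) -fsum_tsum //.
  apply: eq_tsum => v1 h'.
  have [N hN] := nvam_truncated (nva_self V_nva) u1 v1.
  have [M hM] := nvam_truncated (nva_self (bialg_nva H_bialg)) h h'.
  rewrite (lin_fsum_comm lG); last first.
    apply: (@fsupp_int _ _ N (k - M)) => m /orP[mN|km].
      by rewrite hN // (lin0 (f := fun x => x ⊗ _)) //; lin.
    by rewrite hM ?(lin0 (f := fun x => _ ⊗ x)) //; [lin|lia].
  rewrite -(fsum_pair (f := fun m m' => K u1 h v1 h' (m, m'))); last first.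
    by apply: (fsupp_inj (h := fun p : int * int => (p.1, p.2)) (k := id)) => // -[].
  apply: eq_fsumz => m; rewrite tsumE; first last.
  - by move=> ?; apply: lin_pure2; apply: mod_lin1.
  - by move=> ?; lin.
  rewrite mod_iterate subst_x1E (lin_fsum_comm (A := fun x => vop A u1 v1 m ⊗ x)) //.
    by lin.
  exact: (fsuppMz _ (truncated2_supp _ (mod_trunc2 h h' w))).
(* On the right side [q] is the power of z coming from x + z and [p] the exponent of the factor
   issued by slot 2; then the product has exponent [k - q] and the factor issued by slot 1 has
   exponent [a - p + q]. *)
pose c (p : int * int) : int * int := (k - p.1, a - p.2 + p.1).
pose d (p : int * int) : int * int := (k - p.1, a + (k - p.1) - p.2).
have cd : cancel c d by case=> i j; rewrite /c /d /=; congr (_, _); ring.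
have dc : cancel d c by case=> i j; rewrite /c /d /=; congr (_, _); ring.
have fT : fsupp (fun p => tsum (fun u1 h => tsum (fun v1 h' => K u1 h v1 h' p)
    (rho v)) (rho u)).
  by apply: fsupp_tsum => u1 h; apply: fsupp_tsum.
rewrite (fsum_bij _ cd dc) -(fsum_pair (f := fun q p => tsum (fun u1 h =>
  tsum (fun v1 h' => K u1 h v1 h' (c (q, p))) (rho v)) (rho u))); last first.
  have := fsupp_inj cd fT; apply: (fsupp_inj (h := fun p : int * int => (p.1, p.2)) (k := id)).
  by case.
apply: eq_fsumz => q; apply: eq_fsumz => p.
rewrite S23_coactR (lin_tsum _ _ (s13.1 _)) (lin_tsum _ _ (wL.1 _)).
rewrite (lin_tsum (f := fun x => x *~ _)); last by apply: lin_mulz; lin.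
rewrite tsum_exchange; apply: eq_tsum => v1 h'; rewrite S13_coactR (lin_tsum _ _ (wL.1 _)).
rewrite (lin_tsum (f := fun x => x *~ _)); last by apply: lin_mulz; lin.
apply: eq_tsum => u1 h; rewrite YidE /K /c /=.
rewrite (linMz (f := fun x => _ ⊗ x)); last by lin.
rewrite (_ : a + (k - (k - q)) - (a - p + q) = p); last by ring.
by rewrite subKr /expker expr1n mul1r.
Qed.

Let D := vD A.

Lemma lin_D : linear D.
Proof. exact: vop_lin1. Qed.

(** Take the coefficient of x2 in the module axiom for a product with the vacuum: the linear term of
    Y(h, x1 - x2)v in x2 is minus its derivative. *)
Lemma mod_D h v n : Y h (D v) n = D (Y h v n) - Y h v (n + 1) *~ (n + 1).
Proof.
rewrite /D /vD (mnva_vop Y_mod).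
pose c := fun h' => vop A (Y h' v n) (vac A) 1 - Y h' v (n + 1) *~ (n + 1).
transitivity (tsum (fun h1 h2 => eps h2 *: c h1) (Delta h)); last first.
  have lc : linear c by rewrite /c => x y z; rewrite !mod_lin1 vop_lin1 mulrzDl
    -!scaler_int scalerBr !scalerA mulrC opprD addrACA.
  rewrite -[RHS]/(c h) -[in RHS](coalg_counitr (bialg_coalg H_bialg) h).
  by rewrite (lin_tsum _ _ lc); apply: eq_tsum => h1 h2; rewrite (linZ lc).
apply: eq_tsum => h1 h2; rewrite /act2.
have hv m : Y h2 (vac A) m = if m == 0 then eps h2 *: vac A else 0.
  by rewrite (mnva_vac Y_mod).
rewrite (fsumE (s := [:: (n, 0); (n, 1)])).
- rewrite big_cons big_seq1 /expand_sub !expandE ![fst _]/= ![snd _]/=.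
  rewrite !subrr hv eqxx subr0 addr0.
  rewrite !(linZ (vop_lin2 _ _)) !(linMz (vop_lin1 _ _)) (nva_limit V_nva) /c scalerBr.
  rewrite /expker /= !binz0 mulr1 mulr1z -binz1; congr (_ + _).
  by rewrite mulN1r mulrNz scalerN.
- by rewrite /= inE andbT; apply/eqP => -[].
move=> [p q]; rewrite !inE !xpair_eqE /= => pq; rewrite hv.
have [pn|pn] := eqVneq (n - p) 0; last by rewrite (lin0 (vop_lin2 _ _)).
have {}pn : p = n by lia.
rewrite (linZ (vop_lin2 _ _)); have [q1|q1] := ltP 1 q.
  by rewrite (nva_regular V_nva) ?scaler0 //; lia.
rewrite /expand_sub expandE (expker_lt0) ?mulr0z ?(lin0 (vop_lin1 _ _)) ?scaler0 //.
by move: pq; rewrite pn eqxx /=; lia.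
Qed.

(** In [mod_iterate] with the vacuum as second element, the linear term of Y(h, x2 + x0) in x0 is
    the derivative. *)
Lemma mod_DH h w n : Y (vD AH h) w n = Y h w (n + 1) *~ (n + 1).
Proof.
rewrite /vD mod_iterate subst_x1E.
rewrite (fsum_one (i0 := n + 1)) => [|m mn]; rewrite (mnva_module Y_mod).(nvam_vac).
  by rewrite subrr /const_series eqxx /= -binz1.
rewrite /const_series ifN; last by apply: contra_neq mn; lia.
by rewrite (lin0 (mod_lin2 _ _)) mul0rz.
Qed.

Lemma trunc_tensor_supp (u v : V) (h k : H) n :
  fsupp (fun m => vop A u v m ⊗ vop AH h k (n - m)).
Proof.
have [N hN] := nvam_truncated (nva_self V_nva) u v.
have [M hM] := nvam_truncated (nva_self (bialg_nva H_bialg)) h k.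
apply: (@fsupp_int _ _ N (n - M)) => m /orP[mN|km].
  by rewrite hN // (lin0 (f := fun x => x ⊗ _)) //; lin.
by rewrite hM ?(lin0 (f := fun x => _ ⊗ x)) //; [lin|lia].
Qed.

Lemma rho_D v : rho (D v) = tsum (fun v1 h => D v1 ⊗ h + v1 ⊗ vD AH h) (rho v).
Proof.
rewrite (hom_vop (cnva_hom V_com)) (hom_vac (cnva_hom V_com)) /=.
have lH k n : linear (fun h => vop AH h k n).
  exact: (nvam_bilinear (nva_self (bialg_nva H_bialg)) n).1.
have lH' h n : linear (fun k => vop AH h k n).
  exact: (nvam_bilinear (nva_self (bialg_nva H_bialg)) n).2.
apply: eq_tsum => v1 h; rewrite tsumE.
- rewrite (fsumE (s := [:: 1; 0])) // => [|m hm].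
    rewrite big_cons big_seq1 subrr subr0.
    by rewrite (nva_limit V_nva) (nva_limit (bialg_nva H_bialg)).
  have [m0|m0] := ltP m 0.
    by rewrite (nva_regular V_nva) // (lin0 (f := fun x => x ⊗ _)) //; lin.
  rewrite (nva_regular (bialg_nva H_bialg)).
    by rewrite (lin0 (f := fun x => _ ⊗ x)) //; lin.
  by move: hm; rewrite !inE; lia.
- move=> k; apply: lin_fsum => [m|u]; last exact: trunc_tensor_supp.
  by apply: lin_pure1; apply: lin_vop2; lin.
- move=> u; apply: lin_fsum => [m|k]; last exact: trunc_tensor_supp.
  by apply: lin_pure2; apply: lH'.
Qed.

Definition D1 : tensor V V -> tensor V V := tmap D id.

Lemma lin_D1 : linear D1.
Proof. by apply: (lin_tmap (h := id)) => //; exact: lin_D. Qed.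

Lemma D1E a b : D1 (a ⊗ b) = D a ⊗ b.
Proof. by rewrite /D1 tmapE //; apply: lin_D. Qed.

Lemma coactR_D p n : coactR (D1 p) n = D1 (coactR p n) + coactR p (n + 1) *~ (n + 1).
Proof.
move: p; apply: (ext2 (f := fun p => coactR (D1 p) n)
  (g := fun p => D1 (coactR p n) + coactR p (n + 1) *~ (n + 1))) => [||a b].
- exact: lin_comp (lin_coactR n) lin_D1.
- apply: lin_add; first exact: lin_comp lin_D1 (lin_coactR n).
  by apply: lin_mulz; apply: lin_coactR.
rewrite D1E !coactRE rho_D.
have lG : linear (tsum (fun (b1 : V) b2 => b1 ⊗ Y b2 b n)).
  by apply: tsum_linear; apply: bilinP => ?; [lin|apply: lin_pure2; apply: mod_lin1].
rewrite (lin_tsum _ _ lG) (lin_tsum _ _ lin_D1).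
rewrite (lin_tsum (f := fun x => x *~ _)); last by apply: lin_mulz; lin.
rewrite tsumD; apply: eq_tsum => a1 h; rewrite (linD lG) D1E.
rewrite !tsumE; try by move=> ?; first [by lin|by apply: lin_pure2; apply: mod_lin1].
by rewrite mod_DH (linMz (f := fun x => a1 ⊗ x)) //; lin.
Qed.

Lemma coactL_D p n : coactL (D1 p) n = D1 (coactL p n) - coactL p (n + 1) *~ (n + 1).
Proof.
move: p; apply: (ext2 (f := fun p => coactL (D1 p) n)
  (g := fun p => D1 (coactL p n) - coactL p (n + 1) *~ (n + 1))) => [||a b].
- exact: lin_comp (lin_coactL n) lin_D1.
- have lN : linear (fun p => - (coactL p (n + 1) *~ (n + 1))).
    by move=> c x y; rewrite -!mulrNz; apply: (lin_mulz _ (lin_coactL _)).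
  apply: lin_add lN; exact: lin_comp lin_D1 (lin_coactL n).
rewrite D1E !coactLE (lin_tsum _ _ lin_D1).
rewrite (lin_tsum (f := fun x => x *~ _)); last by apply: lin_mulz; lin.
rewrite tsumB; apply: eq_tsum => b1 h; rewrite D1E mod_D (linD (f := fun x => x ⊗ b1)); last by lin.
rewrite (linN (f := fun x => x ⊗ b1)); last by lin.
by rewrite (linMz (f := fun x => x ⊗ b1)) //; lin.
Qed.

(** Passing to -x reverses the sign of the derivative, so both factors of S obey the same rule and S
    inherits it by Leibniz. *)
Lemma coactLn_D p n : coactLn (D1 p) n = D1 (coactLn p n) + coactLn p (n + 1) *~ (n + 1).
Proof.
rewrite /coactLn /neg_series coactL_D scalerBr (linZ lin_D1); congr (_ + _).
rewrite signzD mulrN1 scaleNr mulNrz.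
by rewrite -!scaler_int !scalerA mulrC.
Qed.
End OneStructure.
End Module.

(** * Products of operators in two variables *)

Section Products.
Variable F : fieldType.
Implicit Types T U V W X : lmodType F.

Definition comp2 (T U : Type) (W : zmodType) (A : U -> int -> int -> W)
    (B : T -> int -> int -> U) : T -> int -> int -> W :=
  fun t => act2 A (B t).

Notation "A \o2 B" := (comp2 A B) (at level 50, left associativity).

(** Covers A(x), A(z), A(x + z) and A(x - z) at once: each coefficient is an integer multiple of a
    coefficient of [A], so commutation passes to any pair of substitutions. *)
Definition subst_of T W (A : T -> int -> W) (B : T -> int -> int -> W) : Prop :=
  exists (g k : int -> int -> int), forall t m n, B t m n = A t (g m n) *~ k m n.

Lemma subst_of_x T W (A : T -> int -> W) : subst_of A (in_x A).
Proof.
exists (fun m _ => m), (fun _ n => (n == 0)%:Z) => t m n; rewrite /in_x.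
by case: (n == 0).
Qed.

Lemma subst_of_z T W (A : T -> int -> W) : subst_of A (in_z A).
Proof.
exists (fun _ n => n), (fun m _ => (m == 0)%:Z) => t m n; rewrite /in_z.
by case: (m == 0).
Qed.

Lemma subst_of_expand e T W (A : T -> int -> W) : subst_of A (fun t => expand e (A t)).
Proof.
by exists (fun m n => m + n), (fun m n => expker e (m + n) n) => t m n; rewrite expandE.
Qed.

Lemma subst_of_comm T (A B : T -> int -> T) A' B' : fl_op A -> fl_op B -> commute_ops A B ->
  subst_of A A' -> subst_of B B' -> A' \o2 B' = B' \o2 A'.
Proof.
move=> [lA _] [lB _] AB [g [k eA]] [g' [k' eB]]; apply/funext => t; apply: act2_comm => p q m n.
rewrite !(eA, eB) (linMz (lA _)) (linMz (lB _)) AB.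
by rewrite -!mulrzA mulrC.
Qed.

Lemma comp2A T U V W (A : V -> int -> int -> W) (B : U -> int -> int -> V)
    (C : T -> int -> int -> U) : trunc_op2 A -> fl_op2 B -> fl_op2 C ->
  A \o2 (B \o2 C) = (A \o2 B) \o2 C.
Proof. by move=> wA sB sC; apply/funext => t; apply: act2_assoc => //; apply: sC.2. Qed.

Lemma comp2_swap T U (A B : U -> int -> int -> U) (C : T -> int -> int -> U) :
  fl_op2 A -> fl_op2 B -> fl_op2 C -> A \o2 B = B \o2 A -> A \o2 (B \o2 C) = B \o2 (A \o2 C).
Proof.
move=> sA sB sC AB; rewrite comp2A ?AB //; last exact: fl_trunc2.
by rewrite -comp2A //; apply: fl_trunc2.
Qed.

Lemma commute_ops_comp2 T (A B C D : T -> int -> T) :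
  fl_op A -> fl_op B -> fl_op C -> fl_op D ->
  commute_ops A C -> commute_ops A D -> commute_ops B C -> commute_ops B D ->
  commute_ops (fun t => act1 A (B t)) (fun t => act1 C (D t)).
Proof.
move=> sA sB sC sD AC AD BC BD; apply: commute_ops_comp => //.
- exact: fl_op_comp.
- by apply: commute_ops_sym; apply: commute_ops_comp => //; apply: commute_ops_sym.
- by apply: commute_ops_sym; apply: commute_ops_comp => //; apply: commute_ops_sym.
Qed.

Lemma flaurent2_slice W (s : int -> int -> W) m : flaurent2 s -> flaurent (s m).
Proof.
case=> zs fs; split; last exact: (finspan_comp (fun n => (m, n)) fs).
by have [N h] := zlaurent_low zs; exists N; apply: h.
Qed.

Lemma trunc_op2_iterate T X W (Y0 : X -> int -> W) (Yb : T -> int -> X) :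
  trunc_op Y0 -> trunc_op Yb -> trunc_op2 (fun t m n => Y0 (Yb t n) m).
Proof.
move=> wY wb; split=> [m n|t b]; first exact: (lin_comp (wY.1 m) (wb.1 n)).
have [N hN] := wb.2 t.
(* Cutting off the indices above [b] leaves finitely many coefficients of [Yb t], hence a common
   bound for [Y0]. *)
have [M hM] : exists M, forall n m, m < M -> Y0 (if n <= b then Yb t n else 0) m = 0.
  apply: (trunc_unif wY).
  exists (map (Yb t) (irange N b)) => n.
  have [h0 _] : subspace (inspan (map (Yb t) (irange N b))) by exact: inspanP.
  case: ifP => nb //; have [nN|nN] := ltP n N; first by rewrite hN.
  by apply: inspan_gen; apply: map_f; apply: mem_irange.
exists (Order.min N M) => m n nb h; have [nN|nN] := ltP n N.
  by rewrite hN // (lin0 (wY.1 m)).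
by have := hM n m; rewrite nb; apply; lia.
Qed.

Section Rule.
Variables (T X W : lmodType F).
Variables (Y0 : X -> int -> W) (E0 : X -> int -> X) (Yb : T -> int -> X).
Variables (P : T -> int -> int -> T) (Eb : T -> int -> T).
Hypotheses (wY : trunc_op Y0) (sE : fl_op E0) (wb : trunc_op Yb) (sP : fl_op2 P) (sEb : fl_op Eb).
Hypothesis rule : forall t k a, E0 (Yb t k) a = act2 (in_z Yb) (P t) a k.

(** [Y0] is the outer product and [Yb] the inner one: moving [E0] past [Yb] turns the deformed outer
    product into a plain iterate preceded by [P]. *)
Lemma rule_fst t m k :
  act1 Y0 (E0 (Yb t k)) m = act2 (fun t m n => Y0 (Yb t n) m) (P t) m k.
Proof.
have wYY := trunc_op2_iterate wY wb.
rewrite [RHS]/act2 -(fsum_pair (f := fun a q => Y0 (Yb (P t a q) (k - q)) (m - a))); last first.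
  exact: (act2_supp m k wYY (sP.2 t)).
apply: eq_fsumz => a; rewrite rule act2_in_z; last by case: wb.
rewrite /act1 (lin_fsum_comm (wY.1 _)) //.
exact: (act1_supp k wb (flaurent2_slice a (sP.2 t))).
Qed.

(** Now the inner product is deformed as well, by [Eb]; this is the shape of both iterates of Y'. *)
Lemma rule_snd t m n :
  act1 Y0 (E0 (act1 Yb (Eb t) n)) m =
  act2 (fun t m n => Y0 (Yb t n) m) (act2 P (in_z Eb t)) m n.
Proof.
have wYY := trunc_op2_iterate wY wb.
rewrite act2_assoc ?act2_in_zr //; last first.
- by case: (fl_op2_in_z sEb) => _; apply.
- by case: (trunc_op2_comp wYY sP).
rewrite /act1 -/(act1 Y0 _ m) -/(act1 _ _ n).
have lYE : linear (fun x => act1 Y0 (E0 x) m) by apply: act1_lin.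
rewrite [act1 Yb _ n]/act1 (lin_fsum_comm lYE); last exact: (act1_supp n wb (sEb.2 t)).
by apply: eq_fsumz => b; apply: rule_fst.
Qed.

End Rule.

Section RuleComp.
Variables (T X : lmodType F).
Variables (E0 E0' : X -> int -> X) (Yb : T -> int -> X).
Variables (P P' : T -> int -> int -> T) (Eb : T -> int -> T).
Hypotheses (sE : fl_op E0) (sE' : fl_op E0') (wb : trunc_op Yb).
Hypotheses (sP : fl_op2 P) (sP' : fl_op2 P') (sEb : fl_op Eb).
Hypothesis rule : forall t k a, E0 (Yb t k) a = act2 (in_z Yb) (P t) a k.
Hypothesis rule' : forall t k a, E0' (Yb t k) a = act2 (in_z Yb) (P' t) a k.

(** Exchange rules compose. In the hexagon the two operators are the factors E_21(-x) and F_12(x) of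
    S. *)
Lemma rule_comp t k m :
  act1 E0 (E0' (Yb t k)) m = act2 (in_z Yb) (act2 P (P' t)) m k.
Proof.
have wz := trunc_op2_in_z wb.
rewrite act2_assoc //; last exact: sP'.2.
rewrite [RHS]/act2 -(fsum_pair (f := fun b q =>
  act2 (in_z Yb) (P (P' t b q)) (m - b) (k - q))); last first.
  exact: (act2_supp m k (trunc_op2_comp wz sP) (sP'.2 t)).
apply: eq_fsumz => b; rewrite rule' act2_in_z; last by case: wb.
rewrite /act1 (lin_fsum_comm (sE.1 _)).
  by apply: eq_fsumz => q; rewrite rule.
exact: (act1_supp k wb (flaurent2_slice b (sP'.2 t))).
Qed.

Lemma rule_comp_in t m n :
  act1 E0 (E0' (act1 Yb (Eb t) n)) m =
  act2 (in_z Yb) (act2 (P \o2 P') (in_z Eb t)) m n.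
Proof.
have wz := trunc_op2_in_z wb; have sPP := fl_op2_comp sP sP'.
rewrite act2_assoc ?act2_in_zr //; last first.
- by case: (fl_op2_in_z sEb) => _; apply.
- by case: (trunc_op2_comp wz sPP).
have lEE : linear (fun x => act1 E0 (E0' x) m).
  by apply: act1_lin => //; apply: fl_trunc.
rewrite [act1 Yb _ n]/act1 (lin_fsum_comm lEE); last exact: (act1_supp n wb (sEb.2 t)).
by apply: eq_fsumz => b; apply: rule_comp.
Qed.

End RuleComp.

Lemma act1_const W (s : int -> W) (A : W -> int -> W) :
  (forall w, A w = const_series w) -> act1 A s = s.
Proof.
move=> hA; apply/funext => n; rewrite /act1 (fsum_one (i0 := n)) => [|m mn].
  by rewrite hA /const_series subrr eqxx.
by rewrite hA /const_series subr_eq0 eq_sym (negPf mn).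
Qed.

Lemma neg_act1 T W (A : T -> int -> W) s : lin_op A ->
  neg_series (act1 A s) = act1 (fun t => neg_series (A t)) (neg_series s).
Proof.
move=> lA; apply/funext => n; rewrite /neg_series /act1 fsum_scale ?signr_eq0 //.
apply: eq_fsumz => m; rewrite (linZ (lA _)) scalerA -signzD.
by rewrite subrK.
Qed.

Lemma neg_seriesK W (s : int -> W) : neg_series (neg_series s) = s.
Proof. by apply/funext => n; rewrite /neg_series scalerA -expr2 sqrr_sign scale1r. Qed.

Lemma neg_const W (w : W) : neg_series (const_series w) = const_series w.
Proof.
apply/funext => n; rewrite /neg_series /const_series.
by case: eqP => [->|_]; rewrite ?scaler0 // absz0 expr0 scale1r.
Qed.

End Products.

(** * Bounds uniform in the last slot *)

Section Generators.
Variable F : fieldType.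
Implicit Types T U V W X : lmodType F.

Lemma inspan_cons W (x : W) l w : inspan (x :: l) w -> exists c, inspan l (w - c *: x).
Proof.
have [h0 hD] := inspanP l.
move=> /(_ (fun w => exists c, inspan l (w - c *: x))); apply.
  split=> [|a y z [c hc] [d hd]]; first by exists 0; rewrite scale0r subr0.
  exists (a * c + d); rewrite scalerDl -scalerA opprD addrACA -scalerBr.
  exact: hD.
move=> y; rewrite inE => /orP[/eqP->|yl].
  by exists 1; rewrite scale1r subrr.
by exists 0; rewrite scale0r subr0; apply: inspan_gen.
Qed.

Lemma subspaceZ W (P : W -> Prop) a x : subspace P -> P x -> P (a *: x).
Proof. by case=> P0 PD Px; rewrite -[_ *: _]addr0; apply: PD. Qed.

Lemma subspaceB W (P : W -> Prop) x y : subspace P -> P x -> P y -> P (x - y).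
Proof. by move=> sP Px Py; rewrite -scaleN1r addrC; apply: sP.2. Qed.

(** The given spanning list may lie outside [P]. As in Gaussian elimination, each of its vectors is
    removed with a pivot [g j], and the pivots do lie in [P]. *)
Lemma finspan_sub (I : Type) W (P : W -> Prop) (g : I -> W) :
  subspace P -> (forall i, P (g i)) -> finspan g ->
  exists l, (forall x, x \in l -> P x) /\ forall i, inspan l (g i).
Proof.
move=> sP Pg [l]; elim: l g Pg => [|x l ih] g Pg lg; first by exists [::].
have [c hc] := boolp.choice (fun i => inspan_cons (lg i)).
have sl := inspanP l.
have [[j cj]|nj] := pselect (exists j, c j != 0); last first.
  apply: ih => // i; have := hc i; rewrite (_ : c i = 0) ?scale0r ?subr0 //.
  by apply/eqP/negPn/negP => ci; apply: nj; exists i.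
have [i|i|l1 [Pl1 hl1]] := ih (fun i => g i - (c i / c j) *: g j).
- by apply: subspaceB => //; apply: subspaceZ.
- have -> : g i - (c i / c j) *: g j =
      (g i - c i *: x) - (c i / c j) *: (g j - c j *: x).
    by rewrite scalerBr scalerA mulfVK // opprB addrA subrK.
  by apply: (subspaceB (P := inspan l)) => //; apply: (subspaceZ _ sl).
exists (g j :: l1); split=> [y|i].
  by rewrite inE => /orP[/eqP->|/Pl1].
rewrite -[g i](subrK ((c i / c j) *: g j)); apply: (subspaceD (inspanP _)).
  by apply: inspan_trans (hl1 i) => y yl; apply: inspan_gen; rewrite inE yl orbT.
apply: (subspaceZ _ (inspanP _)); apply: inspan_gen.
by rewrite inE eqxx.
Qed.

(** Bounds exist only for vectors of [P], so the generators are first moved into [P]. *)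
Lemma finspan_unif_in (I : Type) W (P : W -> Prop) (g : I -> W) (Q : int -> W -> Prop) :
  subspace P -> (forall i, P (g i)) -> finspan g -> (forall N, subspace (Q N)) ->
  (forall M N w, M <= N -> Q N w -> Q M w) -> (forall w, P w -> exists N, Q N w) ->
  exists N, forall i, Q N (g i).
Proof.
move=> sP Pg fg sQ mQ eQ; have [l [Pl hl]] := finspan_sub sP Pg fg.
suff [N hN] : exists N, forall x, x \in l -> Q N x by exists N => i; apply: (hl i (Q N)).
elim: l Pl {hl} => [|y l ih] Pl; first by exists 0.
have [x xl|N hN] := ih; first by apply: Pl; rewrite inE xl orbT.
have [M hM] := eQ y (Pl y (mem_head _ _)).
exists (Order.min M N) => x; rewrite inE => /orP[/eqP->|/hN].
  by apply: mQ hM; lia.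
by apply: mQ; lia.
Qed.

Lemma fl_op_shift T W (A : T -> int -> W) (k : int) :
  fl_op A -> fl_op (fun t n => A t (n - k)).
Proof.
case=> lA sA; split=> [n|t]; first exact: lA.
have [[N hN] fs] := sA t; split; last exact: (finspan_comp (fun n => n - k) fs).
by exists (N + k) => n nN; apply: hN; lia.
Qed.

Lemma finspan_nth W (l : seq W) : finspan (fun i => nth 0 l i).
Proof.
exists l => i; have [il|li] := ltnP i (size l); first by apply: inspan_gen; apply: mem_nth.
by rewrite nth_default //; case: (inspanP l).
Qed.

(** [lsup l t] says that [t] lies in [span l (x) V]. *)
Definition lsup T V (l : seq T) (t : tensor T V) : Prop :=
  forall P : tensor T V -> Prop, subspace P ->
    (forall p w, p \in l -> P (p ⊗ w)) -> P t.

Lemma lsup_subspace T V (l : seq T) : subspace (@lsup T V l).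
Proof.
split=> [P [] //|a x y lx ly P sP lP].
by apply: sP.2; [apply: lx|apply: ly].
Qed.

Lemma lsup_pure T V (l : seq T) p (w : V) : inspan l p -> lsup l (p ⊗ w).
Proof.
move=> lp P sP lP; apply: (lp (fun p => P (p ⊗ w))) => [|q ql]; last exact: lP.
split=> [|a x y Px Py].
  by rewrite (lin0 (f := fun x => x ⊗ w)); [case: sP|lin].
by rewrite (pure_bilinear T V).1; apply: sP.2.
Qed.

(** An amplified operator leaves the right factor alone, so the new generators and the pole bound
    [C] depend on [l] only. *)
Lemma amplify_lsup T X V (B : T -> int -> X) (l : seq T) : fl_op B ->
  exists l' : seq X, exists C : nat, forall t : tensor T V, lsup l t ->
    (forall n, lsup l' (amplify B t n)) /\ (forall n, n < - Posz C -> amplify B t n = 0).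
Proof.
move=> sB; have fl := finspan_nth l.
have [N hN] := trunc_unif (fl_trunc sB) fl.
have [l' hl'] := finspan_op sB.1 (fun t => (sB.2 t).2) fl.
exists l', `|N|%N => t lt; have lB n : linear (fun t => @amplify F T X V B t n).
  by case: (trunc_op_amplify V (fl_trunc sB)).
split=> n.
  apply: (lt (fun t => lsup l' (amplify B t n))).
    split=> [|a x y hx hy]; first by rewrite (lin0 (lB n)); case: (@lsup_subspace X V l').
    by rewrite lB; exact: ((@lsup_subspace X V l').2 a _ _ hx hy).
  move=> p w pl; rewrite amplifyE; last by case: sB.
  by apply: lsup_pure; rewrite -(nth_index 0 pl); exact: (hl' (index p l, n)).
move=> nN; apply: (lt (fun t => amplify B t n = 0)).
  by split=> [|a x y hx hy]; rewrite ?(lin0 (lB n)) // lB hx hy scaler0 addr0.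
move=> p w pl; rewrite amplifyE; last by case: sB.
rewrite -(nth_index 0 pl) hN; first by rewrite (lin0 (f := fun x => x ⊗ w)) //; lin.
by lia.
Qed.

Lemma expand_sub_pos W (s : int -> W) (m n : int) : (forall c, c < 0 -> s c = 0) ->
  (m < 0) || (n < 0) -> expand_sub s m n = 0.
Proof.
move=> s0 h; rewrite /expand_sub expandE.
have [n0|n0] := ltP n 0; first by rewrite expker_lt0 // mulr0z.
have m0 : m < 0 by move: h; rewrite [n < 0]ltNge n0 orbF.
have [c0|c0] := ltP (m + n) 0; first by rewrite s0 // mul0rz.
have ec : m + n = Posz `|(m + n)%R|%N by lia.
have en : n = Posz `|n|%N by lia.
(* As m < 0 <= m + n, the lower index [n] exceeds the upper index [m + n]. *)
rewrite ec /expker [X in bz _ X]en /= bin_small ?mulr0 ?mulr0z //; lia.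
Qed.

(** Without poles the direction of expansion is immaterial, so s(-(x1 - x2)) is s(x2 - x1); on
    coefficients this is the symmetry of binomial coefficients. *)
Lemma expand_sub_tr W (s : int -> W) (m n : int) : (forall c, c < 0 -> s c = 0) ->
  expand_sub (fun c => (-1) ^+ `|c|%N *: s c) m n = expand_sub s n m.
Proof.
move=> s0; set s' := fun c => _.
have s'0 c : c < 0 -> s' c = 0 by move=> c0; rewrite /s' s0 // scaler0.
have [h|] := boolP ((m < 0) || (n < 0)).
  by rewrite !expand_sub_pos // orbC.
case: m n => [m|//] [n|//] _; rewrite /expand_sub !expandE /s' /expker.
have -> : Posz m + Posz n = Posz (m + n) by [].
have -> : Posz n + Posz m = Posz (m + n) by rewrite addnC.
rewrite /= -(@bin_sub _ m) ?leq_addr // addKn.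
rewrite mulrzA [RHS]mulrzA !mulz_sign; congr (_ *~ _).
by rewrite scalerA -exprD addnCA addnn -muln2 exprD exprM sqrr_sign mulr1.
Qed.

(** By homogeneity only the term of degree [p + i] matters. It is a constant times a power of x1 -
    x2, and x1 - x2 becomes x0. *)
Lemma subst_expand_sub W (s : int -> W) (i p : int) : (forall c, c < 0 -> s c = 0) ->
  subst_x1 (expand_sub s) i p = if p == 0 then s i else 0.
Proof.
move=> s0; rewrite subst_x1E.
pose d n := if n == p + i then s n else 0.
transitivity (subst_x1 (expand_sub d) i p).
  rewrite subst_x1E; apply: eq_fsumz => m; rewrite /expand_sub !expandE.
  by rewrite [d _]ifT // addrC subrK.
have [c0|c0] := ltP (p + i) 0.
  rewrite (_ : d = fun=> 0); last first.
    by apply/funext => n; rewrite /d; case: eqP => // ->; apply: s0.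
  rewrite subst_x1E fsum0z => [|m]; last by rewrite /expand_sub expandE !mul0rz.
  by case: eqP => // p0; rewrite s0 //; lia.
pose k := `|(p + i)%R|%N; have ek : Posz k = p + i by lia.
have -> : expand_sub d = mul_sub_pow k (expand_sub (const_series (s (p + i)))).
  rewrite expand_sub_shift; congr expand_sub; apply/funext => n.
  by rewrite /d /const_series ek subr_eq0; case: eqP => // ->.
have e m n : expand_sub (const_series (s (p + i))) m n =
    if (m == 0) && (n == 0) then s (p + i) else 0.
  rewrite /expand_sub expandE /const_series; case: eqP => [mn|mn]; last first.
    by rewrite mul0rz; case: andP => // -[/eqP ? /eqP ?]; lia.
  rewrite mn /expker bz0n; case: (eqVneq n 0) => [n0|n0].
    by rewrite n0 absz0 expr0 mulr1 mulr1z andbT ifT //; lia.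
  by rewrite mulr0 mulr0z andbF.
rewrite subst_mul_sub_pow; last by exists 0 => m n h; rewrite e ifN //; lia.
rewrite subst_x1E (fsum_one (i0 := 0)) => [|m m0]; last by rewrite e (negPf m0) mul0rz.
have -> : p + (i - Posz k) - 0 = 0 by lia.
rewrite e bz0n (_ : (i - Posz k == 0) = (p == 0)) /=; last by apply/eqP/eqP; lia.
by case: eqP => [->|_]; rewrite ?mul0rz // add0r.
Qed.

(** The power is shared out: [C] factors go to B(x1 - x2), where they clear poles, and [K] factors
    go to [Y0]. *)
Lemma mul_sub_pow_exps T U W (Y0 : T -> int -> int -> W) (B : U -> int -> T)
    s K C : trunc_op2 Y0 -> fl_op B -> flaurent2 s ->
  mul_sub_pow (K + C) (act2 Y0 (act2 (fun t => expand_sub (B t)) s)) =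
  act2 (fun t => mul_sub_pow K (Y0 t))
    (act2 (fun t => expand_sub (fun c => B t (c - Posz C))) s).
Proof.
move=> wY sB ss; have sS := fl_op2_expand (-1) sB.
have sS' := fl_op2_expand (-1) (fl_op_shift (Posz C) sB).
rewrite mul_sub_pow_add (mul_sub_pow_act2r _ wY (act2_ss sS ss)).
rewrite (mul_sub_pow_act2l _ (fl_trunc2 sS) ss).
rewrite (act2_congr (B := fun t => expand_sub (fun c => B t (c - Posz C)))).
  by rewrite (mul_sub_pow_act2l _ wY (act2_ss sS' ss)).
by move=> p q; apply: expand_sub_shift.
Qed.

Lemma mul_sub_powZ k W (c : F) (s : int -> int -> W) :
  mul_sub_pow k (fun m n => c *: s m n) = fun m n => c *: mul_sub_pow k s m n.
Proof.
elim: k => [|k ih]; first by rewrite !mul_sub_pow0.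
rewrite [LHS]mul_sub_powS ih; apply/funext => m; apply/funext => n.
by rewrite mul_sub_powS /mul_sub scalerBr.
Qed.

Lemma mul_sub_powB k W (s s' : int -> int -> W) :
  mul_sub_pow k (fun m n => s m n - s' m n) =
  fun m n => mul_sub_pow k s m n - mul_sub_pow k s' m n.
Proof.
elim: k => [|k ih]; first by rewrite !mul_sub_pow0.
rewrite [LHS]mul_sub_powS ih; apply/funext => m; apply/funext => n.
rewrite !mul_sub_powS /mul_sub !opprB addrACA [RHS]addrACA; congr (_ + _).
exact: addrC.
Qed.

Lemma act1_constr T W (A : T -> int -> W) w : lin_op A -> act1 A (const_series w) = A w.
Proof.
move=> lA; apply/funext => n; rewrite /act1 (fsum_one (i0 := 0)) => [|m /negPf m0].
  by rewrite /const_series eqxx subr0.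
by rewrite /const_series m0 (lin0 (lA _)).
Qed.

(** [rel K] stands for an identity valid after multiplication by (x1 - x2)^K. Linearity in [t] and
    monotonicity in [K] spread an exponent that is independent of [w] from pure tensors to span l ⊗
    W. *)
Lemma lsup_rel U V W (rel : nat -> tensor (tensor U V) W -> Prop) (l : seq (tensor U V)) :
  (forall K, subspace (rel K)) -> (forall j K t, rel K t -> rel (j + K)%N t) ->
  (forall u v, exists K, forall w, rel K (u ⊗ v ⊗ w)) ->
  exists K, forall t, lsup l t -> rel K t.
Proof.
move=> sR aR pR.
have pure_rel p : exists K, forall w, rel K (p ⊗ w).
  rewrite (tensorE p) /tsum /tev; elim: (repr p) => [|[u v] r [K hK]].
    exists 0%N => w; rewrite big_nil (lin0 (f := fun x => x ⊗ w)); last by lin.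
    by case: (sR 0%N).
  have [k hk] := pR u v; exists (K + k)%N => w.
  rewrite big_cons /= (linD (f := fun x => x ⊗ w)); last by lin.
  by apply: (subspaceD (sR _)); [apply: aR|rewrite addnC; apply: aR].
suff [K hK] : exists K, forall p w, p \in l -> rel K (p ⊗ w).
  by exists K => t lt; apply: (lt (rel K)).
elim: l => [|x l [K hK]]; first by exists 0%N.
have [k hk] := pure_rel x; exists (K + k)%N => p w.
rewrite inE => /orP[/eqP->|pl]; first exact: aR.
by rewrite addnC; apply: aR; apply: hK.
Qed.

End Generators.

(** * The deformed vertex algebra *)

Section Deformation.
Variables (F : fieldType) (H : lmodType F) (AH : vertex_struct H).
Variables (Delta : {linear H -> tensor H H}) (eps : {linear H -> F^o}).
Hypothesis H_bialg : nonlocal_vertex_bialgebra AH Delta eps.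
Hypothesis cocomm : cocommutative Delta.
Variables (V : lmodType F) (A : vertex_struct V).
Hypothesis V_nva : nonlocal_vertex_algebra A.
Variable rho : {linear V -> tensor V H}.
Hypothesis V_com : comodule_nva AH Delta eps A rho.
Variables L R : H -> V -> int -> V.
Hypotheses (L_mod : module_nva AH Delta eps A L) (L_comp : compatible rho L).
Hypotheses (R_mod : module_nva AH Delta eps A R) (R_comp : compatible rho R).
Hypotheses (LL : ops_commute L L) (LR : ops_commute L R) (RR : ops_commute R R).
Hypotheses (LR1 : conv Delta L R = conv_unit eps (V := V)).
Hypotheses (RL1 : conv Delta R L = conv_unit eps (V := V)).

Notation "A \o2 B" := (comp2 A B) (at level 50, left associativity).
Notation "A \o1 B" := (fun t => act1 A (B t)) (at level 50, left associativity).
Notation exps A := (fun t => expand_sub (A t)).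
Notation expa A := (fun t => expand_add (A t)).

Let coassoc := cnva_coassoc V_com.
Let counit := cnva_counit V_com.
Let he := co_op_counit_op eps rho.

Notation E := (coactR eps rho L).
Notation ER := (coactR eps rho R).
Notation EB := (coactL eps rho L).
Notation EN := (coactLn eps rho L).

Let sE : fl_op E := fl_op_coactR V_com L_mod L_comp.
Let sER : fl_op ER := fl_op_coactR V_com R_mod R_comp.
Let sEB : fl_op EB := fl_op_coactL V_com L_mod L_comp.
Let sEN : fl_op EN := fl_op_coactLn V_com L_mod L_comp.

(** The ingredients of all coefficients of E_12, F_12 and E_21(-x), with [L] for Y_M and [R] for its
    inverse; the scalar [c] accommodates the sign in Y_M(h, -x). *)
Inductive elementary : (H -> V -> V) -> Prop :=
  | elementary_eps : elementary (counit_op eps)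
  | elementary_L c n : elementary (fun h v => c *: L h v n)
  | elementary_R c n : elementary (fun h v => c *: R h v n).

Lemma co_op_scale f c : co_op rho f -> co_op rho (fun h v => c *: f h v).
Proof.
case=> l1 l2 r; split=> [v|h|h v]; [exact: lin_scale|exact: lin_scale|].
rewrite linearZ /= r; move: (rho v); have lh := l2 h.
have e (c' : F) (t : tensor V H) : c' *: tmap (f h) id t = tmap (fun v => c' *: f h v) id t.
  apply: (ext2 (f := fun t => c' *: tmap (f h) id t)
    (g := fun t => tmap (fun v => c' *: f h v) id t)) => [||a k]; try by lin.
  by rewrite !tmapE //; try by lin; rewrite (linZ (f := fun x => x ⊗ k)) //; lin.
exact: e.
Qed.

Lemma elem_co_op f : elementary f -> co_op rho f.
Proof.
case=> [|c n|c n]; first exact: he.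
  by apply: (co_op_scale (f := fun h v => L h v n)); apply: co_op_coef L_mod L_comp n.
by apply: (co_op_scale (f := fun h v => R h v n)); apply: co_op_coef R_mod R_comp n.
Qed.

Lemma elementary_comm f g : elementary f -> elementary g -> hcommute f g.
Proof.
have lL h n := mod_lin2 L_mod h n; have lR h n := mod_lin2 R_mod h n.
move=> hf hg; case: (hf); case: (hg).
- by apply: hcommute_eopl; exact: he.
- by move=> c n; apply: hcommute_eopl; apply: elem_co_op (elementary_L c n).
- by move=> c n; apply: hcommute_eopl; apply: elem_co_op (elementary_R c n).
- by move=> c n; apply: hcommute_eopr; apply: elem_co_op (elementary_L c n).
- move=> c n c' n' h k v; rewrite (linZ (lL _ _)) (linZ (lL _ _)) LL.
  by rewrite !scalerA mulrC.
- move=> c n c' n' h k v; rewrite (linZ (lL _ _)) (linZ (lR _ _)) LR.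
  by rewrite !scalerA mulrC.
- by move=> c n; apply: hcommute_eopr; apply: elem_co_op (elementary_R c n).
- move=> c n c' n' h k v; rewrite (linZ (lR _ _)) (linZ (lL _ _)) -LR.
  by rewrite !scalerA mulrC.
- move=> c n c' n' h k v; rewrite (linZ (lR _ _)) (linZ (lR _ _)) RR.
  by rewrite !scalerA mulrC.
Qed.

Definition elem_op (B : tensor V V -> int -> tensor V V) : Prop :=
  fl_op B /\ forall n, exists f g, [/\ elementary f, elementary g &
    forall p, B p n = twist rho f g p].

Lemma eq_elementary f g : (forall h v, f h v = g h v) -> elementary f -> elementary g.
Proof.
move=> e; rewrite (_ : f = g) //.
by apply/funext => h; apply/funext => v.
Qed.

Lemma elem_E : elem_op E.
Proof.
split=> // n; exists (counit_op eps), (fun h v => L h v n); split=> //; first exact: elementary_eps.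
by apply: eq_elementary (elementary_L 1 n) => h v; rewrite scale1r.
Qed.

Lemma elem_ER : elem_op ER.
Proof.
split=> // n; exists (counit_op eps), (fun h v => R h v n); split=> //; first exact: elementary_eps.
by apply: eq_elementary (elementary_R 1 n) => h v; rewrite scale1r.
Qed.

Lemma elem_EN : elem_op EN.
Proof.
split=> // n; exists (fun h v => (-1) ^+ `|n|%N *: L h v n), (counit_op eps).
split=> [||p]; [exact: elementary_L|exact: elementary_eps|].
have hL := co_op_coef L_mod L_comp n; have hN := elem_co_op (elementary_L ((-1) ^+ `|n|%N) n).
rewrite /EN /neg_series /coactL; move: p.
apply: (ext2 (f := fun p => (-1) ^+ `|n|%N *: twist rho (fun h v => L h v n) (counit_op eps) p)
  (g := twist rho (fun h v => (-1) ^+ `|n|%N *: L h v n) (counit_op eps))) => [||a b].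
- by apply: lin_scale; apply: lin_twist.
- exact: lin_twist.
rewrite !(twist_eopr counit) // (lin_tsum (f := fun x => (-1) ^+ `|n|%N *: x)); last by lin.
apply: eq_tsum => b1 h.
by rewrite (linZ (f := fun x => x ⊗ b1)) //; lin.
Qed.

Lemma elem_comm B C : elem_op B -> elem_op C -> commute_ops B C.
Proof.
case=> sB hB [sC hC] m n t.
have [f [g [ef eg eB]]] := hB n; have [f' [g' [ef' eg' eC]]] := hC m.
rewrite eB eC eC eB.
by apply: (twist_comm coassoc cocomm); do ?[exact: elem_co_op|exact: elementary_comm].
Qed.

Lemma elem_comm12_13 B C : elem_op B -> elem_op C -> commute_ops (S12 B) (S13 C).
Proof.
case=> sB hB [sC hC] m n t.
have [f [g [ef eg eB]]] := hB n; have [f' [g' [ef' eg' eC]]] := hC m.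
have hf := elem_co_op ef; have hg := elem_co_op eg.
have hf' := elem_co_op ef'; have hg' := elem_co_op eg'.
have eB' : (fun p => B p n) = twist rho f g by apply/funext.
have eC' : (fun p => C p m) = twist rho f' g' by apply/funext.
change (T12 (fun p => B p n) (T13 (fun p => C p m) t) =
  T13 (fun p => C p m) (T12 (fun p => B p n) t)).
rewrite eB' eC'; apply: (T12_T13 coassoc cocomm) => //.
exact: elementary_comm ef ef'.
Qed.

Lemma elem_comm12_23 B C : elem_op B -> elem_op C -> commute_ops (S12 B) (S23 C).
Proof.
case=> sB hB [sC hC] m n t.
have [f [g [ef eg eB]]] := hB n; have [f' [g' [ef' eg' eC]]] := hC m.
have hf := elem_co_op ef; have hg := elem_co_op eg.
have hf' := elem_co_op ef'; have hg' := elem_co_op eg'.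
have eB' : (fun p => B p n) = twist rho f g by apply/funext.
have eC' : (fun p => C p m) = twist rho f' g' by apply/funext.
change (T12 (fun p => B p n) (T23 (fun p => C p m) t) =
  T23 (fun p => C p m) (T12 (fun p => B p n) t)).
rewrite eB' eC'; apply: (T12_T23 coassoc cocomm) => //.
exact: elementary_comm eg ef'.
Qed.

Lemma elem_comm13_23 B C : elem_op B -> elem_op C -> commute_ops (S13 B) (S23 C).
Proof.
case=> sB hB [sC hC] m n t.
have [f [g [ef eg eB]]] := hB n; have [f' [g' [ef' eg' eC]]] := hC m.
have hf := elem_co_op ef; have hg := elem_co_op eg.
have hf' := elem_co_op ef'; have hg' := elem_co_op eg'.
have eB' : (fun p => B p n) = twist rho f g by apply/funext.
have eC' : (fun p => C p m) = twist rho f' g' by apply/funext.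
change (T13 (fun p => B p n) (T23 (fun p => C p m) t) =
  T23 (fun p => C p m) (T13 (fun p => B p n) t)).
rewrite eB' eC'; apply: (T13_T23 coassoc cocomm) => //.
exact: elementary_comm eg eg'.
Qed.

(** * The Yang-Baxter equation and unitarity *)

Notation S := (smap rho L R).

(** The definition of S takes both coactions on the original v and u. With the commuting factors in
    the order F_12 E_21, the coaction of slot 1 is taken after Y_M(u_(2), -x) has acted, and
    compatibility moves it back to v. *)
Lemma smapE : S = EN \o1 ER.
Proof.
apply/funext => t; apply/funext => n; rewrite (act1_comm (B := ER)); last first.
  by move=> i j x; apply: (elem_comm elem_EN elem_ER).
have lS : linear (fun t => act1 ER (EN t) n) by apply: act1_lin => //; apply: fl_trunc.
rewrite (tsum_pureE t lS) /smap; apply: eq_tsum => v u.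
have fS (v1 : V) u1 v2 u2 : fsupp (fun m => neg_series (L u2 v1) m ⊗ R v2 u1 (n - m)).
  have [[N hN] _] := flaurent_neg (mod_ss L_mod u2 v1); have [[M hM] _] := mod_ss R_mod v2 u1.
  apply: (@fsupp_int _ _ N (n - M)) => m /orP[mN|km].
    by rewrite hN // (lin0 (f := fun x => x ⊗ _)) //; lin.
  by rewrite hM ?(lin0 (f := fun x => _ ⊗ x)) //; [lin|lia].
transitivity (\sum_(m \in [set: int]) tsum (fun v1 v2 => tsum (fun u1 u2 =>
    neg_series (L u2 v1) m ⊗ R v2 u1 (n - m)) (rho u)) (rho v)).
  rewrite -fsum_tsum; last by move=> v1 v2; apply: fsupp_tsum.
  by apply: eq_tsum => v1 v2; rewrite fsum_tsum.
apply: eq_fsumz => m; rewrite /coactLn /neg_series (coactLE V_com) //.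
rewrite (linZ (sER.1 _)) (lin_tsum _ _ (sER.1 _)).
rewrite (lin_tsum (f := fun x => (-1) ^+ `|m|%N *: x)); last by lin.
rewrite tsum_exchange; apply: eq_tsum => u1 u2; rewrite (coactRE V_com) // L_comp tsum_tmap.
- rewrite (lin_tsum (f := fun x => (-1) ^+ `|m|%N *: x)); last by lin.
  apply: eq_tsum => v1 v2.
  by rewrite (linZ (f := fun x => x ⊗ _)) //; lin.
- by move=> ?; lin.
- by move=> v1; apply: lin_pure2; apply: (mod_lin1 R_mod).
Qed.

Lemma fl_op_smap : fl_op S.
Proof. by rewrite smapE; apply: fl_op_comp. Qed.

Lemma comm_S12_S13 : commute_ops (S12 S) (S13 S).
Proof.
have e12 : S12 S = S12 EN \o1 S12 ER by apply/funext => t; rewrite S12_comp // -smapE.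
have e13 : S13 S = S13 EN \o1 S13 ER by apply/funext => t; rewrite S13_comp // -smapE.
rewrite e12 e13; apply: commute_ops_comp2; do ?[exact: fl_op_S12|exact: fl_op_S13];
  by apply: elem_comm12_13; do ?[exact: elem_EN|exact: elem_ER].
Qed.

Lemma comm_S12_S23 : commute_ops (S12 S) (S23 S).
Proof.
have e12 : S12 S = S12 EN \o1 S12 ER by apply/funext => t; rewrite S12_comp // -smapE.
have e23 : S23 S = S23 EN \o1 S23 ER by apply/funext => t; rewrite S23_comp // -smapE.
rewrite e12 e23; apply: commute_ops_comp2; do ?[exact: fl_op_S12|exact: fl_op_S23];
  by apply: elem_comm12_23; do ?[exact: elem_EN|exact: elem_ER].
Qed.

Lemma comm_S13_S23 : commute_ops (S13 S) (S23 S).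
Proof.
have e13 : S13 S = S13 EN \o1 S13 ER by apply/funext => t; rewrite S13_comp // -smapE.
have e23 : S23 S = S23 EN \o1 S23 ER by apply/funext => t; rewrite S23_comp // -smapE.
rewrite e13 e23; apply: commute_ops_comp2; do ?[exact: fl_op_S13|exact: fl_op_S23];
  by apply: elem_comm13_23; do ?[exact: elem_EN|exact: elem_ER].
Qed.

Lemma smap_qyb : rational_qyb_operator S.
Proof.
have sS := fl_op_smap.
have s12 := fl_op_S12 sS; have s13 := fl_op_S13 sS; have s23 := fl_op_S23 sS.
split=> [n|t|t m n]; [exact: sS.1|exact: ss_finite_laurent (sS.2 t)|].
have sx := fl_op2_in_x s12; have sz := fl_op2_in_z s23; have sa := fl_op2_expand 1 s13.
have wx := fl_trunc2 sx; have wz := fl_trunc2 sz; have wa := fl_trunc2 sa.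
have c1 : in_x (S12 S) \o2 expa (S13 S) = expa (S13 S) \o2 in_x (S12 S).
  exact: (subst_of_comm s12 s13 comm_S12_S13 (subst_of_x _) (subst_of_expand _ _)).
have c2 : in_x (S12 S) \o2 in_z (S23 S) = in_z (S23 S) \o2 in_x (S12 S).
  exact: (subst_of_comm s12 s23 comm_S12_S23 (subst_of_x _) (subst_of_z _)).
have c3 : expa (S13 S) \o2 in_z (S23 S) = in_z (S23 S) \o2 expa (S13 S).
  exact: (subst_of_comm s13 s23 comm_S13_S23 (subst_of_expand _ _) (subst_of_z _)).
have key : in_x (S12 S) \o2 (expa (S13 S) \o2 in_z (S23 S)) =
    in_z (S23 S) \o2 (expa (S13 S) \o2 in_x (S12 S)).
  rewrite (comp2A wx sa sz) c1 -(comp2A wa sx sz) c2 (comp2A wa sz sx) c3.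
  by rewrite -(comp2A wz sa sx).
exact: (congr1 (fun f => f t m n) key).
Qed.

Lemma coactL_swap Y p n : module_nva AH Delta eps A Y -> compatible rho Y ->
  coactL eps rho Y p n = tswap (coactR eps rho Y (tswap p) n).
Proof.
move=> Y_mod Y_comp; have l1 := lin_coactR Y_mod Y_comp n; have l2 := lin_coactL Y_mod Y_comp n.
have lt : linear (@tswap F V V) by apply: (lin_tswap (f := id)).
move: p; apply: (ext2 (f := fun p => coactL eps rho Y p n)
  (g := fun p => tswap (coactR eps rho Y (tswap p) n))) => [//||a b].
  exact: lin_comp lt (lin_comp l1 lt).
rewrite tswapE (coactRE V_com) // (coactLE V_com) // (lin_tsum _ _ lt).
by apply: eq_tsum => b1 h; rewrite tswapE.
Qed.

(** Coassociativity merges two successive actions into the action of a convolution product, and the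
    counit removes the remaining leg. *)
Lemma coactR_inv Y1 Y2 p : module_nva AH Delta eps A Y1 -> compatible rho Y1 ->
  module_nva AH Delta eps A Y2 -> compatible rho Y2 ->
  conv Delta Y1 Y2 = conv_unit eps (V := V) ->
  act1 (coactR eps rho Y1) (coactR eps rho Y2 p) = const_series p.
Proof.
move=> m1 c1 m2 c2 cv; apply/funext => n; move: p.
have s1 := fl_op_coactR V_com m1 c1; have s2 := fl_op_coactR V_com m2 c2.
apply: (ext2 (f := fun p => act1 (coactR eps rho Y1) (coactR eps rho Y2 p) n)
  (g := fun p => const_series p n)) => [||a b].
- by apply: act1_lin => //; apply: fl_trunc.
- by rewrite /const_series; case: eqP => _ ? ? ?; rewrite ?scaler0 ?addr0.
have fK (a1 : V) h1 h2 : fsupp (fun m => a1 ⊗ Y1 h1 (Y2 h2 b m) (n - m)).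
  apply: (fsupp_lin (A := fun x => a1 ⊗ x)); first by lin.
  exact: (act1_supp n (fl_trunc (mod_fl_op2 m1 h1)) (mod_ss m2 h2 b)).
transitivity (\sum_(m \in [set: int]) tsum (fun a1 h => tsum (fun h1 h2 =>
    a1 ⊗ Y1 h1 (Y2 h2 b m) (n - m)) (Delta h)) (rho a)).
  apply: eq_fsumz => m; rewrite (coactRE V_com) // (lin_tsum _ _ (s1.1 _)).
  rewrite -(rho_coassoc coassoc (G := fun a1 h1 h2 => a1 ⊗ Y1 h1 (Y2 h2 b m) (n - m))).
  - by apply: eq_tsum => a1 h; rewrite (coactRE V_com).
  - by move=> ? ?; lin.
  - by move=> ? ?; apply: lin_pure2; apply: (mod_lin1 m1).
  - by move=> ? ?; apply: lin_pure2; apply: (lin_mod2 m1); apply: (mod_lin1 m2).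
rewrite -fsum_tsum; last by move=> a1 h; apply: fsupp_tsum.
transitivity (tsum (fun (a1 : V) h => const_series ((eps h : F) *: (a1 ⊗ b)) n) (rho a)).
  apply: eq_tsum => a1 h; rewrite -fsum_tsum //.
  have := congr1 (fun f => a1 ⊗ f h b n) cv.
  rewrite /conv (lin_tsum (f := fun x => a1 ⊗ x)); last by lin.
  have -> : a1 ⊗ conv_unit eps h b n = const_series ((eps h : F) *: (a1 ⊗ b)) n.
    rewrite /conv_unit /const_series; case: eqP => _.
      by rewrite (linZ (f := fun x => a1 ⊗ x)) //; lin.
    by rewrite (lin0 (f := fun x => a1 ⊗ x)) //; lin.
  move=> <-; apply: eq_tsum => h1 h2.
  rewrite /act1 (lin_fsum_comm (A := fun x => a1 ⊗ x)) //; first by lin.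
  exact: (act1_supp n (fl_trunc (mod_fl_op2 m1 h1)) (mod_ss m2 h2 b)).
rewrite -[in RHS](counit a) /const_series; case: eqP => _.
  rewrite [RHS](lin_tsum (f := fun x => x ⊗ b)); last by lin.
  by apply: eq_tsum => a1 h; rewrite (linZ (f := fun x => x ⊗ b)) //; lin.
by rewrite /tsum /tev big1.
Qed.

Lemma coactL_inv p : act1 (coactL eps rho R) (EB p) = const_series p.
Proof.
have lt : linear (@tswap F V V) by apply: (lin_tswap (f := id)).
have e1 : coactL eps rho R = fun t n => tswap (ER (tswap t) n).
  by apply/funext => t; apply/funext => n; apply: coactL_swap.
have e2 t : EB t = fun n => tswap (E (tswap t) n).
  by apply/funext => n; apply: coactL_swap.
rewrite e1 e2 (act1_conj (P := @tswap F V V) (A := ER) (B := E) (P' := @tswap F V V)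
  (Q' := @tswap F V V) (@tswap F V V) p) //; first last.
- exact: tswapK.
- exact: fl_trunc.
apply/funext => n; rewrite coactR_inv // /const_series.
by case: eqP => _; rewrite ?tswapK ?(lin0 lt).
Qed.

Lemma smap_unitary : unitary_operator S.
Proof.
move=> t n; have lt : linear (@tswap F V V) by apply: (lin_tswap (f := id)).
have sR := fl_op_coactL V_com R_mod R_comp.
pose nE p := neg_series (E p); have snE : fl_op nE := fl_op_neg sE.
(* The flip exchanges the slots, so S21(x) S(-x) = E_12(-x) F_21(x) E_21(x) F_12(-x): the middle
   factors cancel, then the outer ones. *)
have -> : S21 S = nE \o1 coactL eps rho R.
  have e1 : nE = fun t n => tswap (EN (tswap t) n).
    apply/funext => x; apply/funext => k; rewrite /nE /coactLn /neg_series coactL_swap //.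
    by rewrite (linZ lt) !tswapK.
  have e2 x : coactL eps rho R x = fun n => tswap (ER (tswap x) n).
    by apply/funext => k; apply: coactL_swap.
  apply/funext => x; rewrite e1 e2 (act1_conj (P := @tswap F V V) (A := EN) (B := ER)
    (P' := @tswap F V V) (Q' := @tswap F V V) (@tswap F V V) x) //; last exact: tswapK.
    by apply/funext => k; rewrite /S21 smapE.
  exact: fl_trunc.
have -> : neg_series (S t) = act1 EB (neg_series (ER t)).
  rewrite smapE neg_act1; last by case: sEN.
  by apply: act1_congr => m; rewrite /coactLn neg_seriesK.
have ssn : flaurent (neg_series (ER t)) by apply: flaurent_neg; apply: sER.2.
rewrite -(act1_assoc (fl_trunc snE) sR (act1_ss sEB ssn)).
rewrite (act1_assoc (fl_trunc sR) sEB ssn).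
rewrite (act1_const _ (A := coactL eps rho R \o1 EB) coactL_inv).
by rewrite -neg_act1 ?coactR_inv ?neg_const //; case: sE.
Qed.

(** * The deformed product and the hexagon identity *)

Notation A' := (deformation A rho L).

Lemma deformation_vop a b n : vop A' a b n = act1 (Yt A) (E (a ⊗ b)) n.
Proof.
have wY := trunc_op_Yt V_nva.
have wA (a1 : V) : trunc_op (vop A a1).
  by split=> [k|c]; [exact: vop_lin2|exact: (nvam_truncated (nva_self V_nva))].
rewrite /= /act1 fsum_tsum; last first.
  by move=> a1 h; apply: (act1_supp n (wA a1) (mod_ss L_mod h b)).
apply: eq_fsumz => m; rewrite (coactRE V_com) // (lin_tsum _ _ (wY.1 _)).
by apply: eq_tsum => a1 h; rewrite YtE.
Qed.

Lemma deformation_Yt p n : Yt A' p n = act1 (Yt A) (E p) n.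
Proof.
have lY : linear (fun p => act1 (Yt A) (E p) n).
  by apply: act1_lin => //; apply: trunc_op_Yt.
by rewrite (tsum_pureE p lY) /Yt; apply: eq_tsum => a b; apply: deformation_vop.
Qed.

Lemma deformation_YtE : Yt A' = Yt A \o1 E.
Proof. by apply/funext => p; apply/funext => n; apply: deformation_Yt. Qed.

Lemma trunc_op_Yt' : trunc_op (Yt A').
Proof. by rewrite deformation_YtE; apply: trunc_op_comp => //; apply: trunc_op_Yt. Qed.

Lemma deformation_Yid : Yid A' = Yid A \o1 S12 E.
Proof.
apply/funext => t; rewrite /Yid deformation_YtE.
by rewrite -amplify_comp //; apply: trunc_op_Yt.
Qed.

Lemma deformation_YL : YL A' = YL A \o1 S23 E.
Proof.
have wY := trunc_op_Yt V_nva.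
have e B (hB : trunc_op B) t n : tmap id (fun p => B p n) (tassoc t) =
    tswap (@amplify F _ V V B (cyc3 t) n).
  have lB := hB.1 n; rewrite /cyc3; move: (tassoc t).
  apply: (ext2 (f := fun t => tmap id (fun p => B p n) t)
    (g := fun t => tswap (@amplify F _ V V B (tswap t) n))) => [||u p].
  - by lin.
  - by apply: lin_tswap; apply: lin_tmap; [|lin|apply: (lin_tswap (f := id))].
  - by rewrite tswapE amplifyE ?tswapE ?tmapE //; case: hB.
apply/funext => t; apply/funext => n; rewrite /YL (e _ trunc_op_Yt') deformation_YtE.
rewrite -(amplify_comp (cyc3 t) wY sE) /act1.
rewrite (lin_fsum_comm (A := @tswap F V V)).
- apply: eq_fsumz => m; rewrite S23_cyc3; last by case: sE.
  by rewrite (e _ wY) uncyc3K.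
- by apply: (lin_tswap (f := id)).
- exact: (act1_supp n (trunc_op_amplify V wY) ((fl_op_amplify V sE).2 (cyc3 t))).
Qed.

Let wYid := trunc_op_Yid V_nva.

Lemma smap_hexagon (t : tensor (tensor V V) V) m n :
  S (vop_id A' t n) m =
  act2 (in_z (vop_id A')) (act2 (in_x (S23 S)) (in_xz (S13 S) t)) m n.
Proof.
have sx23N := fl_op2_in_x (fl_op_S23 sEN); have sx23R := fl_op2_in_x (fl_op_S23 sER).
have sa13N := fl_op2_expand 1 (fl_op_S13 sEN); have sa13R := fl_op2_expand 1 (fl_op_S13 sER).
have sz12 := fl_op2_in_z (fl_op_S12 sE); have wz := trunc_op2_in_z wYid.
(* [Q1] and [Q2] are what E_21(-x) and F_12(x) turn into on crossing Y(z) ⊗ 1. *)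
pose Q1 := expa (S13 EN) \o2 in_x (S23 EN).
pose Q2 := expa (S13 ER) \o2 in_x (S23 ER).
have sQ1 : fl_op2 Q1 by apply: fl_op2_comp.
have sQ2 : fl_op2 Q2 by apply: fl_op2_comp.
have -> : vop_id A' = Yid A \o1 S12 E by rewrite -deformation_Yid.
have r1 t0 k a : EN (Yid A t0 k) a = act2 (in_z (Yid A)) (Q1 t0) a k.
  exact: (coactLn_Yid V_nva V_com L_mod L_comp).
have r2 t0 k a : ER (Yid A t0 k) a = act2 (in_z (Yid A)) (Q2 t0) a k.
  exact: (coactR_Yid H_bialg V_nva V_com R_mod R_comp).
rewrite {1}smapE (rule_comp_in sEN sER wYid sQ1 sQ2 (fl_op_S12 sE) r1 r2).
have -> : in_z (Yid A \o1 S12 E) = in_z (Yid A) \o2 in_z (S12 E).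
  by apply/funext => x; rewrite /comp2 in_z_comp //; case: wYid.
have e23 : in_x (S23 S) = in_x (S23 EN) \o2 in_x (S23 ER).
  apply/funext => x; rewrite /comp2 in_x_comp; last exact: ((fl_op_S23 sER).2 x).
    by congr (in_x _ x); apply/funext => y; rewrite S23_comp // -smapE.
  exact: (fl_trunc (fl_op_S23 sEN)).
have e13 : in_xz (S13 S) = expa (S13 EN) \o2 expa (S13 ER).
  apply/funext => x; rewrite /in_xz /comp2 [RHS]expand_comp; last exact: ((fl_op_S13 sER).2 x).
    by congr (expand_add _); rewrite S13_comp // -smapE.
  exact: (fl_trunc (fl_op_S13 sEN)).
have z23N : in_z (S12 E) \o2 in_x (S23 EN) = in_x (S23 EN) \o2 in_z (S12 E).
  exact: (subst_of_comm (fl_op_S12 sE) (fl_op_S23 sEN) (elem_comm12_23 elem_E elem_EN)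
    (subst_of_z _) (subst_of_x _)).
have z23R : in_z (S12 E) \o2 in_x (S23 ER) = in_x (S23 ER) \o2 in_z (S12 E).
  exact: (subst_of_comm (fl_op_S12 sE) (fl_op_S23 sER) (elem_comm12_23 elem_E elem_ER)
    (subst_of_z _) (subst_of_x _)).
have z13N : in_z (S12 E) \o2 expa (S13 EN) = expa (S13 EN) \o2 in_z (S12 E).
  exact: (subst_of_comm (fl_op_S12 sE) (fl_op_S13 sEN) (elem_comm12_13 elem_E elem_EN)
    (subst_of_z _) (subst_of_expand _ _)).
have z13R : in_z (S12 E) \o2 expa (S13 ER) = expa (S13 ER) \o2 in_z (S12 E).
  exact: (subst_of_comm (fl_op_S12 sE) (fl_op_S13 sER) (elem_comm12_13 elem_E elem_ER)
    (subst_of_z _) (subst_of_expand _ _)).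
have c12 : in_x (S23 ER) \o2 expa (S13 EN) = expa (S13 EN) \o2 in_x (S23 ER).
  exact: (subst_of_comm (fl_op_S23 sER) (fl_op_S13 sEN)
    (commute_ops_sym (elem_comm13_23 elem_EN elem_ER))
    (subst_of_x _) (subst_of_expand _ _)).
have c22 : in_x (S23 EN) \o2 expa (S13 EN) = expa (S13 EN) \o2 in_x (S23 EN).
  exact: (subst_of_comm (fl_op_S23 sEN) (fl_op_S13 sEN)
    (commute_ops_sym (elem_comm13_23 elem_EN elem_EN))
    (subst_of_x _) (subst_of_expand _ _)).
have c2R : in_x (S23 ER) \o2 expa (S13 ER) = expa (S13 ER) \o2 in_x (S23 ER).
  exact: (subst_of_comm (fl_op_S23 sER) (fl_op_S13 sER)
    (commute_ops_sym (elem_comm13_23 elem_ER elem_ER))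
    (subst_of_x _) (subst_of_expand _ _)).
set Z := in_z (S12 E) in sz12 z23N z23R z13N z13R *.
set N1 := expa (S13 EN) in sa13N Q1 sQ1 r1 e13 z13N c12 c22 *.
set N2 := in_x (S23 EN) in sx23N Q1 sQ1 r1 e23 z23N c22 *.
set R1 := expa (S13 ER) in sa13R Q2 sQ2 r2 e13 z13R c2R *.
set R2 := in_x (S23 ER) in sx23R Q2 sQ2 r2 e23 z23R c12 c2R *.
(* Only commuting factors are sorted; [Z] is E_12(z), which moves leftmost to turn Y(z) ⊗ 1 into
   Y'(z) ⊗ 1. *)
have key : (Q1 \o2 Q2) \o2 Z = Z \o2 ((N2 \o2 R2) \o2 (N1 \o2 R1)).
  rewrite -(comp2A (fl_trunc2 sQ1) sQ2 sz12) -(comp2A (fl_trunc2 sa13R) sx23R sz12).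
  rewrite -(comp2A (fl_trunc2 sa13N) sx23N (fl_op2_comp sa13R (fl_op2_comp sx23R sz12))).
  rewrite -(comp2A (fl_trunc2 sx23N) sx23R (fl_op2_comp sa13N sa13R)).
  rewrite (comp2_swap sz12 sx23N (fl_op2_comp sx23R (fl_op2_comp sa13N sa13R)) z23N).
  rewrite (comp2_swap sz12 sx23R (fl_op2_comp sa13N sa13R) z23R).
  rewrite (comp2_swap sz12 sa13N sa13R z13N) z13R.
  rewrite (comp2_swap sx23R sa13N (fl_op2_comp sa13R sz12) c12).
  rewrite (comp2_swap sx23R sa13R sz12 c2R).
  by rewrite (comp2_swap sx23N sa13N (fl_op2_comp sa13R (fl_op2_comp sx23R sz12)) c22).
rewrite e23 e13 -[act2 (Q1 \o2 Q2) _]/(((Q1 \o2 Q2) \o2 Z) t) key.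
have := congr1 (fun f => f t m n)
  (comp2A wz sz12 (fl_op2_comp (fl_op2_comp sx23N sx23R) (fl_op2_comp sa13N sa13R))).
exact.
Qed.

(** * The vacuum, the operator D and truncation *)

(** Y_M acts on the vacuum by the counit, which the counit axiom of [rho] absorbs. In particular the
    deformation has the same operator D as V. *)
Lemma deformation_vac v n : vop A' v (vac A) n = vop A v (vac A) n.
Proof.
rewrite /= -(rho_counit counit (g := fun v => vop A v (vac A) n)); last exact: vop_lin1.
apply: eq_tsum => a h.
rewrite /act1 (fsum_one (i0 := 0)) => [|m /negPf m0].
  by rewrite (mnva_vac L_mod) /const_series eqxx subr0 (linZ (vop_lin2 V_nva _ _)).
by rewrite (mnva_vac L_mod) /const_series m0 (lin0 (vop_lin2 V_nva _ _)).
Qed.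

Lemma smap_D1 t n : S (D1 A t) n = D1 A (S t n) + S t (n + 1) *~ (n + 1).
Proof.
have lD := lin_D1 V_nva; rewrite !smapE.
have f0 k := act1_supp k (fl_trunc sEN) (sER.2 t).
rewrite /act1 (lin_fsum_comm lD) //.
(* Leibniz's rule: the factor [n + 1] splits into the exponents [n + 1 - m] and [m] of the two
   operators. *)
have e2 : \sum_(m \in [set: int]) (EN (ER t m) (n + 1 - m) *~ (n + 1 - m) +
    EN (ER t m) (n + 1 - m) *~ m) =
    (\sum_(m \in [set: int]) EN (ER t m) (n + 1 - m)) *~ (n + 1).
  rewrite -[RHS]scaler_int (lin_fsum_comm (A := fun x => (n + 1)%:~R *: x)) //; last by lin.
  by apply: eq_fsumz => m; rewrite -mulrzDr subrK scaler_int.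
rewrite -e2 fsumD; try by apply: fsuppMz.
have e3 : \sum_(m \in [set: int]) EN (ER t m) (n + 1 - m) *~ m =
    \sum_(m \in [set: int]) EN (ER t (m + 1)) (n - m) *~ (m + 1).
  rewrite (fsum_shift _ 1); apply: eq_fsumz => m.
  by rewrite (_ : n + 1 - (m + 1) = n - m) //; ring.
have f3 : fsupp (fun m => EN (ER t (m + 1)) (n - m) *~ (m + 1)).
  have [s hs] : fsupp (fun m => EN (ER t (m + 1)) (n + 1 - (m + 1))).
    exact: (fsupp_inj (h := fun m : int => m + 1) (k := fun m => m - 1) (addrK _) (f0 (n + 1))).
  exists s => m /hs; rewrite (_ : n + 1 - (m + 1) = n - m); last by ring.
  by move=> ->; rewrite mul0rz.
rewrite e3 addrA -fsumD; [|exact: fsupp_lin|by apply: fsuppMz].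
rewrite -fsumD //; last first.
  have [s _ hs] := fsupp_cat (fsupp_lin lD (f0 n)) (fsuppMz (fun m => n + 1 - m) (f0 (n + 1))).
  by exists s => m /hs[-> ->]; rewrite addr0.
apply: eq_fsumz => m; rewrite (coactR_D H_bialg V_nva V_com R_mod R_comp).
rewrite (linD (sEN.1 _)) (linMz (sEN.1 _)) (coactLn_D H_bialg V_nva V_com L_mod L_comp).
by rewrite (_ : n - m + 1 = n + 1 - m) //; ring.
Qed.

Lemma smap_D t n :
  tmap (vD A') id (S t n) - S (tmap (vD A') id t) n = - (S t (n + 1) *~ (n + 1)).
Proof.
have -> : vD A' = vD A by apply/funext => v; apply: deformation_vac.
by rewrite -/(D1 A _) -/(D1 A t) smap_D1 opprD addrA subrr add0r.
Qed.

Lemma deformation_regular v n : n < 0 -> vop A' v (vac A') n = 0.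
Proof. by move=> n0; rewrite deformation_vac (nva_regular V_nva). Qed.

Lemma deformation_limit v : vop A' v (vac A') 0 = v.
Proof. by rewrite deformation_vac (nva_limit V_nva). Qed.

Lemma deformation_bilinear n : is_bilinear (fun a b => vop A' a b n).
Proof.
have e a b : vop A' a b n = act1 (Yt A) (E (a ⊗ b)) n by exact: deformation_vop.
have l : linear (fun p => act1 (Yt A) (E p) n) by apply: act1_lin => //; apply: trunc_op_Yt.
apply: bilinP => c x y z; rewrite !e.
  by apply: (lin_comp (f := fun x => x ⊗ c) l); lin.
by apply: (lin_comp (f := fun x => c ⊗ x) l); lin.
Qed.

Lemma deformation_truncated a b : truncated (vop A' a b).
Proof.
have [N h] := act1_trunc (trunc_op_Yt V_nva) (sE.2 (a ⊗ b)).
by exists N => n nN; rewrite deformation_vop h.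
Qed.

Lemma deformation_vacl w n : vop A' (vac A') w n = const_series w n.
Proof.
rewrite deformation_vop; have e m : E (vac A ⊗ w) m = vac A ⊗ const_series w m.
  rewrite (coactRE V_com) // (hom_vac (cnva_hom V_com)) /= tsumE; first last.
  - by move=> ?; apply: lin_pure2; apply: (mod_lin1 L_mod).
  - by move=> ?; lin.
  by rewrite (nvam_vac (mnva_module L_mod)).
rewrite /act1 (fsum_one (i0 := 0)) => [|m /negPf m0].
  by rewrite e YtE // subr0 (nvam_vac (nva_self V_nva)).
by rewrite e YtE // /const_series m0 (lin0 (vop_lin2 V_nva _ _)).
Qed.

(** * Weak associativity of the deformation *)

Notation YY := (fun t m n => Yt A (YL A t n) m).
Notation YI := (fun t m n => Yt A (Yid A t n) m).

Lemma trunc_op2_YY : trunc_op2 YY.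
Proof. exact: trunc_op2_iterate (trunc_op_Yt V_nva) (trunc_op_YL V_nva). Qed.

Lemma trunc_op2_YI : trunc_op2 YI.
Proof. exact: trunc_op2_iterate (trunc_op_Yt V_nva) wYid. Qed.

Definition X13_23 : tensor (tensor V V) V -> int -> int -> tensor (tensor V V) V :=
  in_x (S13 E) \o2 in_z (S23 E).

Lemma X13_23E t m n : X13_23 t m n = S13 E (S23 E t n) m.
Proof. by rewrite /X13_23 /comp2 in_x_in_z //; case: (fl_op_S13 sE). Qed.

Lemma fl_op2_X13_23 : fl_op2 X13_23.
Proof. exact: fl_op2_comp (fl_op2_in_x (fl_op_S13 sE)) (fl_op2_in_z (fl_op_S23 sE)). Qed.

Lemma X13_23_trunc t : exists N, forall a b, (a < N) || (b < N) -> X13_23 t a b = 0.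
Proof.
have [N hN] := act1_bound (fl_trunc (fl_op_S13 sE)) ((fl_op_S23 sE).2 t).
by exists N => a b h; rewrite X13_23E hN // orbC.
Qed.

Lemma subspace_tsum (X U W : lmodType F) (P : W -> Prop) (f : X -> U -> W) t :
  subspace P -> (forall p, p \in repr t -> P (f p.1 p.2)) -> P (tsum f t).
Proof.
move=> sP hP; rewrite /tsum /tev big_seq; apply: big_ind => //; first by case: sP.
by move=> x y; apply: subspaceD.
Qed.

(** Slots 1 and 2 undergo coactions while only slot 3 is acted on, so the generators come from
    [rho u] and [rho v], before [w] is known. *)
Lemma X13_23_lsup u v : exists l, forall w a b, lsup l (X13_23 (u ⊗ v ⊗ w) a b).
Proof.
exists [seq p.1 ⊗ q.1 | p <- repr (rho u), q <- repr (rho v)] => w a b.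
set l := [seq _ | _ <- _, _ <- _]; have sl := @lsup_subspace F _ V l.
rewrite X13_23E (S23_coactR V_com) // (lin_tsum _ _ ((fl_op_S13 sE).1 _)).
apply: (subspace_tsum (P := lsup l)) => // q qv.
rewrite (S13_coactR V_com) //; apply: (subspace_tsum (P := lsup l)) => // p pu.
apply: lsup_pure; apply: inspan_gen; apply/allpairsP.
by exists (p, q).
Qed.

(** Weak associativity of V with exponent [K], as a condition linear in [t]. In [YI] the first index
    is the exponent of x2, the second that of x0. *)
Definition assoc_rel K t : Prop :=
  truncated2 (mul_sub_pow K (YY t)) /\
  forall i q, subst_x1 (mul_sub_pow K (YY t)) i q = YI t q (i - Posz K).

Lemma truncated2_comb W (a : F) (s s' : int -> int -> (W : lmodType F)) :
  truncated2 s -> truncated2 s' -> truncated2 (fun m n => a *: s m n + s' m n).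
Proof.
case=> N h [N' h']; exists (Order.min N N') => m n hmn.
by rewrite h ?h' ?scaler0 ?addr0 //; lia.
Qed.

Lemma assoc_rel_subspace K : subspace (assoc_rel K).
Proof.
have [lK _] := trunc_op2_mul_sub_pow K trunc_op2_YY; have [lI _] := trunc_op2_YI.
split.
  have e : mul_sub_pow K (YY 0) = fun _ _ => 0.
    by apply/funext => m; apply/funext => n; rewrite (lin0 (lK m n)).
  rewrite /assoc_rel e; split=> [|i q]; first by exists 0.
  rewrite (lin0 (lI q _)) subst_x1E fsum0z // => m; exact: mul0rz.
move=> a x y [tx hx] [ty hy].
have e : mul_sub_pow K (YY (a *: x + y)) =
    fun m n => a *: mul_sub_pow K (YY x) m n + mul_sub_pow K (YY y) m n.
  by apply/funext => m; apply/funext => n; rewrite (lK m n).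
rewrite /assoc_rel e; split=> [|i q]; first exact: truncated2_comb.
rewrite (lI q) -hx -hy !subst_x1E -fsum_lin_comb.
- by apply: eq_fsumz => m; rewrite mulrzDl -!scaler_int !scalerA mulrC.
- by apply: fsuppMz; apply: truncated2_supp.
- by apply: fsuppMz; apply: truncated2_supp.
Qed.

Lemma assoc_rel_add j K t : assoc_rel K t -> assoc_rel (j + K) t.
Proof.
case=> tK hK; rewrite /assoc_rel mul_sub_pow_add; split=> [|i q].
  exact: truncated2_mul_sub_pow.
by rewrite subst_mul_sub_pow // hK; congr (Yt A (Yid A t _) q); lia.
Qed.

Lemma assoc_rel_lsup (l : seq (tensor V V)) :
  exists K, forall t : tensor (tensor V V) V, lsup l t -> assoc_rel K t.
Proof.
apply: lsup_rel => [K|j K t|u v]; [exact: assoc_rel_subspace|exact: assoc_rel_add|].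
have [k hk] := nvam_assoc (nva_self V_nva) u v; exists k => w; have [h1 h2] := hk w.
have e : YY (u ⊗ v ⊗ w) = fun m n => vop A u (vop A v w n) m.
  by apply/funext => m; apply/funext => n; rewrite YLE // YtE.
by rewrite /assoc_rel e; split=> // i q; rewrite YidE // YtE.
Qed.

Let P1 := exps (S12 E) \o2 in_x (S13 E).
Let P2 := expa (S13 E) \o2 in_x (S23 E).

Let sP1 : fl_op2 P1.
Proof. exact: fl_op2_comp (fl_op2_expand (-1) (fl_op_S12 sE)) (fl_op2_in_x (fl_op_S13 sE)). Qed.

Let sP2 : fl_op2 P2.
Proof. exact: fl_op2_comp (fl_op2_expand 1 (fl_op_S13 sE)) (fl_op2_in_x (fl_op_S23 sE)). Qed.

Lemma deformation_iter_r t m n : Yt A' (YL A' t n) m =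
  act2 YY (act2 (exps (S12 E)) (X13_23 t)) m n.
Proof.
rewrite deformation_Yt deformation_YL.
rewrite (rule_snd (trunc_op_Yt V_nva) sE (trunc_op_YL V_nva) sP1 (fl_op_S23 sE)); last first.
  by move=> t0 k a; exact: (coactR_YL V_nva V_com L_mod L_comp).
congr (act2 YY _ m n); have sx := fl_op2_in_x (fl_op_S13 sE).
have := congr1 (fun f => f t) (comp2A (fl_trunc2 (fl_op2_expand (-1) (fl_op_S12 sE))) sx
  (fl_op2_in_z (fl_op_S23 sE))).
by move=> /esym.
Qed.

(** The counterpart for Y'(Y'(u, x0)v, x2): in [P2] the variable x is x2 and z is x0, and E_12(x0)
    commutes past both factors. *)
Lemma deformation_iter_l t m n : Yt A' (Yid A' t n) m =
  act2 YI (act2 (in_z (S12 E)) (P2 t)) m n.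
Proof.
rewrite deformation_Yt deformation_Yid.
rewrite (rule_snd (trunc_op_Yt V_nva) sE wYid sP2 (fl_op_S12 sE)); last first.
  by move=> t0 k a; exact: (coactR_Yid H_bialg V_nva V_com L_mod L_comp).
congr (act2 YI _ m n).
have sz := fl_op2_in_z (fl_op_S12 sE); have sx := fl_op2_in_x (fl_op_S23 sE).
have sa := fl_op2_expand 1 (fl_op_S13 sE).
have z23 : in_z (S12 E) \o2 in_x (S23 E) = in_x (S23 E) \o2 in_z (S12 E).
  exact: (subst_of_comm (fl_op_S12 sE) (fl_op_S23 sE) (elem_comm12_23 elem_E elem_E)
    (subst_of_z _) (subst_of_x _)).
have z13 : in_z (S12 E) \o2 expa (S13 E) = expa (S13 E) \o2 in_z (S12 E).
  exact: (subst_of_comm (fl_op_S12 sE) (fl_op_S13 sE) (elem_comm12_13 elem_E elem_E)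
    (subst_of_z _) (subst_of_expand _ _)).
have key : P2 \o2 in_z (S12 E) = in_z (S12 E) \o2 P2.
  rewrite /P2 -(comp2A (fl_trunc2 sa) sx sz) -z23.
  by rewrite (comp2_swap sz sa sx z13).
exact: (congr1 (fun f => f t) key).
Qed.

Lemma deformation_YLE u v w m n :
  Yt A' (YL A' (u ⊗ v ⊗ w) n) m = vop A' u (vop A' v w n) m.
Proof.
rewrite /YL tassocE tmapE //; last by case: trunc_op_Yt'.
by rewrite !deformation_Yt -!deformation_vop.
Qed.

Lemma deformation_YidE u v w m n :
  Yt A' (Yid A' (u ⊗ v ⊗ w) n) m = vop A' (vop A' u v n) w m.
Proof.
rewrite /Yid amplifyE; last by case: trunc_op_Yt'.
by rewrite !deformation_Yt -!deformation_vop.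
Qed.

Lemma lsup_act2 (l l' : seq (tensor V V)) (B : tensor (tensor V V) V -> int -> int -> tensor (tensor V V) V) s m n :
  (forall a b m n, lsup l' (B (s a b) m n)) -> lsup l' (act2 B s m n).
Proof.
by move=> h; apply: (subspace_fsum (P := lsup l')) => [|p]; [exact: lsup_subspace|exact: h].
Qed.

Lemma lsupMz (l : seq (tensor V V)) (t : tensor (tensor V V) V) k : lsup l t -> lsup l (t *~ k).
Proof. by move=> h; apply: (subspaceMz (P := lsup l)) => //; apply: lsup_subspace. Qed.

Lemma deformation_assoc : weak_associativity (vop A') (vop A').
Proof.
move=> u v; have [l hl] := X13_23_lsup u v.
have [l' [C hC]] := @amplify_lsup F _ _ V E l sE.
have [K hK] := assoc_rel_lsup l'.
(* [C] clears the poles of E_12(x1 - x2) on span l ⊗ V and [K] serves on span l' ⊗ V, where the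
   result lies; both are fixed before [w]. *)
exists (K + C)%N => w; set t := u ⊗ v ⊗ w; pose X := X13_23 t.
have sX : flaurent2 X by case: fl_op2_X13_23 => _; apply.
have [N hN] := X13_23_trunc t.
pose Ex x c := S12 E x (c - Posz C).
have sEx : fl_op Ex by apply: fl_op_shift; apply: fl_op_S12.
have Ex0 x c : lsup l x -> c < 0 -> Ex x c = 0.
  by move=> lx c0; apply: (hC x lx).2; lia.
have Exl x c : lsup l x -> lsup l' (Ex x c) by move=> lx; apply: (hC x lx).1.
have hX a b : lsup l (X a b) by apply: hl.
pose Z := act2 (exps Ex) X.
have sZ : flaurent2 Z by apply: act2_ss => //; apply: (fl_op2_expand (-1)).
pose YK := fun x => mul_sub_pow K (YY x).
have wYK : trunc_op2 YK by apply: trunc_op2_mul_sub_pow; apply: trunc_op2_YY.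
have es : mul_sub_pow (K + C) (fun m n => vop A' u (vop A' v w n) m) = act2 YK Z.
  have -> : (fun m n => vop A' u (vop A' v w n) m) = act2 YY (act2 (exps (S12 E)) X).
    apply/funext => m; apply/funext => n.
    by rewrite -deformation_YLE deformation_iter_r.
  by rewrite (mul_sub_pow_exps _ _ trunc_op2_YY (fl_op_S12 sE) sX).
have Zl a b : lsup l' (Z a b).
  apply: (@lsup_act2 l) => a1 b1 m n; rewrite /expand_sub expandE.
  by apply: lsupMz; apply: Exl.
have ZN a b : (a < N) || (b < N) -> Z a b = 0.
  move=> h; apply: fsum0 => -[p q] /=.
  have [pq|/norP[p0 q0]] := boolP ((p < N) || (q < N)).
    rewrite (hN _ _ pq : X p q = 0); exact: (lin0 (lin_expand (-1) sEx.1 _ _)).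
  by apply: expand_sub_pos => [c|]; [apply: Ex0|lia].
(* Truncation in both variables is known only inside span l' ⊗ V, so a bound common to all
   coefficients of [Z] needs generators in that subspace. *)
have [M hM] : exists M, forall p : int * int, forall m n,
    (m < M) || (n < M) -> YK (Z p.1 p.2) m n = 0.
  apply: (finspan_unif_in (P := lsup l') (Q := fun M x => forall m n,
    (m < M) || (n < M) -> YK x m n = 0) _ _ sZ.2).
  - exact: lsup_subspace.
  - by move=> p; apply: Zl.
  - move=> M; split=> [m n _|a x y hx hy m n mn]; first exact: (lin0 (wYK.1 m n)).
    by rewrite (wYK.1 m n) hx // hy // scaler0 addr0.
  - by move=> M1 M2 x M12 h m n mn; apply: h; lia.
  - by move=> x /hK[[M h] _]; exists M.
cbv zeta; rewrite es; split.
  exists (N + M) => m n mn; apply: fsum0 => -[p q] /=.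
  have [pq|/norP[p0 q0]] := boolP ((p < N) || (q < N)).
    by rewrite ZN // (lin0 (wYK.1 _ _)).
  by apply: (hM (p, q)); lia.
move=> i p; rewrite (subst_act2 (N := Order.min N M)); first last.
- by move=> a b m n mn; apply: (hM (a, b)); lia.
- by move=> a b ab; apply: ZN; lia.
- by case: wYK.
have eZ : subst_x1 Z = act2 (fun x => subst_x1 (expand_sub (Ex x))) (subst_x1 X).
  apply: (subst_act2 (N := Order.min N 0)).
  - exact: lin_expand sEx.1.
  - by move=> a b ab; apply: hN; lia.
  - by move=> a b m n mn; apply: expand_sub_pos => [c|]; [apply: Ex0|lia].
have sXl a b : lsup l (subst_x1 X a b).
  rewrite subst_x1E; apply: (subspace_fsum (P := lsup l)) => [|m].
    exact: lsup_subspace.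
  exact: lsupMz.
(* Being free of poles, (x1 - x2)^C E_12(x1 - x2) turns into x0^C E_12(x0). *)
have eZ' : subst_x1 Z = act2 (in_x Ex) (subst_x1 X).
  rewrite eZ; apply: act2_congr => a b; apply/funext => m; apply/funext => n.
  by rewrite subst_expand_sub // => c; apply: Ex0.
have sZl a b : lsup l' (subst_x1 Z a b).
  rewrite subst_x1E; apply: (subspace_fsum (P := lsup l')) => [|m].
    exact: lsup_subspace.
  exact: lsupMz.
rewrite (act2_congr (B := fun x i q => YI x q (i - Posz K))); last first.
  move=> a b; apply/funext => j; apply/funext => q.
  by case: (hK _ (sZl a b)) => _ ->.
rewrite -deformation_YidE deformation_iter_l.
(* E_13(x1) E_23(x2) turns into E_13(x2 + x0) E_23(x2). *)
have eX b j : subst_x1 X j b = P2 t b j.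
  rewrite subst_x1E /P2 /comp2 act2_in_xr; last first.
    exact: (lin_expand 1 (fl_op_S13 sE).1).
  rewrite [RHS](fsum_sub _ (b + j)); apply: eq_fsumz => m.
  rewrite /X X13_23E /expand_add expandE (_ : b - (b + j - m) + j = m); last by ring.
  by rewrite /expker expr1n mul1r.
have eW a b : subst_x1 Z a b = act2 (in_z (S12 E)) (P2 t) b (a - Posz C).
  rewrite eZ' act2_in_x; last by case: sEx.
  rewrite act2_in_z; last by case: (fl_op_S12 sE).
  apply: eq_fsumz => j; rewrite eX /Ex; congr (S12 E _ _); ring.
rewrite /act2.
(* The indices trade places because the substitution lists x0 before x2; the shift by [C] is the
   factor x0^C. *)
pose h (x : int * int) : int * int := (x.2 + Posz C, x.1).
pose k (x : int * int) : int * int := (x.2, x.1 - Posz C).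
rewrite (fsum_bij (h := h) (k := k)); first last.
- by case=> a b; rewrite /h /k /= subrK.
- by case=> a b; rewrite /h /k /= addrK.
apply: eq_fsum => -[b a] /=; rewrite eW addrK.
by congr (Yt A (Yid A _ _) _); lia.
Qed.

Lemma deformation_nva : nonlocal_vertex_algebra A'.
Proof.
split; [split|exact: deformation_regular|exact: deformation_limit].
- exact: deformation_bilinear.
- exact: deformation_truncated.
- exact: deformation_vacl.
- exact: deformation_assoc.
Qed.

(** * S-locality *)

Definition swap12 (t : tensor (tensor V V) V) : tensor (tensor V V) V :=
  tmap (@tswap F V V) id t.

Lemma lin_swap12 : linear swap12.
Proof. by apply: (lin_tmap (h := id)) => //; apply: (lin_tswap (f := id)). Qed.

Lemma swap12E u v w : swap12 (u ⊗ v ⊗ w) = v ⊗ u ⊗ w.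
Proof. by rewrite /swap12 tmapE ?tswapE //; apply: (lin_tswap (f := id)). Qed.

Lemma S12_swap12 t n : S12 E (swap12 t) n = swap12 (S12 EB t n).
Proof.
have lt : linear (@tswap F V V) by apply: (lin_tswap (f := id)).
have [l1 _] := fl_op_S12 sE; have [l2 _] := fl_op_S12 sEB.
move: t; apply: (ext2 (f := fun t => S12 E (swap12 t) n) (g := fun t => swap12 (S12 EB t n))).
- exact: lin_comp (l1 n) lin_swap12.
- exact: lin_comp lin_swap12 (l2 n).
move=> p w; rewrite /swap12 tmapE // /S12 !tmapE; try by [case: sE|case: sEB|].
by rewrite coactL_swap // tswapK.
Qed.

Lemma S13_swap12 t n : S13 E (swap12 t) n = swap12 (S23 E t n).
Proof.
have [l1 _] := fl_op_S13 sE; have [l2 _] := fl_op_S23 sE.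
move: t; apply: (ext3 (f := fun t => S13 E (swap12 t) n) (g := fun t => swap12 (S23 E t n))).
- exact: lin_comp (l1 n) lin_swap12.
- exact: lin_comp lin_swap12 (l2 n).
move=> u v w; rewrite swap12E (S13_coactR V_com) // (S23_coactR V_com) // (lin_tsum _ _ lin_swap12).
by apply: eq_tsum => a h; rewrite swap12E.
Qed.

Lemma S23_swap12 t n : S23 E (swap12 t) n = swap12 (S13 E t n).
Proof.
have [l1 _] := fl_op_S23 sE; have [l2 _] := fl_op_S13 sE.
move: t; apply: (ext3 (f := fun t => S23 E (swap12 t) n) (g := fun t => swap12 (S13 E t n))).
- exact: lin_comp (l1 n) lin_swap12.
- exact: lin_comp lin_swap12 (l2 n).
move=> u v w; rewrite swap12E (S13_coactR V_com) // (S23_coactR V_com) // (lin_tsum _ _ lin_swap12).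
by apply: eq_tsum => a h; rewrite swap12E.
Qed.

(** Exchanging slots 1 and 2 along with the variables exchanges the two factors, which commute. *)
Lemma X13_23_swap12 t m n : X13_23 (swap12 t) m n = swap12 (X13_23 t n m).
Proof.
by rewrite !X13_23E S23_swap12 S13_swap12 (elem_comm13_23 elem_E elem_E).
Qed.

Lemma S12_EN t n : S12 EN t n = (-1) ^+ `|n|%N *: S12 EB t n.
Proof.
have [l1 _] := fl_op_S12 sEN; have [l2 _] := fl_op_S12 sEB.
move: t; apply: (ext2 (f := fun t => S12 EN t n)
  (g := fun t => (-1) ^+ `|n|%N *: S12 EB t n)) => [||p w].
- exact: l1.
- by apply: lin_scale; apply: l2.
rewrite /S12 !tmapE; try by [case: sEB|case: sEN].
by rewrite -(linZ (f := fun x => x ⊗ w)) //; lin.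
Qed.

(** Locality of V as a condition linear in [t]. The sign appears because exchanging the indices
    turns the power into (x2 - x1)^K. *)
Definition loc_rel K t : Prop := forall m n,
  mul_sub_pow K (YY t) m n = (-1) ^+ K *: mul_sub_pow K (YY (swap12 t)) n m.

Lemma loc_rel_subspace K : subspace (loc_rel K).
Proof.
have [lK _] := trunc_op2_mul_sub_pow K trunc_op2_YY; split=> [m n|a x y hx hy m n].
  by rewrite (lin0 lin_swap12) !(lin0 (lK _ _)) scaler0.
by rewrite (lK m n) hx hy lin_swap12 (lK n m) scalerDr !scalerA [a * _]mulrC.
Qed.

Lemma loc_rel_add j K t : loc_rel K t -> loc_rel (j + K) t.
Proof.
move=> hK m n; rewrite !mul_sub_pow_add.
have -> : mul_sub_pow K (YY t) = fun m n => (-1) ^+ K *: mul_sub_pow K (YY (swap12 t)) n m.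
  by apply/funext => i; apply/funext => i'; apply: hK.
by rewrite mul_sub_powZ mul_sub_pow_tr scalerA -exprD addnC.
Qed.

Hypothesis V_local : forall u v, exists k : nat, forall w m n, mul_sub_pow k
  (fun m n => vop A u (vop A v w n) m - vop A v (vop A u w m) n) m n = 0.

Lemma loc_rel_lsup (l : seq (tensor V V)) :
  exists K, forall t : tensor (tensor V V) V, lsup l t -> loc_rel K t.
Proof.
apply: lsup_rel => [K|j K t|u v]; [exact: loc_rel_subspace|exact: loc_rel_add|].
have [k hk] := V_local u v; exists k => w m n; have := hk w m n.
have e1 : YY (u ⊗ v ⊗ w) = fun m n => vop A u (vop A v w n) m.
  by apply/funext => i; apply/funext => j; rewrite YLE // YtE.
have e2 : YY (swap12 (u ⊗ v ⊗ w)) = fun m n => vop A v (vop A u w n) m.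
  by apply/funext => i; apply/funext => j; rewrite swap12E YLE // YtE.
rewrite mul_sub_powB e1 e2 => /eqP; rewrite subr_eq0 => /eqP ->.
by rewrite -mul_sub_pow_tr.
Qed.

Lemma comm_X13_23_S12 : X13_23 \o2 exps (S12 S) = exps (S12 S) \o2 X13_23.
Proof.
have s13 := fl_op_S13 sE; have s23 := fl_op_S23 sE; have sS12 := fl_op_S12 fl_op_smap.
have e12 : S12 S = S12 EN \o1 S12 ER by apply/funext => t; rewrite S12_comp // -smapE.
have c13 : commute_ops (S13 E) (S12 S).
  apply: commute_ops_sym; rewrite e12; apply: commute_ops_comp => //; try exact: fl_op_S12.
    exact: elem_comm12_13 elem_EN elem_E.
  exact: elem_comm12_13 elem_ER elem_E.
have c23 : commute_ops (S23 E) (S12 S).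
  apply: commute_ops_sym; rewrite e12; apply: commute_ops_comp => //; try exact: fl_op_S12.
    exact: elem_comm12_23 elem_EN elem_E.
  exact: elem_comm12_23 elem_ER elem_E.
have sx := fl_op2_in_x s13; have sz := fl_op2_in_z s23; have sS := fl_op2_expand (-1) sS12.
have e1 : in_x (S13 E) \o2 exps (S12 S) = exps (S12 S) \o2 in_x (S13 E).
  exact: (subst_of_comm s13 sS12 c13 (subst_of_x _) (subst_of_expand _ _)).
have e2 : in_z (S23 E) \o2 exps (S12 S) = exps (S12 S) \o2 in_z (S23 E).
  exact: (subst_of_comm s23 sS12 c23 (subst_of_z _) (subst_of_expand _ _)).
rewrite /X13_23 -(comp2A (fl_trunc2 sx) sz sS) e2.
by rewrite (comp2_swap sx sS sz e1).
Qed.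

(** In E_12(x) E_21(-x) F_12(x) the first two factors commute, after which E_12 meets its
    inverse. *)
Lemma S12_E_smap : exps (S12 E) \o2 exps (S12 S) = exps (S12 EN).
Proof.
have sS := fl_op_smap; have s12 := fl_op_S12 sE.
apply/funext => t; rewrite /comp2 [LHS](expand_comp (-1) (fl_trunc s12) ((fl_op_S12 sS).2 t)).
congr expand_sub; rewrite S12_comp //; congr (S12 _ t); apply/funext => p.
rewrite smapE (act1_assoc (fl_trunc sE) sEN (sER.2 p)).
rewrite (act1_congr (B := EN \o1 E)) => [|m]; last first.
  by rewrite (act1_comm (B := EN)) // => i j x; apply: (elem_comm elem_E elem_EN).
rewrite -(act1_assoc (fl_trunc sEN) sE (sER.2 p)) coactR_inv //.
by rewrite act1_constr //; case: sEN.
Qed.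

Lemma vop2_YY w p : vop2 A' w p = fun m n => Yt A' (YL A' (p ⊗ w) n) m.
Proof.
apply/funext => m; apply/funext => n.
have l : linear (fun p => Yt A' (YL A' (p ⊗ w) n) m).
  have [lY _] := trunc_op_Yt V_nva.
  have e p' : Yt A' (YL A' (p' ⊗ w) n) m = act2 YY (act2 (exps (S12 E)) (X13_23 (p' ⊗ w))) m n.
    exact: deformation_iter_r.
  move=> a x y; rewrite !e (pure_bilinear _ V).1.
  by apply: (act2_lin trunc_op2_YY (fl_op2_comp (fl_op2_expand (-1) (fl_op_S12 sE)) fl_op2_X13_23)).
by rewrite /vop2 (tsum_pureE p l); apply: eq_tsum => a b; rewrite deformation_YLE.
Qed.

Lemma smap_local u v : exists k : nat, forall w m n,
  mul_sub_pow k (act2 (vop2 A' w) (expand_sub (S (u ⊗ v)))) m n =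
  mul_sub_pow k (fun m n => vop A' v (vop A' u w m) n) m n.
Proof.
have [l hl] := X13_23_lsup u v.
have [l' [C hC]] := @amplify_lsup F _ _ V EN l sEN.
have [K hK] := loc_rel_lsup l'.
have s12 := fl_op_S12 sE; have s12N := fl_op_S12 sEN; have sS12 := fl_op_S12 fl_op_smap.
have sX := fl_op2_X13_23; have seE := fl_op2_expand (-1) s12; have seS := fl_op2_expand (-1) sS12.
exists (K + C)%N => w m n; set t := u ⊗ v ⊗ w; pose X := X13_23 t.
have hX a b : lsup l (X a b) by apply: hl.
pose Nx x c := S12 EN x (c - Posz C); pose Ex x c := S12 E x (c - Posz C).
have Nx0 x c : lsup l x -> c < 0 -> Nx x c = 0.
  by move=> lx c0; apply: (hC x lx).2; lia.
pose YK := fun x => mul_sub_pow K (YY x).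
pose ZN := act2 (exps Nx) X; pose ZE := act2 (exps Ex) (X13_23 (swap12 t)).
have -> : mul_sub_pow (K + C) (act2 (vop2 A' w) (expand_sub (S (u ⊗ v)))) = act2 YK ZN.
  have -> : act2 (vop2 A' w) (expand_sub (S (u ⊗ v))) =
      act2 (fun x m n => Yt A' (YL A' x n) m) (expand_sub (S12 S t)).
    apply/funext => i; apply/funext => j; apply: eq_fsum => p.
    rewrite vop2_YY /expand_sub !expandE /t S12E; last by case: fl_op_smap.
    by rewrite -(linMz (f := fun x => x ⊗ w)) //; lin.
  have -> : (fun x m n => Yt A' (YL A' x n) m) = YY \o2 (exps (S12 E) \o2 X13_23).
    by apply/funext => x; apply/funext => i; apply/funext => j; apply: deformation_iter_r.
  (* S moves left past E_13 E_23 and is absorbed by E_12(x1 - x2), which leaves E_21(-(x1 - x2)). *)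
  have key : (YY \o2 (exps (S12 E) \o2 X13_23)) \o2 exps (S12 S) =
      YY \o2 (exps (S12 EN) \o2 X13_23).
    rewrite -(comp2A trunc_op2_YY (fl_op2_comp seE sX) seS) -(comp2A (fl_trunc2 seE) sX seS).
    by rewrite comm_X13_23_S12 (comp2A (fl_trunc2 seE) seS sX) S12_E_smap.
  rewrite -[act2 _ (expand_sub (S12 S t))]/
    (((YY \o2 (exps (S12 E) \o2 X13_23)) \o2 exps (S12 S)) t) key.
  exact: (mul_sub_pow_exps _ _ trunc_op2_YY s12N (sX.2 t)).
have -> : (fun m n => vop A' v (vop A' u w m) n) =
    fun m n => act2 YY (act2 (exps (S12 E)) (X13_23 (swap12 t))) n m.
  apply/funext => i; apply/funext => j.
  by rewrite -deformation_iter_r /t swap12E deformation_YLE.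
rewrite (mul_sub_pow_tr _ (act2 YY (act2 (exps (S12 E)) (X13_23 (swap12 t))))).
rewrite (mul_sub_pow_exps _ _ trunc_op2_YY s12 (sX.2 (swap12 t))) -/YK -/ZE.
(* The other side has E_12(x2 - x1) on exchanged slots, that is E_21(-(x1 - x2)) on the original
   ones. Once [C] factors have cleared the poles, both directions of expansion agree; the sign
   compares (x2 - x1)^C with (x1 - x2)^C. *)
have eZ a b : ZE b a = (-1) ^+ C *: swap12 (ZN a b).
  rewrite /ZE /ZN /act2 (lin_fsum_comm lin_swap12); last first.
    have sN : fl_op2 (exps Nx) by apply: (fl_op2_expand (-1)); apply: fl_op_shift.
    exact: (act2_supp a b (fl_trunc2 sN) (sX.2 t)).
  rewrite fsum_scale ?signr_eq0 //.
  rewrite (fsum_bij (h := fun p : int * int => (p.2, p.1))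
    (k := fun p : int * int => (p.2, p.1))) => [|[]|[]] //.
  apply: eq_fsum => -[p q] /=; rewrite X13_23_swap12 -/(X p q).
  have lx : lsup l (X p q) by apply: hX.
  have eE c : Ex (swap12 (X p q)) c = (-1) ^+ C *: ((-1) ^+ `|c|%N *: swap12 (Nx (X p q) c)).
    rewrite /Ex /Nx S12_swap12 S12_EN (linZ lin_swap12) !scalerA -[(-1) ^+ C]/((-1) ^+ `|Posz C|%N).
    rewrite -mulrA -!signzD -signr_odd (_ : odd _ = false) ?expr0 ?scale1r //.
    by lia.
  have -> : expand_sub (Ex (swap12 (X p q))) (b - q) (a - p) =
      (-1) ^+ C *: expand_sub (fun c => (-1) ^+ `|c|%N *: swap12 (Nx (X p q) c)) (b - q) (a - p).
    by rewrite /expand_sub !expandE eE scalerMzr.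
  rewrite expand_sub_tr => [|c c0]; last by rewrite Nx0 // (lin0 lin_swap12).
  by rewrite /expand_sub !expandE (linMz lin_swap12).
have ZNl a b : lsup l' (ZN a b).
  apply: (@lsup_act2 l) => a1 b1 i j; rewrite /expand_sub expandE.
  by apply: lsupMz; apply: (hC _ (hX a1 b1)).1.
rewrite /act2 fsum_scale ?signr_eq0 //.
rewrite [RHS](fsum_bij (h := fun p : int * int => (p.2, p.1))
  (k := fun p : int * int => (p.2, p.1))) => [|[]|[]] //.
apply: eq_fsum => -[a b] /=; have [lK _] := trunc_op2_mul_sub_pow K trunc_op2_YY.
rewrite /YK (hK _ (ZNl a b)) eZ (linZ (lK _ _)) scalerA exprD -mulrA -expr2 sqrr_sign.
by rewrite mulr1.
Qed.

(** * The weak quantum vertex algebra relation *)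

Lemma deformation_weak_local u v :
  exists (k N : nat) (u' v' : 'I_N -> V) (f : 'I_N -> int -> F),
    (forall i, truncated (f i)) /\
    forall w m n,
      mul_sub_pow k (fun m n => vop A' u (vop A' v w n) m) m n =
      mul_sub_pow k (fun m n => \sum_(i < N)
        act2 (fun (c : F) m n => c *: vop A' (v' i) (vop A' (u' i) w m) n)
          (fun m n => expand_sub (f i) n m) m n) m n.
Proof.
(* The required relation is S-locality for the pair [v], [u] with x and z exchanged, so that the
   series of S(v ⊗ u) appear at z - x. *)
have [k hk] := smap_local v u.
have [N0 [t [f0 [tf0 eS]]]] := ss_finite_laurent (fl_op_smap.2 (v ⊗ u)).
(* The [t i] are tensors rather than pure ones: [l] lists all their pure terms, tagged with the
   index [i] of the series that multiplies them. *)
pose l := [seq (i, p) | i <- enum 'I_N0, p <- repr (t i)].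
pose x (j : 'I_(size l)) := tnth (in_tuple l) j.
pose g j := f0 (x j).1.
have eSl c : S (v ⊗ u) c = \sum_(j < size l) g j c *: ((x j).2.1 ⊗ (x j).2.2).
  rewrite eS -(big_tnth _ _ l xpredT (fun y => f0 y.1 c *: (y.2.1 ⊗ y.2.2))) /l.
  rewrite big_allpairs_dep big_enum; apply: eq_bigr => i _ /=.
  by rewrite {1}(tensorE (t i)) /tsum /tev scaler_sumr.
exists k, (size l), (fun j => (x j).2.2), (fun j => (x j).2.1), g.
split=> [j|w m n]; first exact: tf0.
pose G := vop2 A' w.
have wG : trunc_op2 G.
  have -> : G = fun p m n => act2 YY (act2 (exps (S12 E)) (X13_23 (p ⊗ w))) m n.
    apply/funext => p; rewrite /G vop2_YY; apply/funext => i; apply/funext => j.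
    exact: deformation_iter_r.
  have [l2 z2] := trunc_op2_comp trunc_op2_YY
    (fl_op2_comp (fl_op2_expand (-1) (fl_op_S12 sE)) fl_op2_X13_23).
  split=> [i j|p]; last exact: z2.
  have lw : linear (fun p : tensor V V => p ⊗ w) by lin.
  exact: (lin_comp (l2 i j) lw).
have -> : (fun m n => \sum_(j < size l)
      act2 (fun (c : F) m n => c *: vop A' (x j).2.1 (vop A' (x j).2.2 w m) n)
        (fun m n => expand_sub (g j) n m) m n) =
    fun m n => act2 G (expand_sub (S (v ⊗ u))) n m.
  apply/funext => i; apply/funext => j.
  transitivity (\sum_(y < size l) \sum_(p \in [set: int * int])
      (expand_sub (g y) p.1 p.2 : F) *: G ((x y).2.1 ⊗ (x y).2.2) (j - p.1) (i - p.2)).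
    apply: eq_bigr => y _; rewrite [LHS](fsum_bij (h := fun p : int * int => (p.2, p.1))
      (k := fun p : int * int => (p.2, p.1))) => [|[]|[]] //.
    by apply: eq_fsum => -[p q] /=; rewrite /G vop2_YY deformation_YLE.
  rewrite -fsum_big; last first.
    move=> y; pose B (c : F^o) m n := (c : F) *: G ((x y).2.1 ⊗ (x y).2.2) m n.
    have wB : trunc_op2 B.
      split=> [a b|c X]; first by apply: lin_scalel; apply: lin_id.
      have [N hN] := wG.2 ((x y).2.1 ⊗ (x y).2.2) X.
      by exists N => a b bX h; rewrite /B hN ?scaler0.
    (* A scalar series has coefficients in the line spanned by 1, so the support lemma for operator
       series applies to it. *)
    have sg' : flaurent (g y : int -> F^o).
      split; first exact: tf0.
      exists [:: 1 : F^o] => c; rewrite -[g y c]mulr1.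
      apply: (subspaceZ (W := F^o) (P := inspan [:: 1 : F^o]) (g y c)); first exact: inspanP.
      by apply: inspan_gen; rewrite mem_seq1.
    exact: (act2_supp j i wB (flaurent2_expand (-1) sg')).
  apply: eq_fsum => -[p q] /=; rewrite /expand_sub expandE eSl.
  rewrite (linMz (wG.1 _ _)) (lin_big _ _ (wG.1 _ _)) big_mulz; apply: eq_bigr => y _.
  by rewrite (linZ (wG.1 _ _)) /expand_sub expandE scalerMzl.
by rewrite (mul_sub_pow_tr k (act2 G (expand_sub (S (v ⊗ u))))) /G hk
  -(mul_sub_pow_tr k (fun m n => vop A' u (vop A' v w m) n)).
Qed.

Lemma deformation_quantum : quantum_vertex_algebra A' S.
Proof.
split.
- by split; [exact: deformation_nva|exact: deformation_weak_local].
- exact: smap_qyb.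
- exact: smap_unitary.
- exact: smap_local.
- exact: smap_D.
- exact: smap_hexagon.
Qed.
End Deformation.

Theorem theorem3p6 (R : realType)
  (H : lmodType R[i]) (AH : vertex_struct H)
  (Delta : {linear H -> tensor H H}) (eps : {linear H -> (R[i])^o})
  (H_bialgebra : nonlocal_vertex_bialgebra AH Delta eps)
  (H_cocomm : cocommutative Delta)
  (V : lmodType R[i]) (A : vertex_struct V)
  (V_va : vertex_algebra A)
  (rho : {linear V -> tensor V H})
  (V_comodule : comodule_nva AH Delta eps A rho)
  (YM YMinv : H -> V -> int -> V)
  (YM_comm : commutative_subset AH Delta eps A rho [set YM; YMinv]%classic)
  (YM_inv : conv_inverses Delta eps YM YMinv) :
  let S := smap rho YM YMinv in
  rational_qyb_operator S /\ unitary_operator S /\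
  quantum_vertex_algebra (deformation A rho YM) S.
Proof.
have [LR1 RL1] := YM_inv; have [sub comm] := YM_comm.
have hL : [set YM; YMinv]%classic YM by left.
have hR : [set YM; YMinv]%classic YMinv by right.
have [L_mod L_comp] := sub _ hL; have [R_mod R_comp] := sub _ hR.
have q := deformation_quantum H_bialgebra H_cocomm (va_nva V_va) V_comodule
  L_mod L_comp R_mod R_comp (comm _ _ hL hL) (comm _ _ hL hR) (comm _ _ hR hR)
  LR1 RL1 (va_local V_va).
by split; [exact: qva_qyb q|split; [exact: qva_unitary q|exact: q]].
Qed.
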